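(* Let $x:M\rightarrow \mathbb{H}^3\times \mathbb{R}$ be a class $\mathcal{A}$ hypersurface with nowhere vanishing $T$ and with three distinct principal curvatures $k_1,k_2,k_3$ (i.e. $k_i-k_j$ vanishes nowhere for $i\neq j$) satisfying $ST=k_1T$. Assume that there are functional relations $k_2=f_1(k_1)$ and $k_3=f_2(k_1)$ for some smooth functions $f_1$ and $f_2$. Then, up to an isometry of $\mathbb{H}^3\times\mathbb{R}$, $M$ is an open part of a hypersurface of the form $$x(s,v,w)=\big(\cosh(\alpha_1(s))\cosh v,\ \cosh(\alpha_1(s))\sinh v,\ \sinh(\alpha_1(s))\cos w,\ \sinh(\alpha_1(s))\sin w,\ \alpha_2(s)\big),$$ where $\alpha_1,\alpha_2$ are smooth functions satisfying $\alpha_1'(s)^2+\alpha_2'(s)^2=1$ and $\sinh(\alpha_1(s))>0$.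
   Context: $\mathbb{L}^5$ is $\mathbb{R}^5$ with the Minkowski metric $-dx_1^2+dx_2^2+dx_3^2+dx_4^2+dx_5^2$, and $\mathbb{H}^3\times\mathbb{R}=\{(x_1,\dots,x_5)\in\mathbb{L}^5 : -x_1^2+x_2^2+x_3^2+x_4^2=-1,\ x_1>0\}$ with the induced Riemannian metric. $M$ is an oriented 3-dimensional hypersurface with unit normal vector field $N$ (in $\mathbb{H}^3\times\mathbb{R}$) and shape operator $SX=-\widetilde\nabla_XN$, where $\widetilde\nabla$ is the Levi-Civita connection of $\mathbb{H}^3\times\mathbb{R}$. The tangent vector field $T$ and the function $\sigma$ on $M$ are defined by $\frac{\partial}{\partial x_5}\big|_M=T+\sigma N$. Principal curvatures are the eigenvalues of $S$. $M$ belongs to class $\mathcal{A}$ if $T$ is a principal direction of $M$.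
   Formalization: M is assumed connected; otherwise two pieces placed by different isometries of H^3×R would satisfy all hypotheses without lying on a single hypersurface of the stated form. *)

(* Defs.v *)
From HB Require Import structures.
From mathcomp Require Import all_boot all_order all_algebra.
From mathcomp Require Import all_classical all_reals all_analysis.

Set Implicit Arguments.
Unset Strict Implicit.
Unset Printing Implicit Defensive.

Import Order.TTheory GRing.Theory Num.Theory.
Import numFieldNormedType.Exports.

Local Open Scope classical_set_scope.
Local Open Scope ring_scope.

Section Smoothness.
Context {R : realType} {V W : normedModType R}.

(* Only meant for D open. *)
Fixpoint Ck_on (k : nat) (D : set V) (f : V -> W) : Prop :=
  match k with
  | 0%N => forall p, D p -> {for p, continuous f}
  | k'.+1 => (forall p, D p -> differentiable f p) /\
             (forall v : V, Ck_on k' D ('D_v f))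
  end.

Definition smooth_on (D : set V) (f : V -> W) : Prop :=
  forall k, Ck_on k D f.

End Smoothness.

Section Manifold.
Context {R : realType} {M : topologicalType}.

(* The values of chart_map outside chart_dom, and of chart_inv outside the
   image of chart_dom, are irrelevant. *)
Record chart := Chart {
  chart_dom : set M;
  chart_map : M -> 'rV[R]_3;
  chart_inv : 'rV[R]_3 -> M }.

Definition chart_cod (c : chart) : set 'rV[R]_3 := chart_map c @` chart_dom c.

Definition is_chart (c : chart) : Prop :=
  [/\ open (chart_dom c), open (chart_cod c),
      (forall p, chart_dom c p -> chart_inv c (chart_map c p) = p),
      (forall p, chart_dom c p -> {for p, continuous (chart_map c)}) &
      (forall u, chart_cod c u -> {for u, continuous (chart_inv c)})].

Definition smooth_transition (c c' : chart) : Prop :=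
  smooth_on (chart_map c @` (chart_dom c `&` chart_dom c'))
            (chart_map c' \o chart_inv c).

Definition compatible (c c' : chart) : Prop :=
  smooth_transition c c' /\ smooth_transition c' c.

Definition smooth_atlas (A : set chart) : Prop :=
  [/\ (forall c, A c -> is_chart c),
      (forall p, exists2 c, A c & chart_dom c p) &
      (forall c c', A c -> A c' -> compatible c c')].

Definition manifold3 (A : set chart) : Prop :=
  [/\ hausdorff_space M, @second_countable M, connected [set: M] &
      smooth_atlas A].

Definition smooth_chart (A : set chart) (c : chart) : Prop :=
  is_chart c /\ forall c', A c' -> compatible c c'.

Definition smooth (W : normedModType R) (A : set chart) (f : M -> W) : Prop :=
  forall c, A c -> smooth_on (chart_cod c) (f \o chart_inv c).

(* The differential of f at p in the chart c: a tangent vector of M at p is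
   given by its coordinates u : 'rV_3 in c, and df(u) = u *m dmx f c p. *)
Definition dmx n (f : M -> 'rV[R]_n.+1) (c : chart) (p : M) : 'M[R]_(3, n.+1) :=
  'J (f \o chart_inv c) (chart_map c p).

End Manifold.
Arguments chart R M : clear implicits.

Section Ambient.
Context {R : realType}.

Definition eta : 'M[R]_5 := diag_mx (\row_j (if j == 0 then -1 else 1)).

Definition lor (u v : 'rV[R]_5) : R := (u *m eta *m v^T) 0 0.

Definition e5 : 'rV[R]_5 := delta_mx 0 4.

Definition H3R : set 'rV[R]_5 :=
  [set p : 'rV[R]_5 | - p 0 0 ^+ 2 + p 0 1 ^+ 2 + p 0 2 ^+ 2 + p 0 3 ^+ 2 = -1 /\
           0 < p 0 0].

(* (p_1, ..., p_4, 0): at p in H3R it spans the normal line of H3R in L^5,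
   and lor (nu p) (nu p) = -1. *)
Definition nu (p : 'rV[R]_5) : 'rV[R]_5 := \row_j (if j == 4 then 0 else p 0 j).

Definition tangent_H3R (p v : 'rV[R]_5) : Prop := lor v (nu p) = 0.

(* Riemannian isometries of H3R; smoothness is that of a map which extends
   smoothly to a neighbourhood of the submanifold H3R of R^5. *)
Definition isometry_H3R (Phi : 'rV[R]_5 -> 'rV[R]_5) : Prop :=
  [/\ set_bij H3R H3R Phi,
      (exists U, [/\ open U, H3R `<=` U & smooth_on U Phi]) &
      (forall p u v, H3R p -> tangent_H3R p u -> tangent_H3R p v ->
        lor ('D_u Phi p) ('D_v Phi p) = lor u v)].

End Ambient.

Section Hypersurface.
Context {R : realType} {M : topologicalType}.
Implicit Types (A : set (chart R M)) (c : chart R M) (x N V T : M -> 'rV[R]_5).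

Definition immersion_H3R A x : Prop :=
  [/\ smooth A x, (forall p, H3R (x p)) &
      (forall c p, A c -> chart_dom c p -> row_free (dmx x c p))].

Definition tangent_field A x T : Prop :=
  forall c p, A c -> chart_dom c p -> (T p <= dmx x c p)%MS.

Definition unit_normal A x N : Prop :=
  [/\ smooth A N,
      (forall p, tangent_H3R (x p) (N p)),
      (forall p, lor (N p) (N p) = 1) &
      (forall c p (u : 'rV[R]_3), A c -> chart_dom c p ->
        lor (N p) (u *m dmx x c p) = 0)].

(* The Levi-Civita connection of H3R is the tangential part of the flat
   connection of L^5, so for V along x with values tangent to H3R,
     nabla_u V = D_u V + lor (D_u V) (nu x) nu x = u *m nabla_mx x V c p. *)
Definition nabla_mx x V c (p : M) : 'M[R]_(3, 5) :=
  dmx V c p + dmx V c p *m eta *m (nu (x p))^T *m nu (x p).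

(* The shape operator in the chart c, acting on coordinates by u |-> u *m S.
   Since nabla_u N is tangent to M, S is the only matrix such that
     S *m dmx x c p = - nabla_mx x N c p. *)
Definition shape x N c (p : M) : 'M[R]_3 :=
  - nabla_mx x N c p *m pinvmx (dmx x c p).

Definition principal_curvature A x N (k : M -> R) : Prop :=
  forall c p, A c -> chart_dom c p -> eigenvalue (shape x N c p) (k p).

(* S T = k T, where t is the coordinate vector of T p in c. *)
Definition shape_scales A x N T (k : M -> R) : Prop :=
  forall c p, A c -> chart_dom c p ->
  exists2 t : 'rV[R]_3, T p = t *m dmx x c p & t *m shape x N c p = k p *: t.

Definition class_A A x N T : Prop := exists k : M -> R, shape_scales A x N T k.

End Hypersurface.

Section Model.
Context {R : realType}.

Definition cosh (z : R) : R := (expR z + expR (- z)) / 2.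
Definition sinh (z : R) : R := (expR z - expR (- z)) / 2.

Definition model (a1 a2 : R -> R) (s v w : R) : 'rV[R]_5 :=
  \row_j [:: cosh (a1 s) * cosh v; cosh (a1 s) * sinh v;
             sinh (a1 s) * cos w; sinh (a1 s) * sin w; a2 s]`_j.

Definition profile (I : set R) (a1 a2 : R -> R) : Prop :=
  [/\ open I, is_interval I, smooth_on I a1, smooth_on I a2 &
      forall s, I s -> derive1 a1 s ^+ 2 + derive1 a2 s ^+ 2 = 1 /\ 0 < sinh (a1 s)].

(* The immersed hypersurface y is an open part of the model hypersurface: every
   point of M has a neighbourhood on which (s, v, w) are coordinates of the
   smooth structure of M (so a diffeomorphism onto an open subset of I x R x R)
   and y is given by the model. No global choice of w is possible in general. *)
Definition open_part_of_model {M : topologicalType} (A : set (chart R M))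
    (y : M -> 'rV[R]_5) (I : set R) (a1 a2 : R -> R) : Prop :=
  forall p, exists c : chart R M,
    [/\ smooth_chart A c, chart_dom c p &
        forall q, chart_dom c q ->
          let u := chart_map c q in
          I (u 0 0) /\ y q = model a1 a2 (u 0 0) (u 0 1) (u 0 2)].

End Model.

(* Main.v *)
Require Import Defs.
From HB Require Import structures.
From mathcomp Require Import all_boot all_order all_algebra.
From mathcomp Require Import all_classical all_reals all_analysis.
From mathcomp Require Import ring lra.
Set Implicit Arguments.
Unset Strict Implicit.
Unset Printing Implicit Defensive.
Import Order.TTheory GRing.Theory Num.Theory.
Import numFieldNormedType.Exports.
Local Open Scope classical_set_scope.
Local Open Scope ring_scope.

(** Let h be the height x_5, sigma = <N, e5>, X the component of x in H^3 (so that
    <X, X> = -1), xi the unit vector along the horizontal part of - N, and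
    m_i = k_i / sqrt (1 - sigma^2).  All differentials below are taken along M.

    Since T is principal, d sigma = - k1 dh; closedness of d sigma makes dk1, and through the
    relations k2 = f1(k1), k3 = f2(k1) also dm2 and dm3, proportional to dh.  With
    c = sigma / sqrt (1 - sigma^2), the vector valued 1-forms d xi - c dh X and d X - c dh xi
    vanish on T and act on the principal directions E2, E3 as m_i and 1.  Hence their
    combination with coefficient m2 takes values in the line of E3, the one with m3 in the line
    of E2 ([principal_form]).  Schwarz's theorem for X and xi turns this into three facts:
    dm2 = c (1 - m2^2) dh ([riccati]), m2 m3 = 1, that is k2 k3 = 1 - sigma^2
    ([principal_product]), and the plane spanned by E2 and X - m2 xi does not move
    ([plane_quadratic_locally_constant], [plane_constant]).

    Because m2 m3 = 1 and m2 <> m3, m2^2 is never 1, and on the connected M one may exchange k2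
    and k3 so that m2^2 < 1 ([curvature_dichotomy]); the plane is then Lorentzian.  A Lorentz
    map Phi carrying it to the plane of the first two coordinates gives, for y = Phi(x),
    y_1^2 - y_2^2 = 1 / (1 - m2^2) and y_3^2 + y_4^2 = m2^2 / (1 - m2^2)
    ([global_frame]): these are cosh^2 and sinh^2 of artanh |m2|, and y is described by a
    hyperbolic angle v, a polar angle w and the height.

    It remains to see that one profile serves all of M.  Near each point k1 and sigma are
    functions of h ([level_curve]) with sigma' = - k1, sigma^2 = 1 - f1(k1) f2(k1) and the
    Riccati equation.  This system cannot be solved for k1' where the coefficient of k1'
    vanishes, but smoothness still forces its solutions to continue uniquely
    ([profile_unique]); as M is connected, a single solution on an open interval gives k1 and
    sigma everywhere ([unique_continuation]).  Its arc length s, a primitive of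
    (1 - sigma^2)^(-1/2), yields alpha_2 as the inverse of s and alpha_1 = artanh |m2|, with
    alpha_1'^2 = sigma^2 and alpha_2'^2 = 1 - sigma^2 ([profile_curve]).  Finally (s, v, w)
    are coordinates, because the model map composed with them is the immersion Phi o x, of
    rank three ([model_charts], by [inverse_function]). *)

(** * Calculus of C^k maps on open sets *)

Section DiffLocal.
Context {R : realType} {V W : normedModType R}.
Implicit Types (f g : V -> W) (D : set V).

(** The epsilon form of differentiability, free of little-o terms. *)
Lemma differentiable_eps f (df : {linear V -> W}) p : continuous df ->
  (forall e, 0 < e -> \forall h \near 0, `|f (h + p) - f p - df h| <= e * `|h|) ->
  differentiable f p /\ ('d f p : V -> W) = df.
Proof.
move=> cdf H.
have E : f \o shift p = cst (f p) + df +o_ (0 : V) id.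
  apply/eqaddoP => e e0; have {H} := H e e0.
  by apply: filterS => h; rewrite /= opprD addrA.
have D := diff_unique cdf E; split=> //.
by apply/diff_locallyP; rewrite D.
Qed.

Lemma diff_eps f p : differentiable f p ->
  forall e, 0 < e -> \forall h \near 0, `|f (h + p) - f p - 'd f p h| <= e * `|h|.
Proof.
move=> /diff_locally/eqaddoP H e e0; have {H} := H e e0.
by apply: filterS => h; rewrite /= opprD addrA.
Qed.

Lemma near_eq_differentiable f g p :
  (\forall q \near p, f q = g q) -> differentiable f p -> differentiable g p.
Proof.
move=> fg df.
have fg0 : \forall h \near (0 : V), f (h + p) = g (h + p).
  by move: fg; rewrite (near_shift (0 : V)) /=; apply: filterS => h; rewrite subr0.
have [] // := @differentiable_eps g ('d f p) p.
- exact: diff_continuous.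
- move=> e e0; have := diff_eps df e0; apply: filter_app.
  by apply: filterS fg0 => h <-; rewrite (nbhs_singleton fg).
Qed.

Lemma Ck_onS k D f : Ck_on k.+1 D f <->
  (forall p, D p -> differentiable f p) /\ forall v, Ck_on k D ('D_v f).
Proof. by []. Qed.

(** Every clause of [Ck_on] concerns germs only, so regularity near each point glues. *)
Lemma Ck_on_local k : forall D f,
  (forall p, D p -> exists2 U, nbhs p U &
     exists g, Ck_on k U g /\ forall q, U q -> f q = g q) -> Ck_on k D f.
Proof.
elim: k => [|k IH] D f H /=.
  move=> p /H[U Up [g [/= Cg fg]]].
  have Fg : \forall q \near p, g q = f q by apply: filterS Up => q /fg.
  have gp := nbhs_singleton Fg.
  have : g @ p --> g p := Cg p (nbhs_singleton Up).
  change (g @ p --> g p -> f @ p --> f p); rewrite -gp; apply: cvg_trans.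
  by apply: near_eq_cvg; apply: filterS Fg.
split=> [p /H[U Up [g [[dg _] fg]]]|v].
  apply: (@near_eq_differentiable g); last exact: dg _ (nbhs_singleton Up).
  by apply: filterS Up => q /fg.
apply: IH => p /H[U]; rewrite nbhsE => -[U' [oU' U'p] sU'] [g [[dg Cg] fg]].
have nU' q : U' q -> nbhs q U' by move=> ?; apply: open_nbhs_nbhs.
exists U'; first by exists U'.
exists ('D_v g); split.
  have sub : forall j E E' h, E' `<=` E -> @Ck_on R V W j E h -> Ck_on j E' h.
    elim=> [|j IHj] E E' h sE /=; first by move=> Ch q /sE/Ch.
    by move=> [dh Ch]; split=> [q /sE/dh //|w]; apply: IHj (Ch w).
  exact: sub sU' (Cg v).
move=> q U'q; apply: near_eq_derive.
by apply: filterS (nU' q U'q) => r /sU'/fg.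
Qed.

Lemma Ck_on_sub k D E f : E `<=` D -> Ck_on k D f -> Ck_on k E f.
Proof.
elim: k D E f => [|j IHj] E E' h sE /=; first by move=> Ch q /sE/Ch.
by move=> [dh Ch]; split=> [q /sE/dh //|w]; apply: IHj (Ch w).
Qed.

Lemma Ck_on_eq k D f g : open D -> (forall p, D p -> f p = g p) ->
  Ck_on k D f -> Ck_on k D g.
Proof.
move=> oD fg Cf; apply: Ck_on_local => p Dp; exists D; first exact: open_nbhs_nbhs.
by exists f; split=> // q /fg.
Qed.

Lemma Ck_on_lt k D f : Ck_on k.+1 D f -> Ck_on k D f.
Proof.
elim: k D f => [|k IH] D f [df Cf] /=.
  by move=> p Dp; apply/differentiable_continuous/df.
by split=> // v; apply: IH (Cf v).
Qed.

Lemma Ck_on_cont k D f p : Ck_on k D f -> D p -> {for p, continuous f}.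
Proof.
move=> + Dp; elim: k => [|k IH] Cf; first exact: Cf.
by apply: IH; apply: Ck_on_lt.
Qed.

Lemma Ck_on_cst k D (c : W) : Ck_on k D (fun=> c).
Proof.
elim: k D c => [|k IH] D c /=; first by move=> p _; apply: cst_continuous.
split=> [p _ //|v].
rewrite (_ : 'D_v _ = fun=> 0); first exact: IH.
by apply/funext => p; rewrite derive_cst.
Qed.

Lemma Ck_onD k D f g : open D -> Ck_on k D f -> Ck_on k D g ->
  Ck_on k D (fun p => f p + g p).
Proof.
move=> oD; elim: k f g => [|k IH] f g /=.
  by move=> Cf Cg p Dp; apply: continuousD; [apply: Cf|apply: Cg].
move=> [df Cf] [dg Cg]; split=> [p Dp|v].
  by apply: differentiableD; [apply: df|apply: dg].
apply: Ck_on_eq (IH _ _ (Cf v) (Cg v)) => // p Dp.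
by rewrite -[LHS]deriveD //; apply: diff_derivable; [apply: df|apply: dg].
Qed.

Lemma Ck_on_sum k D (I : Type) (r : seq I) (P : pred I) (F : I -> V -> W) :
  open D -> (forall i, P i -> Ck_on k D (F i)) ->
  Ck_on k D (fun p => \sum_(i <- r | P i) F i p).
Proof.
move=> oD CF; elim: r => [|i r IH].
  by rewrite (_ : (fun _ => _) = fun=> 0) ?funeqE => [|p]; rewrite ?big_nil//;
    apply: Ck_on_cst.
have [Pi|nPi] := boolP (P i).
  rewrite (_ : (fun _ => _) = fun p => F i p + \sum_(i <- r | P i) F i p).
    by apply: Ck_onD => //; apply: CF.
  by apply/funext => p; rewrite big_cons Pi.
by under eq_fun do rewrite big_cons (negPf nPi).
Qed.

Lemma Ck_on_lin k (L : {linear V -> W}) : continuous L -> Ck_on k setT L.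
Proof.
move=> cL; case: k => [|k] /=; first by move=> p _; apply: cL.
split=> [p _|v]; first exact: linear_differentiable.
rewrite (_ : 'D_v _ = fun=> L v); first exact: Ck_on_cst.
apply/funext => p; rewrite deriveE ?diff_lin//.
exact: linear_differentiable.
Qed.

End DiffLocal.

Lemma Ck_on_id (R : realType) (V : normedModType R) k (D : set V) :
  Ck_on k D (fun p : V => p).
Proof.
apply: (Ck_on_sub (@subsetT _ D)).
apply: (Ck_on_lin k (L := idfun)) => p; exact: cvg_id.
Qed.

Section ScaleBilinear.
Context {R : realType} {W : normedModType R}.

Lemma scaler_is_bilinear :
  bilinear_for
    (GRing.Scale.Law.clone _ _ *:%R _) (GRing.Scale.Law.clone _ _ *:%R _)
    ( *:%R : R -> W -> W).
Proof.
split=> [u'|u] a x y /=.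
- by rewrite scalerDl scalerA.
- by rewrite scalerDr !scalerA mulrC.
Qed.
HB.instance Definition _ := bilinear_isBilinear.Build R R W W _ _
  ( *:%R : R -> W -> W) scaler_is_bilinear.

Lemma scaler_continuous2 : continuous (fun q : R * W => q.1 *: q.2).
Proof. exact: scale_continuous. Qed.
End ScaleBilinear.

Section CkScale.
Context {R : realType} {V W : normedModType R}.
Implicit Types (D : set V).

Lemma differentiable_scale (a : V -> R) (f : V -> W) p :
  differentiable a p -> differentiable f p ->
  differentiable (fun q => a q *: f q) p /\
  forall v, 'D_v (fun q => a q *: f q) p = 'D_v a p *: f p + a p *: 'D_v f p.
Proof.
move=> da df.
have cb : continuous (fun q : R * W => q.1 *: q.2) by exact: scaler_continuous2.
have dp : differentiable (fun q => (a q, f q)) p by exact: differentiable_pair.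
have db : differentiable (fun q : R * W => q.1 *: q.2) (a p, f p).
  exact: differentiable_bilin.
have E : (fun q => a q *: f q) = (fun q : R * W => q.1 *: q.2) \o (fun q => (a q, f q)).
  by [].
have dE : differentiable (fun q => a q *: f q) p.
  by rewrite E; apply: differentiable_comp.
split=> // v; rewrite deriveE// E diff_comp//= diff_bilin//=.
by rewrite diff_pair//= addrC; congr (_ + _) => /=; rewrite deriveE.
Qed.

(** By the Leibniz rule the derivative of [a *: f] is a sum of two products of the same kind,
    one order less regular. *)
Lemma Ck_onZ k D (a : V -> R) (f : V -> W) : open D ->
  Ck_on k D a -> Ck_on k D f -> Ck_on k D (fun p => a p *: f p).
Proof.
move=> oD; elim: k a f => [|k IH] a f.
  by move=> Ca Cf p Dp; apply: continuousZ; [apply: Ca|apply: Cf].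
move=> Ca' Cf'; have Ca := Ck_on_lt Ca'; have Cf := Ck_on_lt Cf'.
case: Ca' => da Ca'; case: Cf' => df Cf'; split=> [p Dp|v].
  by have [] := differentiable_scale (da _ Dp) (df _ Dp).
have := Ck_onD oD (IH _ _ (Ca' v) Cf) (IH _ _ Ca (Cf' v)).
apply: Ck_on_eq => // p Dp.
by have [_ ->] := differentiable_scale (da _ Dp) (df _ Dp).
Qed.

Lemma Ck_onN k D (f : V -> W) : open D -> Ck_on k D f -> Ck_on k D (fun p => - f p).
Proof.
move=> oD Cf; have := Ck_onZ oD (Ck_on_cst (W := R) k D (-1)) Cf.
by apply: Ck_on_eq => // p _; rewrite scaleN1r.
Qed.

Lemma Ck_onB k D (f g : V -> W) : open D -> Ck_on k D f -> Ck_on k D g ->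
  Ck_on k D (fun p => f p - g p).
Proof. by move=> oD Cf Cg; apply: Ck_onD => //; apply: Ck_onN. Qed.

End CkScale.

Lemma Ck_onM (R : realType) (V : normedModType R) k (D : set V) (f g : V -> R) :
  open D -> Ck_on k D f -> Ck_on k D g -> Ck_on k D (fun p => f p * g p).
Proof. by move=> oD; apply: (@Ck_onZ R V R). Qed.

Section CkComp.
Context {R : realType} {V W : normedModType R}.
Implicit Types (D : set V).

Lemma derive_comp1 (g : R -> W) (f : V -> R) p v :
  differentiable f p -> differentiable g (f p) ->
  'D_v (g \o f) p = 'D_v f p *: 'D_1 g (f p).
Proof.
move=> df dg; rewrite deriveE; last exact: differentiable_comp.
rewrite diff_comp//= -!deriveE//.
rewrite [X in derive g _ X](_ : _ = ('D_v f p) *: (1 : R)); last by rewrite [RHS]mulr1.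
by rewrite !deriveE// linearZ.
Qed.

Lemma Ck_on_comp1 k D (E : set R) (g : R -> W) (f : V -> R) : open D ->
  (forall p, D p -> E (f p)) ->
  Ck_on k E g -> Ck_on k D f -> Ck_on k D (g \o f).
Proof.
move=> oD DE; elim: k g => [|k IH] g.
  by move=> Cg Cf p Dp; apply: continuous_comp; [apply: Cf|apply: Cg; apply: DE].
move=> [dg Cg] Cf'; have Cf := Ck_on_lt Cf'; case: Cf' => df Cf'.
split=> [p Dp|v].
  by apply: differentiable_comp; [apply: df|apply/dg/DE].
have := Ck_onZ oD (Cf' v) (IH _ (Cg 1) Cf).
apply: Ck_on_eq => // p Dp.
by rewrite /= derive_comp1//; [apply: df|apply/dg/DE].
Qed.

End CkComp.

Lemma derive_comp (R : realType) (U V W : normedModType R) (g : V -> W) (f : U -> V) p v :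
  differentiable f p -> differentiable g (f p) ->
  'D_v (g \o f) p = 'D_('D_v f p) g (f p).
Proof.
move=> df dg; rewrite deriveE; last exact: differentiable_comp.
by rewrite diff_comp//= -!deriveE.
Qed.

Section CkRow.
Context {R : realType} {V W : normedModType R} {n : nat}.
Implicit Types (D : set V).

Lemma differentiable_rowP (f : V -> 'rV[R]_n) p :
  differentiable f p <-> forall i, differentiable (fun q => f q 0 i) p.
Proof.
split=> [df i|df].
  by apply: (@differentiable_comp _ _ _ _ f (fun N : 'rV[R]_n => N 0 i)) => //;
    apply: differentiable_coord.
have -> : f = fun q => \sum_(i < n) (f q 0 i *: delta_mx 0 i).
  by apply/funext => q; rewrite [LHS]row_sum_delta.
rewrite (_ : (fun _ => _) = \sum_(i < n) fun q => f q 0 i *: delta_mx 0 i).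
  apply: differentiable_sum => i.
  exact: differentiableZl.
by apply/funext => q; rewrite fct_sumE.
Qed.

Lemma derive_row (f : V -> 'rV[R]_n) p v i : differentiable f p ->
  ('D_v f p) 0 i = 'D_v (fun q => f q 0 i) p.
Proof.
by move=> df; rewrite derive_mx ?mxE//; apply: diff_derivable.
Qed.

Lemma Ck_on_rowP k D (f : V -> 'rV[R]_n) : open D ->
  Ck_on k D f <-> forall i, Ck_on k D (fun q => f q 0 i).
Proof.
move=> oD; split=> [|Cf].
  elim: k f => [|k IH] f Cf i /=.
    move=> p Dp; apply: (@continuous_comp _ _ _ f (fun N : 'rV[R]_n => N 0 i)).
      exact: Cf.
    exact: coord_continuous.
  case: Cf => df Cf; split=> [p Dp|v].
    by have /differentiable_rowP := df p Dp; apply.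
  apply: Ck_on_eq (IH _ (Cf v) i) => // p Dp.
  by rewrite derive_row//; apply: df.
apply: (@Ck_on_eq _ _ _ k D (fun q => \sum_(i < n) (f q 0 i *: delta_mx 0 i))) => //.
  by move=> p _; rewrite -row_sum_delta.
apply: Ck_on_sum => // i _; apply: Ck_onZ => //; exact: Ck_on_cst.
Qed.

Lemma derive_sum_delta (g : 'rV[R]_n -> W) p v : differentiable g p ->
  'D_v g p = \sum_(i < n) v 0 i *: 'D_(delta_mx 0 i) g p.
Proof.
move=> dg; rewrite deriveE// [v in LHS]row_sum_delta linear_sum.
by apply: eq_bigr => i _; rewrite linearZ/= deriveE.
Qed.

(** Expanding along the canonical basis writes a derivative of [g \o f] as a finite sum of
    products whose outer factors are partial derivatives of [g] composed with [f], to which the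
    induction hypothesis applies. *)
Lemma Ck_on_comp k D (E : set 'rV[R]_n) (g : 'rV[R]_n -> W) (f : V -> 'rV[R]_n) :
  open D -> (forall p, D p -> E (f p)) ->
  Ck_on k E g -> Ck_on k D f -> Ck_on k D (g \o f).
Proof.
move=> oD DE; elim: k g => [|k IH] g.
  by move=> Cg Cf p Dp; apply: continuous_comp; [apply: Cf|apply: Cg; apply: DE].
move=> [dg Cg] Cf'; have Cf := Ck_on_lt Cf'; case: Cf' => df Cf'.
split=> [p Dp|v].
  by apply: differentiable_comp; [apply: df|apply/dg/DE].
apply: (@Ck_on_eq _ _ _ k D (fun p => \sum_(i < n)
   ('D_v f p) 0 i *: 'D_(delta_mx 0 i) g (f p))) => //.
  by move=> p Dp; rewrite (derive_comp v (df p Dp) (dg _ (DE _ Dp))) derive_sum_delta//; exact/dg/DE.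
apply: Ck_on_sum => // i _; apply: Ck_onZ => //.
  by have [/(_ (Cf' v) i)] := Ck_on_rowP k ('D_v f) oD.
exact: (IH ('D_(delta_mx 0 i) g) (Cg _) Cf).
Qed.

End CkRow.

Section CkOneVar.
Context {R : realType}.
Implicit Types (D : set R).

(** In one variable every directional derivative is a multiple of the ordinary one. *)
Lemma Ck_on1 k D (f f' : R -> R) : open D ->
  (forall x, D x -> is_derive x 1 f (f' x)) -> Ck_on k D f' -> Ck_on k.+1 D f.
Proof.
move=> oD H Cf'.
have df x : D x -> differentiable f x.
  by move=> /H[+ _]; rewrite derivable1_diffP.
split=> // v; apply: Ck_on_eq (Ck_onM oD (Ck_on_cst k D (v : R)) Cf') => // x Dx.
have dvx := H _ Dx; rewrite -(derive_val (is_derive := dvx)).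
rewrite !deriveE; [|exact: df|exact: df].
by rewrite -[X in _ = 'd f x X](mulr1 v) [RHS]linearZ.
Qed.

Lemma smooth_inv : smooth_on [set x : R | x != 0] (fun x => x^-1).
Proof.
have oD : open [set x : R | x != 0].
  rewrite (_ : [set _ | _] = ~` [set (0 : R)]); last first.
    by apply/seteqP; split=> x /eqP.
  exact: closed_openC.
elim=> [|k IH].
  by move=> x /= x0; apply: inv_continuous.
apply: (Ck_on1 (f' := fun x => - (x^-1 * x^-1))) => //.
  move=> x /= x0; have := @is_deriveV R id x 1 1 x0 (is_derive_id _ _).
  move=> H; apply: (@is_derive_eq _ _ _ (fun x : R => x^-1) x 1 _ _ H).
  by rewrite expr2 invfM /GRing.scale /= mulr1.
by apply: Ck_onN => //; apply: Ck_onM.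
Qed.

Lemma smooth_expR : smooth_on setT (@expR R).
Proof.
elim=> [|k IH]; first by move=> x _; apply: continuous_expR.
by apply: (Ck_on1 (f' := @expR R)) => //; exact: openT.
Qed.

Lemma open_pos : open [set x : R | 0 < x].
Proof. exact: open_gt. Qed.

Lemma smooth_ln : smooth_on [set x : R | 0 < x] (@ln R).
Proof.
have H k : Ck_on k.+1 [set x : R | 0 < x] (@ln R).
  apply: (Ck_on1 (f' := fun x => x^-1)); first exact: open_pos.
  by apply: (Ck_on_sub _ (smooth_inv k)) => x /= /lt0r_neq0.
by case=> [|k //]; apply/Ck_on_lt/H.
Qed.

(** Away from 0, the square root is [exp (ln x / 2)]. *)
Lemma smooth_sqrt : smooth_on [set x : R | 0 < x] (@Num.sqrt R).
Proof.
move=> k; apply: (@Ck_on_eq _ _ _ k _ (fun x => expR (2^-1 * ln x))).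
- exact: open_pos.
- by move=> x /= x0; rewrite -powR12_sqrt ?ltW// /powR gt_eqF.
- apply: (@Ck_on_comp1 _ _ _ k _ setT expR (fun x => 2^-1 * ln x) open_pos) => //.
    exact: smooth_expR.
  by apply: (Ck_onM open_pos (Ck_on_cst _ _ _)); apply: smooth_ln.
Qed.

Lemma smooth_atan : smooth_on setT (@atan R).
Proof.
have H k : Ck_on k.+1 setT (@atan R).
  apply: (Ck_on1 (f' := fun x => (1 + x ^+ 2)^-1)); first exact: openT.
  have oT := @openT R.
  apply: (@Ck_on_comp1 R R R k setT [set x : R | x != 0] (fun x => x^-1)
           (fun x => 1 + x ^+ 2) oT).
  - by move=> x _ /=; rewrite gt_eqF// ltr_pwDl// sqr_ge0.
  - exact: smooth_inv.
  - apply: (Ck_onD oT (Ck_on_cst _ _ _)).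
    by under eq_fun do rewrite expr2; apply: (Ck_onM oT); apply: Ck_on_id.
by case=> [|k //]; apply/Ck_on_lt/H.
Qed.

End CkOneVar.

Section CkMore.
Context {R : realType} {V : normedModType R}.
Implicit Types (D : set V) (f g : V -> R).

Lemma Ck_onV k D f : open D -> (forall p, D p -> f p != 0) ->
  Ck_on k D f -> Ck_on k D (fun p => (f p)^-1).
Proof.
move=> oD f0; apply: (@Ck_on_comp1 _ _ _ k D [set x : R | x != 0] (fun x => x^-1)) => //.
exact: smooth_inv.
Qed.

Lemma Ck_on_sqrt k D f : open D -> (forall p, D p -> 0 < f p) ->
  Ck_on k D f -> Ck_on k D (fun p => Num.sqrt (f p)).
Proof.
move=> oD f0; apply: (@Ck_on_comp1 _ _ _ k D [set x : R | 0 < x] Num.sqrt) => //.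
exact: smooth_sqrt.
Qed.

Lemma Ck_on_prod k D (I : Type) (r : seq I) (P : pred I) (F : I -> V -> R) :
  open D -> (forall i, P i -> Ck_on k D (F i)) ->
  Ck_on k D (fun p => \prod_(i <- r | P i) F i p).
Proof.
move=> oD CF; elim: r => [|i r IH].
  by rewrite (_ : (fun _ => _) = fun=> 1) ?funeqE => [|p]; rewrite ?big_nil//;
    apply: Ck_on_cst.
have [Pi|nPi] := boolP (P i).
  rewrite (_ : (fun _ => _) = fun p => F i p * \prod_(i <- r | P i) F i p).
    by apply: Ck_onM => //; apply: CF.
  by apply/funext => p; rewrite big_cons Pi.
by under eq_fun do rewrite big_cons (negPf nPi).
Qed.

Lemma Ck_on_det k D n (F : V -> 'M[R]_n) : open D ->
  (forall i j, Ck_on k D (fun p => F p i j)) -> Ck_on k D (fun p => \det (F p)).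
Proof.
move=> oD CF; apply: Ck_on_sum => // s _; apply: Ck_onM => //.
  exact: Ck_on_cst.
by apply: Ck_on_prod.
Qed.

(** Cramer's rule. *)
Lemma Ck_on_invmx k D n (F : V -> 'M[R]_n) i j : open D ->
  (forall p, D p -> F p \in unitmx) ->
  (forall i j, Ck_on k D (fun p => F p i j)) -> Ck_on k D (fun p => invmx (F p) i j).
Proof.
move=> oD uF CF.
apply: (@Ck_on_eq _ _ _ k D (fun p => (\det (F p))^-1 * (\adj (F p)) i j)) => //.
  by move=> p Dp; rewrite /invmx uF// [RHS]mxE.
apply: Ck_onM => //.
  apply: Ck_onV => //; last exact: Ck_on_det.
  by move=> p /uF; rewrite unitmxE unitfE.
under eq_fun do rewrite mxE.
apply: Ck_onM => //; first exact: Ck_on_cst.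
by apply: Ck_on_det => // a b; under eq_fun do rewrite !mxE; exact: CF.
Qed.

End CkMore.

(** * Symmetry of second derivatives *)

Opaque derive Ck_on.

Section Lines.
Context {R : realType} {V W : normedModType R}.

Lemma line_derive (a w : V) (s : R) :
  differentiable (fun s : R => a + s *: w) s /\ 'D_1 (fun s : R => a + s *: w) s = w.
Proof.
have ds : differentiable (fun s : R => s *: w) s by [].
split; first exact: differentiableD.
rewrite (@deriveD _ _ _ (cst a) (fun s : R => s *: w)) //; last exact: diff_derivable.
rewrite derive_cst add0r.
have did : differentiable (@id R) s by [].
have [_ ->] := @differentiable_scale R R V id (cst w) s did (differentiable_cst _ _).
by rewrite derive_cst derive_id scaler0 addr0 scale1r.
Qed.

Lemma line_is_derive (g : V -> W) (a w : V) (s : R) : differentiable g (a + s *: w) ->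
  is_derive s 1 (fun s : R => g (a + s *: w)) ('D_w g (a + s *: w)).
Proof.
move=> dg; have [dl el] := line_derive a w s.
split; first by apply: diff_derivable; apply: (differentiable_comp dl dg).
apply: etrans (derive_comp (1 : R) dl dg) _; by rewrite el.
Qed.
End Lines.

Lemma mvt_line (R : realType) (V : normedModType R) (g : V -> R) (a w : V) (t : R) :
  0 < t -> (forall s, 0 <= s <= t -> differentiable g (a + s *: w)) ->
  exists2 s, 0 <= s <= t & g (a + t *: w) - g a = t * 'D_w g (a + s *: w).
Proof.
move=> t0 dg.
have [s| |s] := @MVT R (fun s => g (a + s *: w)) (fun s => 'D_w g (a + s *: w)) 0 t t0.
- rewrite in_itv /= => /andP[s0 st]; apply: line_is_derive; apply: dg.
  by rewrite !ltW.
- apply/continuous_in_subspaceT => s; rewrite inE /= in_itv /= => st.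
  have dgs := dg _ st; apply: differentiable_continuous.
  by have [+ _] := line_is_derive dgs; rewrite derivable1_diffP.
- rewrite in_itv /= scale0r addr0 subr0 mulrC => /andP[s0 st] E.
  by exists s; rewrite ?ltW.
Qed.

Lemma dist_lt_split (R : realType) (x y z e : R) :
  `|x - z| < e / 2 -> `|y - z| < e / 2 -> `|x - y| <= e.
Proof.
move=> ha hb; have -> : x - y = (x - z) + (z - y) by ring.
rewrite (le_trans (ler_normD _ _))// (splitr e) lerD// ltW//.
by rewrite distrC.
Qed.

Section Schwarz.
Context {R : realType} {V : normedModType R}.

(** The second difference of [f] over a parallelogram, by two uses of the mean value theorem.
    It is symmetric in [u] and [v], which is what makes mixed derivatives commute. *)
Lemma second_difference (f : V -> R) D p u v t : Ck_on 2 D f -> 0 < t ->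
  (forall a b, 0 <= a <= t -> 0 <= b <= t -> D (p + a *: u + b *: v)) ->
  exists a b, [/\ 0 <= a <= t, 0 <= b <= t &
   f (p + t *: u + t *: v) - f (p + t *: u) - (f (p + t *: v) - f p) =
   t ^+ 2 * 'D_v ('D_u f) (p + a *: u + b *: v)].
Proof.
move=> /Ck_onS[df Cf] t0 HD.
have t0t : 0 <= t <= t by apply/andP; split; rewrite // ltW.
have t00 : 0 <= (0 : R) <= t by apply/andP; split; rewrite // ltW.
pose g q := f (q + t *: v) - f q.
have dshift q : differentiable (fun q : V => q + t *: v) q by exact: differentiableD.
have dg1 q : D (q + t *: v) -> differentiable (fun q => f (q + t *: v)) q.
  move=> Dq; apply: (@differentiable_comp _ _ _ _ (fun q => q + t *: v) f) => //.
  exact: df.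
have Dshift q : D (q + t *: v) ->
    'D_u (fun q => f (q + t *: v)) q = 'D_u f (q + t *: v).
  move=> Dq; rewrite (@derive_comp _ _ _ _ f (fun q => q + t *: v))//; last exact: df.
  congr (derive _ _ _); rewrite (@deriveD _ _ _ id (cst (t *: v))) //.
  by rewrite derive_cst derive_id addr0.
have Dsub s : 0 <= s <= t -> D (p + s *: u).
  by move=> st; have := HD _ _ st t00; rewrite scale0r addr0.
have [s st Es] : exists2 s, 0 <= s <= t & g (p + t *: u) - g p = t * 'D_u g (p + s *: u).
  apply: mvt_line => // s st; apply: differentiableB.
    by apply: dg1; apply: HD.
  by apply: df; apply: Dsub.
have Eg : 'D_u g (p + s *: u) = 'D_u f (p + s *: u + t *: v) - 'D_u f (p + s *: u).
  rewrite /g deriveB; first by rewrite Dshift//; apply: HD.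
    by apply: diff_derivable; apply: dg1; apply: HD.
  by apply/diff_derivable/df/Dsub.
have [b bt Eb] : exists2 b, 0 <= b <= t &
    'D_u f (p + s *: u + t *: v) - 'D_u f (p + s *: u) =
    t * 'D_v ('D_u f) (p + s *: u + b *: v).
  have /Ck_onS[dDu _] := Cf u.
  apply: (@mvt_line _ _ ('D_u f) (p + s *: u) v t t0) => b bt.
  by apply: dDu; apply: HD.
exists s, b; split=> //.
by rewrite expr2 -mulrA -Eb -Eg -Es.
Qed.

Lemma near_small_square (D : set V) p u v : nbhs p D ->
  \forall t \near (0 : R)^'+,
  forall a b, 0 <= a <= t -> 0 <= b <= t -> D (p + a *: u + b *: v).
Proof.
move=> /nbhs_ballP[e /= e0 eD].
pose M := `|u| + `|v| + 1.
have M0 : 0 < M by rewrite ltr_wpDl// addr_ge0.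
exists (e / M) => /=; first by rewrite divr_gt0.
move=> t /=; rewrite sub0r normrN => te t0 a b /andP[a0 at_] /andP[b0 bt].
apply: eD; rewrite -ball_normE /= -addrA opprD addrA subrr sub0r normrN.
rewrite (le_lt_trans (ler_normD _ _))// !normrZ !ger0_norm//.
rewrite gtr0_norm// ltr_pdivlMr// in te; apply: le_lt_trans te.
rewrite /M !mulrDr mulr1 -[leLHS]addr0; apply: lerD; last exact: ltW.
by rewrite lerD// ler_wpM2r.
Qed.

Lemma schwarz (f : V -> R) D p u v : open D -> Ck_on 2 D f -> D p ->
  'D_u ('D_v f) p = 'D_v ('D_u f) p.
Proof.
move=> oD Cf Dp.
have cont x y : {for p, continuous ('D_x ('D_y f))}.
  by have /Ck_onS[_ /(_ y)/Ck_onS[_ /(_ x) C]] := Cf; exact: (Ck_on_cont C).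
have H x y (e : R) : 0 < e ->
    nbhs p (fun q => D q /\ `|'D_x ('D_y f) p - 'D_x ('D_y f) q| < e).
  move=> e0; apply: filterI; first exact: open_nbhs_nbhs.
  by have /cvgrPdist_lt/(_ e e0) := cont x y.
suff E : forall e, 0 < e -> `|'D_u ('D_v f) p - 'D_v ('D_u f) p| <= e.
  have : `|'D_u ('D_v f) p - 'D_v ('D_u f) p| <= 0 by apply/ler_addgt0Pr => e /E; rewrite add0r.
  by rewrite normr_le0 subr_eq0 => /eqP.
move=> e e0; have e2 : 0 < e / 2 by rewrite divr_gt0.
have N1 := near_small_square u v (H v u _ e2).
have N2 := near_small_square v u (H u v _ e2).
have [t [t0 [S1 S2]]] : exists t : R, 0 < t /\
   ((forall a b, 0 <= a <= t -> 0 <= b <= t -> D (p + a *: u + b *: v) /\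
     `|'D_v ('D_u f) p - 'D_v ('D_u f) (p + a *: u + b *: v)| < e / 2) /\
   (forall a b, 0 <= a <= t -> 0 <= b <= t -> D (p + a *: v + b *: u) /\
     `|'D_u ('D_v f) p - 'D_u ('D_v f) (p + a *: v + b *: u)| < e / 2)).
  have [t t_] := filter_ex (filterI (nbhs_right_gt (0 : R)) (filterI N1 N2)).
  by exists t.
have [a [b [at_ bt E1]]] := second_difference Cf t0 (fun a b Ha Hb => (S1 a b Ha Hb).1).
have [a' [b' [at' bt' E2]]] := second_difference Cf t0 (fun a b Ha Hb => (S2 a b Ha Hb).1).
have E : 'D_v ('D_u f) (p + a *: u + b *: v) = 'D_u ('D_v f) (p + a' *: v + b' *: u).
  have t2 : t ^+ 2 != 0 by rewrite expf_neq0// lt0r_neq0.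
  apply: (mulfI t2); apply: etrans (esym E1) (etrans _ E2).
  rewrite (addrAC p (t *: v)).
  by move: (f (p + t *: v + t *: u)) (f (p + t *: u)) (f (p + t *: v)) (f p) => r1 r2 r3 r4; ring.
have [_ ha] := S2 _ _ at' bt'; have [_ hb] := S1 _ _ at_ bt.
rewrite E in hb; exact: dist_lt_split ha hb.
Qed.

Lemma schwarz_row n (f : V -> 'rV[R]_n) D p u v : open D -> Ck_on 2 D f -> D p ->
  'D_u ('D_v f) p = 'D_v ('D_u f) p.
Proof.
move=> oD Cf Dp; apply/rowP => i.
have /Ck_onS[df Cdf] := Cf.
have dd w : differentiable ('D_w f) p by have [+ _] := Cdf w; apply.
have E x y : ('D_x ('D_y f) p) 0 i = 'D_x ('D_y (fun q => f q 0 i)) p.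
  rewrite (derive_row x i (dd y)); apply: near_eq_derive.
  have : nbhs p D by exact: open_nbhs_nbhs.
  by apply: filterS => q /df dq; exact: derive_row.
apply: etrans (E u v) (etrans _ (esym (E v u))).
exact: (schwarz u v oD ((Ck_on_rowP 2 f oD).1 Cf i) Dp).
Qed.
End Schwarz.

(** * The inverse function theorem *)

Section InverseFunction.
Context {R : realType} {n : nat}.
Notation V := 'rV[R]_n.
Implicit Types (F g : V -> V) (D B : set V) (u v w y : V).

Lemma rV_norm_le (u : V) (e : R) : 0 <= e -> (forall i, `|u 0 i| <= e) -> `|u| <= e.
Proof.
move=> e0 H; rewrite /Num.Def.normr /= mx_normrE; apply: bigmax_le => // -[i j] _ /=.
by rewrite ord1.
Qed.

Lemma rV_coord_le (u : V) i : `|u 0 i| <= `|u|.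
Proof.
rewrite [leRHS]/Num.Def.normr /= mx_normrE.
exact: (le_bigmax _ (fun ij : 'I_1 * 'I_n => `|u ij.1 ij.2|) (0, i)).
Qed.

Lemma mulmxr_lipschitz (A : 'M[R]_n) :
  exists2 c, 0 < c & forall x : V, `|x *m A| <= c * `|x|.
Proof.
exists (1 + \sum_(i < n) \sum_(j < n) `|A i j|).
  by rewrite ltr_pwDl// sumr_ge0// => i _; rewrite sumr_ge0.
move=> x; apply: rV_norm_le => [|j].
  by rewrite mulr_ge0// addr_ge0// sumr_ge0// => i _; rewrite sumr_ge0.
rewrite mxE; apply: le_trans (ler_norm_sum _ _ _) _.
apply: (@le_trans _ _ ((\sum_(i < n) \sum_(j < n) `|A i j|) * `|x|)); last first.
  by rewrite mulrDl mul1r lerDr.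
rewrite mulr_suml; apply: ler_sum => i _; rewrite normrM mulrC.
apply: ler_pM => //; last exact: rV_coord_le.
by rewrite (bigD1 j)//= lerDl sumr_ge0.
Qed.

Lemma mulmxr_continuous (A : 'M[R]_n) : continuous (mulmxr A : V -> V).
Proof.
have [c c0 cA] := mulmxr_lipschitz A.
apply: bounded_linear_continuous; apply/linear_boundedP.
exists c; split; first exact: num_real.
by move=> M cM x; apply: le_trans (cA x) _; apply: ler_wpM2r; rewrite // ltW.
Qed.

Lemma derive_mulmxr (U : normedModType R) (A : 'M[R]_n) (F : U -> V) (p v : U) :
  differentiable F p -> differentiable (fun q => F q *m A) p /\
  'D_v (fun q => F q *m A) p = 'D_v F p *m A.
Proof.
move=> dF; have cA := @mulmxr_continuous A.
have dA : differentiable (mulmxr A : V -> V) (F p) by exact: linear_differentiable.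
split; first exact: (@differentiable_comp _ _ _ _ F (mulmxr A)).
apply: etrans (@derive_comp _ _ _ _ (mulmxr A) F p v dF dA) _.
by rewrite deriveE// diff_lin.
Qed.

(** Applied to [F - id], once the differential of [F] at [u0] has been made the identity. *)
Lemma small_lipschitz g D u0 : open D -> Ck_on 1 D g -> D u0 ->
  (forall v, 'D_v g u0 = 0) ->
  \forall r \near (0 : R)^'+, forall u v, ball u0 r u -> ball u0 r v ->
    `|g u - g v| <= `|u - v| / 2.
Proof.
move=> oD /Ck_onS[dg Cg] Du0 g0.
(* the [n] partial derivatives then add up to a Lipschitz constant below [1 / 2] *)
pose e : R := (2 * n.+1%:R)^-1.
have e0 : 0 < e by rewrite invr_gt0 mulr_gt0.
have small i j : \forall p \near u0, `|('D_(delta_mx 0 j) g p) 0 i| <= e.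
  have C := Ck_on_cont (Cg (delta_mx 0 j)) Du0.
  have /cvgrPdist_le/(_ e e0) := C; apply: filterS => p; rewrite g0 sub0r normrN.
  by apply: le_trans; exact: rV_coord_le.
have /nbhs_ballP[r /= r0 H] :
    \forall p \near u0, D p /\ forall i j, `|('D_(delta_mx 0 j) g p) 0 i| <= e.
  apply: filterI; first exact: open_nbhs_nbhs.
  have all_small : \forall p \near u0, forall ij : 'I_n * 'I_n,
      `|('D_(delta_mx 0 ij.2) g p) 0 ij.1| <= e.
    by apply: (@filter_forall _ _ (fun ij p => `|(derive g p (delta_mx 0 ij.2)) 0 ij.1| <= e) (nbhs u0)) => ij; exact: small.
  by apply: filterS all_small => p Hp i j; exact: (Hp (i, j)).
exists r => // s /=; rewrite sub0r normrN => sr s0 u v Bu Bv.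
rewrite gtr0_norm// in sr.
have Bs (t : R) : 0 <= t <= 1 -> ball u0 r (v + t *: (u - v)).
  move=> /andP[t0 t1].
  move: Bu Bv; rewrite -!ball_normE /= => Bu Bv.
  have -> : u0 - (v + t *: (u - v)) = (1 - t) *: (u0 - v) + t *: (u0 - u).
    by rewrite scalerBl scale1r !scalerBr !opprD !opprK; apply/rowP => i; rewrite !mxE; ring.
  apply: le_lt_trans sr; apply: le_trans (ler_normD _ _) _.
  rewrite !normrZ (ger0_norm t0) ger0_norm ?subr_ge0//.
  have -> : s = (1 - t) * s + t * s by ring.
  by apply: lerD; apply: ler_wpM2l; rewrite ?subr_ge0// ltW.
apply: rV_norm_le => [|i]; first by rewrite mulr_ge0.
have di p : ball u0 r p -> differentiable (fun q => g q 0 i) p.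
  by move=> /H[/dg dp _]; move: dp; rewrite differentiable_rowP; apply.
have [t t01 E] := @mvt_line _ _ (fun q => g q 0 i) v (u - v) 1 ltr01
   (fun t t01 => di _ (Bs t t01)).
rewrite scale1r subrKC mul1r in E.
rewrite !mxE E -derive_row; last by have [/dg] := H _ (Bs _ t01).
have dgt : differentiable g (v + t *: (u - v)) by have [/dg] := H _ (Bs _ t01).
rewrite (derive_sum_delta (u - v) dgt) summxE.
apply: le_trans (ler_norm_sum _ _ _) _.
apply: (@le_trans _ _ (\sum_(j < n) `|u - v| * e)).
  apply: ler_sum => j _; rewrite mxE normrM ler_pM//; first exact: rV_coord_le.
  by have [_] := H _ (Bs _ t01); apply.
rewrite sumr_const card_ord -(mulr_natr (`|u - v| * e) n) -mulrA ler_wpM2l//.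
rewrite /e invfM -mulrA ler_piMr// ?invr_ge0// mulrC ler_pdivrMr// mul1r.
by rewrite ler_nat.
Qed.

Section NearIdentity.
Variables (F : V -> V) (B : set V).
Hypothesis cF : forall u, B u -> {for u, continuous F}.
Hypothesis lipF : forall u v, B u -> B v -> `|(F u - F v) - (u - v)| <= `|u - v| / 2.

Lemma near_id_expand u v : B u -> B v -> `|u - v| <= 2 * `|F u - F v|.
Proof.
move=> Bu Bv; have := lipF Bu Bv.
have := ler_normB (F u - F v) ((F u - F v) - (u - v)).
rewrite opprB subrKC; lra.
Qed.

(** Minimise [|F u - y|] over a closed ball: at a minimiser with [F u <> y], a small step in
    the direction [y - F u] would decrease the distance. *)
Lemma near_id_onto u1 (r : R) y : 0 < r -> (forall u, `|u - u1| <= r -> B u) ->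
  `|y - F u1| < r / 4 -> exists2 u, B u & F u = y.
Proof.
move=> r0 sB yr.
pose K := closed_ball_ (fun z : V => `|z|) u1 r.
have KB u : K u -> B u by move=> /= Ku; apply: sB; rewrite distrC.
have Ku1 : K u1 by rewrite /K /closed_ball_ /= subrr normr0 ltW.
have cK : compact K.
  apply: bounded_closed_compact; last exact: closed_closed_ball_.
  exists (`|u1| + r); split; first by rewrite realE addr_ge0// ltW.
  move=> M MM u Ku; have : `|u1 - u| <= r := Ku.
  have := ler_normB u1 (u1 - u); rewrite opprB subrKC => h1 h2.
  rewrite /=; lra.
have [|us] := @EVT_min_rV R n (fun u => `|F u - y|) K (ex_intro _ u1 Ku1) cK.
  apply/continuous_in_subspaceT => u; rewrite inE => /KB Bu.
  apply: (@continuous_comp _ _ _ (fun u => F u - y) (fun z => `|z|)).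
    by apply: continuousB; [exact: cF|exact: cst_continuous].
  exact: norm_continuous.
rewrite inE => Kus min_us.
have := min_us u1; rewrite inE => /(_ Ku1); rewrite (distrC (F u1)) => m1.
have Bus := KB _ Kus; have Bu1 := KB _ Ku1.
have usr : `|us - u1| < r.
  have h1 := near_id_expand Bus Bu1.
  have h2 := ler_normD (F us - y) (y - F u1); rewrite subrKA in h2.
  lra.
exists us => //; apply/eqP; rewrite -subr_eq0 -normr_le0 leNgt; apply/negP => d0.
pose d := y - F us.
have nd : `|d| = `|F us - y| by rewrite distrC.
have d1 : 0 < `|d| by rewrite nd.
(* the longest step from the minimiser towards [y] that stays in the closed ball *)
pose t := Num.min 1 ((r - `|us - u1|) / `|d|).
have t0 : 0 < t by rewrite lt_min ltr01 divr_gt0 ?subr_gt0.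
have t1 : t <= 1 by rewrite ge_min lexx.
have td : t * `|d| <= r - `|us - u1| by rewrite -ler_pdivlMr// ge_min lexx orbT.
pose u2 := us + t *: d.
have Ku2 : K u2.
  rewrite /K /closed_ball_ /= distrC /u2 addrAC.
  by rewrite (le_trans (ler_normD _ _))// normrZ gtr0_norm//; lra.
have Bu2 := KB _ Ku2.
have := min_us u2; rewrite inE => /(_ Ku2); rewrite -nd.
have -> : F u2 - y = ((F u2 - F us) - (u2 - us)) - (1 - t) *: d.
  by rewrite /u2 /d scalerBl scale1r; apply/rowP => i; rewrite !mxE; ring.
have h1 := lipF Bu2 Bus.
have h2 := ler_normB ((F u2 - F us) - (u2 - us)) ((1 - t) *: d).
rewrite normrZ ger0_norm ?subr_ge0// in h2.
have h3 : `|u2 - us| = t * `|d| by rewrite /u2 addrC addKr normrZ gtr0_norm.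
rewrite h3 in h1; have := mulr_gt0 t0 d1; lra.
Qed.

Lemma near_id_open_image : open B -> open (F @` B).
Proof.
move=> oB; rewrite openE => y [u1 Bu1 <-].
have /nbhs_ballP[r /= r0 H] : nbhs u1 B by exact: open_nbhs_nbhs.
apply/nbhs_ballP; exists (r / 2 / 4) => /=; first by rewrite !divr_gt0.
move=> y'; rewrite -ball_normE /= distrC => y'r.
have r2 : 0 < r / 2 by rewrite divr_gt0.
have sB u : `|u - u1| <= r / 2 -> B u.
  by move=> ur; apply: H; rewrite -ball_normE /= distrC; lra.
by have [u Bu <-] := near_id_onto r2 sB y'r; exists u.
Qed.
End NearIdentity.

(** The differential of the inverse [G] is the inverse Jacobian of [F] at [G y], so each order
    of regularity of [G] gives the next. *)
Lemma smooth_inverse F B (C : R) : open B -> smooth_on B F -> open (F @` B) ->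
  0 < C -> (forall u v, B u -> B v -> `|u - v| <= C * `|F u - F v|) ->
  (forall u, B u -> 'J F u \in unitmx) ->
  exists G, (forall u, B u -> G (F u) = u) /\ smooth_on (F @` B) G.
Proof.
move=> oB sF oFB C0 ex uJ.
pose G y : V := xget 0 [set u | B u /\ F u = y].
have GF u : B u -> G (F u) = u.
  move=> Bu; rewrite /G; case: xgetP => [v -> [Bv E]|/(_ u)]; last by case.
  have := ex _ _ Bv Bu; rewrite E subrr normr0 mulr0 normr_le0 subr_eq0.
  by move/eqP.
exists G; split=> //.
have BG y : (F @` B) y -> B (G y) /\ F (G y) = y.
  by move=> [u Bu <-]; rewrite GF.
have dF u : B u -> differentiable F u by have /Ck_onS[+ _] := sF 1%N; apply.
have dG y : (F @` B) y -> differentiable G y /\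
    forall v, 'D_v G y = v *m invmx ('J F (G y)).
  move=> FBy; have [Bu Fu] := BG _ FBy; set u := G y in Bu Fu *.
  set J := 'J F u.
  pose L : {linear V -> V} := mulmxr (invmx J).
  have [c c0 cL] : exists2 c, 0 < c & forall x, `|L x| <= c * `|x|.
    exact: mulmxr_lipschitz.
  have contL : continuous L by exact: mulmxr_continuous.
  have [|dG eG] := @differentiable_eps _ _ _ G L y contL.
    move=> e e0.
    have e'0 : 0 < e / (c * C) by rewrite divr_gt0// mulr_gt0.
    have dFu := diff_eps (dF _ Bu) e'0.
    have /nbhs_ballP[r /= r0 Hr] := dFu.
    have /nbhs_ballP[s /= s0 Hs] : nbhs y (F @` B) by exact: open_nbhs_nbhs.
    apply/nbhs_ballP; exists (Num.min s (r / C)) => /=.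
      by rewrite lt_min s0 divr_gt0.
    move=> k; rewrite -ball_normE /= sub0r normrN lt_min => /andP[ks kr].
    have FBk : (F @` B) (k + y).
      by apply: Hs; rewrite -ball_normE /= opprD addrCA subrr addr0 normrN.
    have [Bv Fv] := BG _ FBk.
    set v := G (k + y) - u.
    have vk : `|v| <= C * `|k|.
      by have := ex _ _ Bv Bu; rewrite Fv Fu addrK.
    have Hv : `|F (v + u) - F u - 'd F u v| <= e / (c * C) * `|v|.
      apply: Hr; rewrite -ball_normE /= sub0r normrN (le_lt_trans vk)//.
      by rewrite mulrC -ltr_pdivlMr.
    rewrite /v subrK Fv Fu addrK -/v -deriveE in Hv; last exact: dF.
    rewrite deriveEjacobian in Hv; last exact: dF.
    rewrite -/J in Hv.
    have -> : v - L k = - L (k - v *m J).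
      by rewrite /L /= mulmxBl -mulmxA mulmxV ?uJ// mulmx1 opprB.
    rewrite normrN (le_trans (cL _))//.
    apply: le_trans (_ : c * (e / (c * C) * (C * `|k|)) <= _).
      apply: ler_wpM2l; first exact: ltW.
      by apply: le_trans Hv _; apply: ler_wpM2l => //; exact: ltW.
    by rewrite le_eqVlt; apply/orP; left; apply/eqP; field; rewrite !gt_eqF.
  by split=> // v; rewrite deriveE// eG.
elim=> [|k IH].
  by move=> y /dG[dGy _]; apply: differentiable_continuous.
apply/Ck_onS; split=> [y /dG[]//|v].
apply: (@Ck_on_eq _ _ _ k _ (fun y => \sum_(i < n) \sum_(j < n)
    (v 0 j * invmx ('J F (G y)) j i) *: delta_mx 0 i)) => //.
  move=> y /dG[_ ->]; rewrite [RHS]row_sum_delta.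
  by apply: eq_bigr => i _; rewrite mxE scaler_suml.
apply: Ck_on_sum => // i _; apply: Ck_on_sum => // j _.
apply: Ck_onZ => //; last exact: Ck_on_cst.
apply: Ck_onM => //; first exact: Ck_on_cst.
apply: Ck_on_invmx => // [y /BG[/uJ]//|a b].
apply: (@Ck_on_eq _ _ _ k _ ((fun u => ('D_(delta_mx 0 a) F u) 0 b) \o G)) => //.
  move=> y /BG[/dF dFy _] /=; rewrite deriveEjacobian//.
  by rewrite -rowE mxE.
apply: (Ck_on_comp (E := B)) => //; first by move=> y /BG[].
have /Ck_onS[_ /(_ (delta_mx 0 a))] := sF k.+1.
by move/(Ck_on_rowP _ _ oB).
Qed.

(** Composing with the inverse of the Jacobian at [u0] reduces to a map close to the identity.
    The radius is quantified by a filter so that the ball may be shrunk further. *)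
Theorem inverse_function F D u0 : open D -> smooth_on D F -> D u0 ->
  'J F u0 \in unitmx ->
  \forall r \near (0 : R)^'+, exists G,
   [/\ ball u0 r `<=` D, open (F @` ball u0 r),
       (forall u, ball u0 r u -> G (F u) = u) & smooth_on (F @` ball u0 r) G].
Proof.
move=> oD sF Du0 uJ0; set J := 'J F u0 in uJ0.
pose H u := F u *m invmx J.
pose g u := H u - u.
have sFr k i : Ck_on k D (fun u => F u 0 i) by move: i; apply/Ck_on_rowP.
have sH k : Ck_on k D H.
  apply/Ck_on_rowP => // i; under eq_fun do rewrite mxE.
  by apply: Ck_on_sum => // j _; apply: Ck_onM => //; exact: Ck_on_cst.
have dF u : D u -> differentiable F u by have /Ck_onS[+ _] := sF 1%N; apply.
have dH u : D u -> differentiable H u by have /Ck_onS[+ _] := sH 1%N; apply.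
have sg : Ck_on 1 D g by apply: Ck_onB => //; exact: Ck_on_id.
have eg v : 'D_v g u0 = 0.
  rewrite deriveB; [|exact/diff_derivable/dH|exact: diff_derivable].
  rewrite derive_id; apply/eqP; rewrite subr_eq0; apply/eqP.
  have [_ ->] := derive_mulmxr (invmx J) v (dF _ Du0).
  by rewrite deriveEjacobian ?mulmxK//; exact: dF.
have dJ : \forall u \near u0, 'J F u \in unitmx.
  have Cdet : Ck_on 0 D (fun u => \det ('J F u)).
    apply: Ck_on_det => // i j.
    apply: (@Ck_on_eq _ _ _ 0 _ (fun u => ('D_(delta_mx 0 i) F u) 0 j)) => //.
      by move=> u Du; rewrite deriveEjacobian -?rowE ?mxE//; exact: dF.
    have /Ck_onS[_ /(_ (delta_mx 0 i))] := sF 1%N.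
    by move/(Ck_on_rowP _ _ oD).
  have C := Ck_on_cont Cdet Du0.
  have N : nbhs (\det ('J F u0)) [set x : R | x != 0].
    apply: open_nbhs_nbhs; split; last by rewrite /= -unitfE -unitmxE.
    rewrite (_ : [set _ | _] = ~` [set (0 : R)]); last first.
      by apply/seteqP; split=> x /eqP.
    exact: closed_openC.
  have {}N : nbhs u0 [set u | \det ('J F u) != 0] := C _ N.
  by apply: filterS N => u /= d0; rewrite unitmxE unitfE.
have oD0 : nbhs u0 D by exact: open_nbhs_nbhs.
have : nbhs u0 (D `&` [set u | 'J F u \in unitmx]) by exact: filterI.
move=> /nbhs_ballP[e /= e0 He].
have lipr := small_lipschitz oD sg Du0 eg.
have er : \forall r \near (0 : R)^'+, r < e by exact: nbhs_right_lt.
have r0 : \forall r \near (0 : R)^'+, 0 < r by exact: nbhs_right_gt.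
apply: filterS (filterI lipr (filterI er r0)) => r [lip [re rp]].
set B := ball u0 r.
have BD u : B u -> D u /\ 'J F u \in unitmx.
  by move=> Bu; apply: He; exact: le_ball (ltW re) _ Bu.
have oB : open B by exact: ball_open.
have lipH u v : B u -> B v -> `|(H u - H v) - (u - v)| <= `|u - v| / 2.
  move=> Bu Bv; have -> : (H u - H v) - (u - v) = g u - g v.
    by rewrite /g !opprD !opprK addrACA.
  exact: lip.
have cH u : B u -> {for u, continuous H}.
  by move=> /BD[/dH dHu _]; exact: differentiable_continuous.
have oHB : open (H @` B) by apply: near_id_open_image.
have FH u : F u = H u *m J by rewrite /H mulmxKV.
have oFB : open (F @` B).
  rewrite (_ : F @` B = (mulmxr (invmx J) : V -> V) @^-1` (H @` B)).
    by apply: open_comp => // x _; exact: mulmxr_continuous.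
  apply/seteqP; split=> y /=.
    by move=> [u Bu <-]; exists u.
  move=> [u Bu Eu]; exists u => //.
  by rewrite FH Eu mulmxKV.
have [c c0 cJ] := mulmxr_lipschitz (invmx J).
have ex u v : B u -> B v -> `|u - v| <= (2 * c) * `|F u - F v|.
  move=> Bu Bv; apply: le_trans (near_id_expand lipH Bu Bv) _.
  by rewrite -mulrA ler_wpM2l// /H -mulmxBl.
have c2 : 0 < 2 * c by rewrite mulr_gt0.
have sFB : smooth_on B F by move=> k; apply: Ck_on_sub (sF k) => u /BD[].
have [G [GF sG]] := smooth_inverse oB sFB oFB c2 ex (fun u Bu => (BD u Bu).2).
exists G; split=> // u /BD[]//.
Qed.

End InverseFunction.

(** * Vanishing criteria in one variable *)

Section OneDim.
Context {R : realType}.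
Implicit Types (f g k : R -> R) (a b t : R).

Lemma is_derive_cont f t (l : R) : is_derive t 1 f l -> {for t, continuous f}.
Proof. by move=> [df _]; apply: differentiable_continuous; apply/derivable1_diffP. Qed.

Lemma mvt_seg f f' a b : a <= b ->
  (forall t, a <= t <= b -> is_derive t 1 f (f' t)) ->
  exists2 c, a <= c <= b & f b - f a = f' c * (b - a).
Proof.
move=> ab df; have [x| |c] := @MVT_segment R f f' a b ab.
- by rewrite in_itv /= => /andP[ax xb]; apply: df; rewrite !ltW.
- apply/continuous_in_subspaceT => x; rewrite inE /= in_itv /= => xab.
  exact: is_derive_cont (df _ xab).
- by rewrite in_itv /=; exists c.
Qed.

Lemma zero_derive_const f a b : (forall t, a <= t <= b -> is_derive t 1 f 0) ->
  forall t, a <= t <= b -> f t = f a.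
Proof.
move=> df t /andP[at_ tb].
have [|c _] := @mvt_seg f (fun=> 0) a t at_.
  by move=> u /andP[au ut]; apply: df; rewrite au (le_trans ut).
by rewrite mul0r => /eqP; rewrite subr_eq0 => /eqP.
Qed.

Lemma mvt_bound f f' a b (B : R) : 0 <= B ->
  (forall t, a <= t <= b -> is_derive t 1 f (f' t) /\ `|f' t| <= B) ->
  forall s t, a <= s -> s <= t -> t <= b -> `|f t - f s| <= B * (t - s).
Proof.
move=> B0 df s t as_ st tb.
have [|c /andP[sc ct] ->] := @mvt_seg f f' s t st.
  by move=> u /andP[su ut]; apply: (df _ _).1; rewrite (le_trans as_ su) (le_trans ut).
rewrite normrM ler_pM//; last by rewrite ger0_norm ?subr_ge0.
by apply: (df _ _).2; rewrite (le_trans as_ sc) (le_trans ct).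
Qed.

Lemma near_right_seg (Q : R -> Prop) b : (\forall t \near b, Q t) ->
  exists2 e, 0 < e & forall t, b <= t <= b + e -> Q t.
Proof.
move=> /nbhs_ballP[r /= r0 H]; exists (r / 2); first by rewrite divr_gt0.
move=> t /andP[bt tb]; apply: H; rewrite -ball_normE /= distrC ger0_norm ?subr_ge0//; lra.
Qed.

Lemma cont_sign g b : {for b, continuous g} -> g b != 0 ->
  \forall t \near b, 0 < Num.sg (g b) * g t.
Proof.
move=> cg gb.
have c : {for b, continuous (fun t => Num.sg (g b) * g t)}.
  by apply: continuousM => //; exact: cst_continuous.
have p : 0 < Num.sg (g b) * g b by rewrite -normrEsg normr_gt0.
by have /cvgr_gt/(_ _ p) := c.
Qed.

Lemma cont_bound g b : {for b, continuous g} ->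
  \forall t \near b, `|g t| <= `|g b| + 1.
Proof.
move=> cg; have /cvgrPdist_le/(_ 1 ltr01) := cg; apply: filterS => t H.
by rewrite -lerBlDl (le_trans (lerB_dist _ _))// distrC.
Qed.

Lemma cont_small g b (e : R) : 0 < e -> {for b, continuous g} -> g b = 0 ->
  \forall t \near b, `|g t| <= e.
Proof.
move=> e0 cg g0; have /cvgrPdist_le/(_ e e0) := cg; apply: filterS => t.
by rewrite g0 sub0r normrN.
Qed.

Lemma cont_away g b : {for b, continuous g} -> g b != 0 ->
  \forall t \near b, `|g b| / 2 <= `|g t|.
Proof.
move=> cg gb; have h : 0 < `|g b| / 2 by rewrite divr_gt0// normr_gt0.
have /cvgrPdist_le/(_ _ h) := cg; apply: filterS => t H.
by have := lerB_dist (g b) (g t); lra.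
Qed.

(** By the mean value inequality [|g|] loses at most half of its value at [t] over the length
    [|g t| / (2 B)]; that length does not reach past [b], where [g] vanishes. *)
Lemma stays_large g g' b e (B t : R) : 0 < B -> b <= t <= b + e ->
  (forall t, b <= t <= b + e -> is_derive t 1 g (g' t) /\ `|g' t| <= B) ->
  g b = 0 -> forall u, t - `|g t| / (2 * B) <= u <= t ->
  b <= u /\ `|g t| / 2 <= `|g u|.
Proof.
move=> B0 /andP[bt te] dg gb u /andP[lu ut].
have h := mvt_bound (ltW B0) dg.
have h1 := h b t (lexx _) bt te; rewrite gb subr0 in h1.
have E : `|g t| / (2 * B) * B = `|g t| / 2 by field; rewrite gt_eqF.
have h2 : `|g t| / (2 * B) <= (t - b) / 2.
  by rewrite invfM mulrCA mulrC ler_wpM2r// ler_pdivrMr// mulrC.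
move: E h2 lu; set l := _ / (2 * B) => E h2 lu.
have bu : b <= u by lra.
split=> //.
have h3 := h u t bu ut te.
have h4 : B * (t - u) <= `|g t| / 2.
  by rewrite -E mulrC; apply: ler_wpM2r; [exact: ltW|lra].
have := lerB_dist (g t) (g u); lra.
Qed.

Lemma max_abs g g' b e : 0 <= e ->
  (forall t, b <= t <= b + e -> is_derive t 1 g (g' t)) ->
  exists2 t, b <= t <= b + e & forall u, b <= u <= b + e -> `|g u| <= `|g t|.
Proof.
move=> e0 dg; have be : b <= b + e by rewrite lerDl.
have [|t] := @EVT_max R (fun t => `|g t|) b (b + e) be.
  apply/continuous_in_subspaceT => x; rewrite inE /= in_itv /= => xab.
  apply: (@continuous_comp _ _ _ g (fun z : R => `|z|)).
    exact: is_derive_cont (dg _ xab).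
  exact: norm_continuous.
by rewrite in_itv /= => tb H; exists t => // u ub; apply: H; rewrite in_itv.
Qed.

(** A Gronwall argument on maxima: the maximum of [|k|] over a segment of length [d] is at most
    [C * d^2] times itself. *)
Lemma vanish_linear (k k' sig : R -> R) b e (C : R) : 0 < e -> 0 < C ->
  (forall t, b <= t <= b + e -> is_derive t 1 k (k' t)) ->
  (forall t, b <= t <= b + e -> is_derive t 1 sig (- k t)) ->
  k b = 0 -> sig b = 0 ->
  (forall t, b <= t <= b + e -> `|k' t| <= C * `|sig t|) ->
  exists2 d, 0 < d & forall t, b <= t <= b + d -> k t = 0.
Proof.
move=> e0 C0 dk ds kb sb H.
(* makes [C * d^2 <= 1 / 2] *)
pose d := Num.min e (Num.min 1 (2 * C)^-1).
have d0 : 0 < d by rewrite !lt_min e0 ltr01 invr_gt0 mulr_gt0.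
have de : d <= e by rewrite ge_min lexx.
have d1 : d <= 1 by rewrite !ge_min lexx orbT.
have dC : d * C <= 1 / 2.
  have h : d <= (2 * C)^-1 by rewrite !ge_min lexx !orbT.
  apply: le_trans (ler_wpM2r (ltW C0) h) _.
  by rewrite invfM mulfVK ?gt_eqF// div1r.
exists d => //.
have sub t : b <= t <= b + d -> b <= t <= b + e.
  by move=> /andP[-> h]; rewrite (le_trans h)// lerD2l.
have [t1 t1d M] := @max_abs k k' b d (ltW d0) (fun t td => dk t (sub t td)).
set K := `|k t1| in M.
have K0 : 0 <= K by rewrite /K.
have sK t : b <= t <= b + d -> `|sig t| <= K * d.
  move=> td; have /andP[bt tbd] := td.
  have := @mvt_bound sig (fun t => - k t) b (b + d) K K0 _ b t (lexx _) bt tbd.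
  rewrite sb subr0 => Hs; apply: le_trans (Hs _) _; last by rewrite ler_wpM2l//; lra.
  by move=> u ud; split; [exact: ds (sub _ ud)|rewrite normrN; exact: M].
have B0 : 0 <= C * (K * d) by rewrite !mulr_ge0// ltW.
have KK : K <= C * (K * d) * d.
  have /andP[bt tbd] := t1d.
  have := @mvt_bound k k' b (b + d) (C * (K * d)) B0 _ b t1 (lexx _) bt tbd.
  rewrite kb subr0 -/K => Hk; apply: le_trans (Hk _) _; last by rewrite ler_wpM2l//; lra.
  move=> u ud; split; first exact: dk (sub _ ud).
  by apply: le_trans (H _ (sub _ ud)) _; apply: ler_wpM2l; [exact: ltW|exact: sK].
have K1 : C * (K * d) * d <= K / 2.
  have -> : C * (K * d) * d = K * (d * C) * d by ring.
  rewrite -[leRHS]mulr1 -mulrA -[leRHS]mulrA; apply: ler_wpM2l => //.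
  by rewrite -div1r; apply: ler_pM => //; rewrite ?mulr_ge0// ltW.
move=> t td; apply/eqP; rewrite -normr_le0 (le_trans (M _ td))//; lra.
Qed.

(** Let [K], [K1] be the maxima of [|k|], [|k'|] on a short segment. As [sig' = - k], the bound
    on [sig] and the slow decay of [k] before its peak give [K^2 <= 8 C K K1^2]; the slow decay
    of [k'] before its own peak gives [K1^2 <= 8 ep K], where [ep] bounds [|k''|]. For small
    [ep] this is incompatible with [K > 0]. *)
Lemma vanish_quadratic (k k' k'' sig : R -> R) b e (C : R) : 0 < e -> 0 < C ->
  (forall t, b <= t <= b + e -> is_derive t 1 k (k' t)) ->
  (forall t, b <= t <= b + e -> is_derive t 1 k' (k'' t)) ->
  {for b, continuous k''} ->
  (forall t, b <= t <= b + e -> is_derive t 1 sig (- k t)) ->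
  k b = 0 -> k' b = 0 -> k'' b = 0 ->
  (forall t, b <= t <= b + e -> `|sig t| <= C * `|k t| * `|k' t|) ->
  exists2 d, 0 < d & forall t, b <= t <= b + d -> k t = 0.
Proof.
move=> e0 C0 dk dk' ck ds kb k'b k''b H.
(* chosen so that [8 C * 8 ep = 1 / 2] *)
pose ep := (128 * C)^-1.
have ep0 : 0 < ep by rewrite invr_gt0 mulr_gt0.
have [r r0 Hr] := near_right_seg (cont_small ep0 ck k''b).
pose d := Num.min e r.
have d0 : 0 < d by rewrite lt_min e0.
have sub t : b <= t <= b + d -> b <= t <= b + e.
  by move=> /andP[-> h]; rewrite (le_trans h)// lerD2l ge_min lexx.
have subr_ t : b <= t <= b + d -> b <= t <= b + r.
  by move=> /andP[-> h]; rewrite (le_trans h)// lerD2l ge_min lexx orbT.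
have [t1 t1d M] := @max_abs k k' b d (ltW d0) (fun t td => dk t (sub t td)).
have [t2 t2d M'] := @max_abs k' k'' b d (ltW d0) (fun t td => dk' t (sub t td)).
set K := `|k t1| in M; set K1 := `|k' t2| in M'.
exists d => // t td; apply/eqP; rewrite -normr_le0 (le_trans (M _ td))// leNgt.
apply/negP => K0.
have K10 : 0 < K1.
  rewrite lt_neqAle /K1 normr_ge0 andbT; apply/negP => /eqP/esym k10.
  have /andP[b1 t1b] := t1d.
  have [|c cd] := @mvt_seg k k' b t1 b1.
    by move=> u /andP[bu ut]; apply/dk/sub; rewrite bu (le_trans ut).
  have : `|k' c| <= 0.
    by rewrite -k10; apply: M'; case/andP: cd => -> h; rewrite (le_trans h).
  rewrite normr_le0 => /eqP ->; rewrite mul0r kb subr0 => E.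
  by move: K0; rewrite /K E normr0 ltxx.
have t1u u : t1 - K / (2 * K1) <= u <= t1 -> b <= u /\ K / 2 <= `|k u|.
  apply: (@stays_large k k' b d K1 t1 K10 t1d) => // s sd.
  by split; [exact: dk (sub _ sd)|exact: M'].
have t2u u : t2 - K1 / (2 * ep) <= u <= t2 -> b <= u /\ K1 / 2 <= `|k' u|.
  apply: (@stays_large k' k'' b d ep t2 ep0 t2d) => // s sd.
  by split; [exact: dk' (sub _ sd)|exact: Hr (subr_ _ sd)].
have Hs u : b <= u <= b + d -> `|sig u| <= C * K * K1.
  move=> ud; apply: le_trans (H _ (sub _ ud)) _.
  apply: ler_pM => //; [|by rewrite ler_wpM2l ?(ltW C0)//; exact: M|exact: M'].
  by rewrite mulr_ge0// ltW.
have I1 : K ^+ 2 <= 8 * C * K * K1 ^+ 2.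
  pose l := K / (2 * K1).
  have l0 : 0 <= l by rewrite divr_ge0 ?ltW// mulr_gt0.
  have bl : b <= t1 - l by have [|] := t1u (t1 - l); rewrite ?lexx// gerBl.
  have /andP[b1 t1b] := t1d.
  have [|s|c ct E] := @mvt_seg sig (fun t => - k t) (t1 - l) t1; first by rewrite gerBl.
    by move=> /andP[ls st]; apply/ds/sub; rewrite (le_trans bl)// (le_trans st).
  have [bc Kc] := t1u c ct.
  have h1 : K / 2 * l <= `|sig t1 - sig (t1 - l)|.
    rewrite E opprB subrKC normrM normrN (ger0_norm l0) ler_wpM2r//.
  have h2 : `|sig t1 - sig (t1 - l)| <= C * K * K1 + C * K * K1.
    apply: le_trans (ler_normB _ _) _; apply: lerD; apply: Hs => //.
    by rewrite bl; lra.
  have h3 : K / 2 * l <= 2 * (C * K * K1) by lra.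
  have h4 : 0 <= 4 * K1 by rewrite mulr_ge0// ltW.
  have := ler_wpM2r h4 h3.
  have -> : K / 2 * l * (4 * K1) = K ^+ 2 by rewrite /l; field; rewrite gt_eqF.
  by have -> : 2 * (C * K * K1) * (4 * K1) = 8 * C * K * K1 ^+ 2 by ring.
have I2 : K1 ^+ 2 <= 8 * ep * K.
  pose l := K1 / (2 * ep).
  have l0 : 0 <= l by rewrite divr_ge0 ?ltW// mulr_gt0.
  have bl : b <= t2 - l by have [|] := t2u (t2 - l); rewrite ?lexx// gerBl.
  have /andP[b1 t1b] := t2d.
  have [|s|c ct E] := @mvt_seg k k' (t2 - l) t2; first by rewrite gerBl.
    by move=> /andP[ls st]; apply/dk/sub; rewrite (le_trans bl)// (le_trans st).
  have [bc Kc] := t2u c ct.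
  have h1 : K1 / 2 * l <= `|k t2 - k (t2 - l)|.
    by rewrite E opprB subrKC normrM (ger0_norm l0) ler_wpM2r.
  have h2 : `|k t2 - k (t2 - l)| <= K + K.
    apply: le_trans (ler_normB _ _) _; apply: lerD; apply: M => //.
    by rewrite bl; lra.
  have h3 : K1 / 2 * l <= 2 * K by lra.
  have h4 : 0 <= 4 * ep by rewrite mulr_ge0// ltW.
  have := ler_wpM2r h4 h3.
  have -> : K1 / 2 * l * (4 * ep) = K1 ^+ 2 by rewrite /l; field; rewrite gt_eqF.
  by have -> : 2 * K * (4 * ep) = 8 * ep * K by ring.
have : K ^+ 2 <= 8 * C * K * (8 * ep * K).
  by apply: le_trans I1 _; rewrite ler_wpM2l// !mulr_ge0// ltW.
have -> : 8 * C * K * (8 * ep * K) = K ^+ 2 / 2 by rewrite /ep; field; rewrite gt_eqF.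
have : 0 < K ^+ 2 by rewrite exprn_gt0.
lra.
Qed.

End OneDim.

(** * Unique continuation of profiles *)

Section Uniqueness.
Context {R : realType}.
Implicit Types (f g k : R -> R) (a b t : R).

Lemma is_derive_eps f b (l e : R) : is_derive b 1 f l -> 0 < e ->
  \forall h \near (0 : R), `|f (h + b) - f b - h * l| <= e * `|h|.
Proof.
move=> [df <-] e0; have {}df : differentiable f b by apply/derivable1_diffP.
have := diff_eps df e0; apply: filterS => h.
have -> : 'd f b h = h * 'D_1 f b.
  by rewrite deriveE// -[X in 'd f b X]mulr1 [LHS]linearZ.
by [].
Qed.

Lemma near0_seg (Q : R -> Prop) : (\forall h \near (0 : R), Q h) ->
  exists2 r, 0 < r & forall h, `|h| < r -> Q h.
Proof.
move=> /nbhs_ballP[r /= r0 H]; exists r => // h hr; apply: H.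
by rewrite -ball_normE /= sub0r normrN.
Qed.

Lemma mvt_open f f' a b : a < b ->
  (forall t, a <= t <= b -> is_derive t 1 f (f' t)) ->
  exists2 c, a < c < b & f b - f a = f' c * (b - a).
Proof.
move=> ab df; have [x| |c] := @MVT R f f' a b ab.
- by rewrite in_itv /= => /andP[ax xb]; apply: df; rewrite !ltW.
- apply/continuous_in_subspaceT => x; rewrite inE /= in_itv /= => xab.
  exact: is_derive_cont (df _ xab).
- by rewrite in_itv /=; exists c.
Qed.

(** The derivative of a differentiable function is determined by its values on one side. *)
Lemma left_derive_eq f g b (f' g' e : R) : 0 < e ->
  is_derive b 1 f f' -> is_derive b 1 g g' ->
  (forall t, b - e < t <= b -> f t = g t) -> f' = g'.
Proof.
move=> e0 df dg fg; apply/eqP; rewrite -subr_eq0 -normr_le0.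
apply/ler_addgt0Pr => ep ep0; rewrite add0r.
have ep2 : 0 < ep / 2 by rewrite divr_gt0.
have [r r0 H] := near0_seg (filterI (is_derive_eps df ep2) (is_derive_eps dg ep2)).
pose h := - (Num.min (e / 2) (r / 2)).
have h0 : h < 0 by rewrite oppr_lt0 lt_min !divr_gt0.
have he : - (e / 2) <= h by rewrite lerN2 ge_min lexx.
have hr : - (r / 2) <= h by rewrite lerN2 ge_min lexx orbT.
have [|h1 h2] := H h.
  by rewrite ltr0_norm//; lra.
have E1 : f (h + b) = g (h + b) by apply: fg; apply/andP; split; lra.
have E2 : f b = g b by apply: fg; apply/andP; split; lra.
rewrite E1 E2 in h1.
have h3 : `|h| * `|f' - g'| <= ep * `|h|.
  rewrite -normrM; have -> : h * (f' - g') =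
    (g (h + b) - g b - h * g') - (g (h + b) - g b - h * f') by ring.
  by apply: le_trans (ler_normB _ _) _; lra.
by rewrite mulrC ler_pM2r ?normr_gt0 ?lt_eqF in h3.
Qed.

Variables (P : set R) (rho' rho'' E Psi : R -> R).
Hypothesis drho : forall x, P x -> is_derive x 1 rho' (rho'' x).
Hypothesis Psi0 : forall x, P x -> Psi x != 0.
Hypothesis cPsi : forall x, P x -> {for x, continuous Psi}.

(** The equations of the principal curvature [k] and of [sig] as functions of the height. Here
    [rho'] is the derivative of the ratio [m2] as a function of [k], and [rho' (k t)] may
    vanish, so that this is not a differential equation in normal form. *)
Record profile_at (k k' k'' sig : R -> R) t : Prop := ProfileAt {
  prof_P : P (k t);
  prof_k : is_derive t 1 k (k' t);
  prof_k' : is_derive t 1 k' (k'' t);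
  prof_k'' : {for t, continuous k''};
  prof_sig : is_derive t 1 sig (- k t);
  prof_E : sig t ^+ 2 = E (k t);
  prof_rho : rho' (k t) * k' t = sig t * Psi (k t) }.

Section OneSolution.
Variables (k k' k'' sig : R -> R) (b e : R).
Hypothesis e0 : 0 < e.
Hypothesis H : forall t, b <= t <= b + e -> profile_at k k' k'' sig t.

Let Hb : profile_at k k' k'' sig b.
Proof. by apply: H; rewrite lexx lerDl ltW. Qed.

Let ck : {for b, continuous k}. Proof. exact: is_derive_cont (prof_k Hb). Qed.

(** First [sig b = 0] by the last equation. If [k b] were nonzero, [sig] would grow linearly,
    too fast for [rho' (k) * k'], which is of smaller order. So [k b = 0], and the last
    equation bounds [k'] by [sig] when [rho' 0 <> 0], and [sig] by [k * k'] when [rho' 0 = 0]: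
    these are the two vanishing criteria. *)
Lemma flat_profile : k' b = 0 -> k'' b = 0 ->
  exists2 d, 0 < d & forall t, b <= t <= b + d -> k t = 0.
Proof.
move=> k'b k''b.
have Pb := prof_P Hb.
have sb : sig b = 0.
  have /eqP := prof_rho Hb; rewrite k'b mulr0 eq_sym mulf_eq0.
  by rewrite (negPf (Psi0 Pb)) orbF => /eqP.
have cPk : {for b, continuous (Psi \o k)} by apply: continuous_comp => //; exact: cPsi.
have crk : {for b, continuous (rho' \o k)}.
  have cr : {for k b, continuous rho'} := is_derive_cont (drho Pb).
  exact: (continuous_comp ck cr).
have Pk0 : (Psi \o k) b != 0 by exact: Psi0.
set c := `|Psi (k b)| / 2.
have c0 : 0 < c by rewrite divr_gt0// normr_gt0.
set C := `|rho' (k b)| + 1.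
have C0 : 0 < C by rewrite ltr_pwDr.
have Nc := cont_away cPk Pk0.
have Nr := cont_bound crk.
have kb : k b = 0.
  apply/eqP; apply/negP => /negP kb.
  pose p := `|k b| / 2; have p0 : 0 < p by rewrite divr_gt0// normr_gt0.
  pose ep := p * c / (2 * C).
  have ep0 : 0 < ep by apply: divr_gt0; apply: mulr_gt0.
  have Nk := cont_away ck kb.
  have Nk'' := cont_small ep0 (prof_k'' Hb) k''b.
  have [r r0 Hr] := near_right_seg (filterI (filterI Nc Nr) (filterI Nk Nk'')).
  pose d := Num.min e r.
  have d0 : 0 < d by rewrite lt_min e0.
  have de t : b <= t <= b + d -> b <= t <= b + e.
    by move=> /andP[-> h]; rewrite (le_trans h)// lerD2l ge_min lexx.
  have dr t : b <= t <= b + d -> b <= t <= b + r.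
    by move=> /andP[-> h]; rewrite (le_trans h)// lerD2l ge_min lexx orbT.
  have bd : b <= b + d by rewrite lerDl ltW.
  have dd : b <= b + d <= b + d by rewrite bd lexx.
  have [|u /dr/Hr[_ [ku _]]] := @mvt_seg _ sig (fun t => - k t) b (b + d) bd.
    by move=> t /de/H/prof_sig.
  rewrite sb subr0 addrAC subrr add0r => su.
  have hk' : `|k' (b + d)| <= ep * d.
    have := @mvt_bound _ k' k'' b (b + d) ep (ltW ep0) _ b (b + d) (lexx _) bd (lexx _).
    rewrite k'b subr0 addrAC subrr add0r; apply.
    by move=> t td; have [_ [_]] := Hr _ (dr _ td); split=> //; exact: prof_k' (H (de _ td)).
  have [[/= hc hC] _] := Hr _ (dr _ dd).
  have := congr1 (fun z => `|z|) (prof_rho (H (de _ dd))).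
  rewrite !normrM su normrM normrN (gtr0_norm d0) => EE.
  have l1 : p * d * c <= `|k u| * d * `|Psi (k (b + d))|.
    by apply: ler_pM => //; rewrite ?mulr_ge0// ?(ltW c0) ?(ltW d0) ?(ltW p0)// ler_wpM2r// ltW.
  have l2 : `|rho' (k (b + d))| * `|k' (b + d)| <= C * (ep * d) by exact: ler_pM.
  have : p * d * c <= C * (ep * d) by rewrite (le_trans l1)// -EE.
  have -> : C * (ep * d) = p * d * c / 2 by rewrite /ep; field; rewrite gt_eqF.
  have : 0 < p * d * c by apply: mulr_gt0 => //; exact: mulr_gt0.
  lra.
have [rb|rb] := eqVneq (rho' (k b)) 0; last first.
  have Nr' := cont_away crk rb; rewrite [X in X / 2]/= in Nr'.
  set a := `|rho' (k b)| / 2 in Nr'.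
  have a0 : 0 < a by rewrite divr_gt0// normr_gt0.
  have NP := cont_bound cPk; rewrite [X in `|X| + 1]/= in NP.
  set B := `|Psi (k b)| + 1 in NP.
  have B0 : 0 < B by rewrite ltr_pwDr.
  have [r r0 Hr] := near_right_seg (filterI Nr' NP).
  pose d := Num.min e r.
  have d0 : 0 < d by rewrite lt_min e0.
  have de t : b <= t <= b + d -> b <= t <= b + e.
    by move=> /andP[-> h]; rewrite (le_trans h)// lerD2l ge_min lexx.
  have dr t : b <= t <= b + d -> b <= t <= b + r.
    by move=> /andP[-> h]; rewrite (le_trans h)// lerD2l ge_min lexx orbT.
  apply: (@vanish_linear _ k k' sig b d (B / a)) => //.
  - by rewrite divr_gt0.
  - by move=> t /de/H/prof_k.
  - by move=> t /de/H/prof_sig.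
  - move=> t td; have [/= ha hB] := Hr _ (dr _ td).
    have := congr1 (fun z => `|z|) (prof_rho (H (de _ td))); rewrite !normrM => EE.
    rewrite mulrAC ler_pdivlMr//.
    apply: le_trans (_ : `|k' t| * `|rho' (k t)| <= _); first by rewrite ler_wpM2l.
    by rewrite mulrC EE mulrC ler_wpM2r.
have Pb0 : P 0 by rewrite -kb.
have L := is_derive_eps (drho Pb0) (ltr01).
rewrite kb in rb; set A := `|rho'' 0| + 1.
have A0 : 0 < A by rewrite ltr_pwDr.
have NL : \forall t \near b, `|rho' (k t)| <= A * `|k t|.
  have NA : \forall h \near k b, `|rho' h| <= A * `|h|.
    rewrite kb.
    apply: filterS L => h; rewrite addr0 rb subr0 mul1r => Lh.
    have := ler_normD (rho' h - h * rho'' 0) (h * rho'' 0).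
    by rewrite subrK normrM /A mulrDl mul1r (mulrC `|h|); lra.
  have NB : nbhs b (k @^-1` [set h | `|rho' h| <= A * `|h|]) := ck NA.
  by [].
have [r r0 Hr] := near_right_seg (filterI Nc NL).
pose d := Num.min e r.
have d0 : 0 < d by rewrite lt_min e0.
have de t : b <= t <= b + d -> b <= t <= b + e.
  by move=> /andP[-> h]; rewrite (le_trans h)// lerD2l ge_min lexx.
have dr t : b <= t <= b + d -> b <= t <= b + r.
  by move=> /andP[-> h]; rewrite (le_trans h)// lerD2l ge_min lexx orbT.
apply: (@vanish_quadratic _ k k' k'' sig b d (A / c)) => //.
- by rewrite divr_gt0.
- by move=> t /de/H/prof_k.
- by move=> t /de/H/prof_k'.
- exact: prof_k'' Hb.
- by move=> t /de/H/prof_sig.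
- move=> t td; have [/= hc hL] := Hr _ (dr _ td).
  have := congr1 (fun z => `|z|) (prof_rho (H (de _ td))); rewrite !normrM => EE.
  have -> : A / c * `|k t| * `|k' t| = (A * `|k t| * `|k' t|) / c.
    by ring.
  rewrite ler_pdivlMr//; apply: le_trans (_ : `|sig t| * `|Psi (k t)| <= _).
    by rewrite ler_wpM2l.
  by rewrite -EE ler_wpM2r.
Qed.

Lemma nonzero_right g g' : (forall t, b <= t <= b + e -> is_derive t 1 g (g' t)) ->
  (forall t, b < t <= b + e -> g' t != 0) ->
  exists2 d, 0 < d <= e & forall t, b < t <= b + d -> g t != 0.
Proof.
move=> dg g'0.
have cg : {for b, continuous g} by apply: is_derive_cont (dg b _); rewrite lexx lerDl ltW.
have [gb|gb] := eqVneq (g b) 0.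
  exists e => [|t /andP[bt te]]; first by rewrite e0 lexx.
  have [|c /andP[bc ct] Eg] := @mvt_open g g' b t bt.
    by move=> u /andP[bu ut]; apply: dg; rewrite bu (le_trans ut).
  rewrite gb subr0 in Eg; rewrite Eg mulf_neq0 ?subr_eq0 ?(gt_eqF bt)//.
  by apply: g'0; rewrite bc (le_trans (ltW ct)).
have [r r0 Hr] := near_right_seg (cont_away cg gb).
exists (Num.min e r) => [|t /andP[bt]]; first by rewrite lt_min e0 r0 ge_min lexx.
move=> te; have : `|g b| / 2 <= `|g t|.
  by apply: Hr; rewrite ltW//= (le_trans te)// lerD2l ge_min lexx orbT.
rewrite -normr_gt0; apply: lt_le_trans.
by rewrite divr_gt0// normr_gt0.
Qed.

End OneSolution.

Section TwoSolutions.
Variables (k k' k'' sig l l' l'' tau : R -> R) (b e : R).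
Hypothesis e0 : 0 < e.
Hypothesis Hk : forall t, b <= t <= b + e -> profile_at k k' k'' sig t.
Hypothesis Hl : forall t, b <= t <= b + e -> profile_at l l' l'' tau t.
Hypothesis kl : k b = l b.

(** The equations determine [k'] up to sign as a function of [k]:
    [rho' (k)^2 * k'^2 = E (k) * Psi (k)^2]. Hence, when [k] and [l] are monotone in the same
    sense, the function [k^-1 o l] has derivative 1; it fixes [b], so it is the identity. *)
Lemma monotone_profile (s : R) :
  (forall t, b < t <= b + e -> 0 < s * k' t /\ 0 < s * l' t) ->
  exists2 d, 0 < d & forall t, b <= t <= b + d -> k t = l t.
Proof.
move=> S.
have k'0 t : b < t <= b + e -> k' t != 0.
  by move=> /S[+ _]; apply: contraTneq => ->; rewrite mulr0 ltxx.
have [e1 /andP[e10 e1e] k0] := nonzero_right e0 (fun t h => prof_k (Hk h)) k'0.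
have sub1 t : b <= t <= b + e1 -> b <= t <= b + e.
  by move=> /andP[-> h]; rewrite (le_trans h)// lerD2l.
have [|c /andP[c0 ce1] s0] := @nonzero_right b e1 e10 sig (fun t => - k t)
    (fun t h => prof_sig (Hk (sub1 _ h))).
  by move=> t /k0; rewrite oppr_eq0.
have sub t : b <= t <= b + c -> b <= t <= b + e.
  by move=> /andP[-> h]; rewrite (le_trans h)// lerD2l (le_trans ce1).
have S' t : b < t <= b + c -> 0 < s * k' t /\ 0 < s * l' t.
  by move=> /andP[h1 h2]; apply: S; rewrite h1 (le_trans h2)// lerD2l (le_trans ce1).
have incr (m m' : R -> R) : (forall t, b <= t <= b + c -> is_derive t 1 m (m' t)) ->
    (forall t, b < t <= b + c -> 0 < s * m' t) ->
    forall t u, b <= t -> t < u -> u <= b + c -> s * m t < s * m u.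
  move=> dm m'0 t u bt tu uc; rewrite -subr_gt0 -mulrBr.
  have [|x /andP[tx xu] ->] := @mvt_open m m' t u tu.
    by move=> x /andP[tx xu]; apply: dm; rewrite (le_trans bt)// (le_trans xu).
  rewrite mulrA mulr_gt0 ?subr_gt0//; apply: m'0.
  by rewrite (le_lt_trans bt)//= (le_trans (ltW xu)).
have inck := incr k k' (fun t h => prof_k (Hk (sub t h))) (fun t h => (S' t h).1).
have incl := incr l l' (fun t h => prof_k (Hl (sub t h))) (fun t h => (S' t h).2).
have bc : b < b + c by rewrite ltrDl.
have [d [d0 dc Hd]] : exists d, [/\ 0 < d, d <= c &
    forall t, b <= t <= b + d -> s * l t < s * k (b + c)].
  have cl : {for b, continuous (fun t => s * l t)}.
    apply: continuousM; first exact: cst_continuous.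
    by apply: is_derive_cont (prof_k (Hl _)); rewrite lexx lerDl ltW.
  have h : s * l b < s * k (b + c) by rewrite -kl; apply: inck.
  have /cvgr_lt/(_ _ h) := cl => /near_right_seg[r r0 Hr].
  exists (Num.min c r); split; [by rewrite lt_min c0|by rewrite ge_min lexx|].
  move=> t /andP[bt tr]; apply: Hr; rewrite bt (le_trans tr)//.
  by rewrite lerD2l ge_min lexx orbT.
pose g y : R := xget b [set u | b <= u <= b + c /\ k u = y].
have gk u : b <= u <= b + c -> g (k u) = u.
  move=> uc; rewrite /g; case: xgetP => [v _ [/andP[bv vc] Ev]|/(_ u)]; last by case.
  case/andP: uc => bu uc.
  by case: (ltgtP v u) => // h; [have := inck _ _ bv h uc|have := inck _ _ bu h vc];
    rewrite Ev ltxx.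
have gl t : b < t <= b + d -> [/\ b < g (l t), g (l t) < b + c & k (g (l t)) = l t].
  move=> /andP[bt td].
  have h1 : s * k b < s * l t by rewrite kl; apply: incl => //; rewrite (le_trans td)// lerD2l.
  have h2 : s * l t < s * k (b + c) by apply: Hd; rewrite ltW.
  have [| |u] := @IVT R (fun u => s * k u) b (b + c) (s * l t) (ltW bc).
  - apply/continuous_in_subspaceT => x; rewrite inE /= in_itv /= => xc.
    apply: continuousM; first exact: cst_continuous.
    exact: is_derive_cont (prof_k (Hk (sub _ xc))).
  - by rewrite ge_min le_max (ltW h1) (ltW h2) orbT.
  rewrite in_itv /= => uc Eu.
  have s0' : s != 0.
    by apply/negP => /eqP s00; move: h1; rewrite s00 !mul0r ltxx.
  have ku : k u = l t by apply: (mulfI s0').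
  rewrite -ku (gk _ uc); case/andP: uc => bu uc; split=> //.
    rewrite lt_neqAle bu andbT; apply/negP => /eqP bu'.
    by move: h1; rewrite -ku -bu' ltxx.
  rewrite lt_neqAle uc andbT; apply/negP => /eqP bu'.
  by move: h2; rewrite -ku bu' ltxx.
have dphi t : b < t < b + d -> is_derive t 1 (fun t => g (l t) - t) 0.
  move=> /andP[bt td]; have [|bu uc ku] := gl t; first by rewrite bt ltW.
  set u := g (l t) in bu uc ku.
  have ucc : b <= u <= b + c by rewrite !ltW.
  have tcc : b <= t <= b + c by rewrite ltW//= ltW// (lt_le_trans td)// lerD2l.
  have Pk := Hk (sub _ ucc); have Pl := Hl (sub _ tcc).
  have Nu : \forall x \near u, b <= x <= b + c.
    have : \forall x \near u, x \in `]b, b + c[ by apply: near_in_itvoo; rewrite in_itv /= bu.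
    by apply: filterS => x; rewrite in_itv /= => /andP[h1 h2]; rewrite !ltW.
  have k'u : k' u != 0 by apply: k'0; rewrite bu; case/andP: (sub _ ucc).
  have dg : is_derive (k u) 1 g (k' u)^-1.
    apply: is_derive_inverse => //.
    - by apply: filterS Nu => x; exact: gk.
    - by apply: filterS Nu => x /sub/Hk/prof_k/is_derive_cont.
    - exact: prof_k Pk.
  rewrite ku in dg.
  have dgl := is_derive1_comp dg (prof_k Pl).
  have E1 : (k' u)^-1 * l' t = 1.
    have [sk _] : 0 < s * k' u /\ 0 < s * l' u by apply: S'; rewrite bu ltW.
    have [_ sl] : 0 < s * k' t /\ 0 < s * l' t.
      by apply: S'; rewrite bt; case/andP: tcc.
    have su : sig u != 0 by apply: s0; rewrite bu ltW.
    have e1' := prof_rho Pk; have e2 := prof_rho Pl.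
    have e3 := prof_E Pk; have e4 := prof_E Pl.
    rewrite ku in e1' e3; rewrite -e3 in e4.
    have r0 : rho' (l t) != 0.
      apply/negP => /eqP r0; move/eqP: e1'; rewrite r0 mul0r eq_sym mulf_eq0 (negPf su) /=.
      by apply/negP; apply: Psi0; exact: prof_P Pl.
    have sq : (s * l' t) ^+ 2 = (s * k' u) ^+ 2.
      rewrite !exprMn; congr (_ * _).
      have r2 : rho' (l t) ^+ 2 != 0 by rewrite expf_neq0.
      by apply: (mulfI r2); rewrite -!exprMn e1' e2 !exprMn e4.
    have /eqP := sq; rewrite eqf_sqr => /orP[/eqP E1|/eqP E1]; last by lra.
    have s0' : s != 0 by apply: contraTneq sk => ->; rewrite mul0r ltxx.
    by rewrite (mulfI s0' E1) mulVf.
  rewrite E1 in dgl.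
  have := is_deriveB dgl (is_derive_id t 1); rewrite subrr; exact.
have cphi t u : b < t -> t <= u -> u < b + d -> g (l u) - u = g (l t) - t.
  move=> bt tu ud; apply: (@zero_derive_const _ (fun t => g (l t) - t) t u).
    by move=> x /andP[tx xu]; apply: dphi; rewrite (lt_le_trans bt)// (le_lt_trans xu).
  by rewrite tu lexx.
pose t0 := b + d / 2.
have bt0 : b < t0 by rewrite ltrDl divr_gt0.
have t0d : t0 < b + d by rewrite ltrD2l; lra.
(* [g (l t) - t] is constant near [b]; that the constant is 0 is a limit at [b], where [g] is
   not known to be continuous *)
pose C := g (l t0) - t0.
have HC t : b < t -> t < b + d -> g (l t) = t + C.
  move=> bt td; have : g (l t) - t = C.
    by case: (leP t t0) => h; [rewrite -(cphi t t0)|rewrite (cphi t0 t)//; exact: ltW].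
  by move=> <-; rewrite subrKC.
have C0 : C = 0.
  case: (ltgtP C 0) => // Cs.
    pose t := b + Num.min (d / 2) (- C / 2).
    have m0 : 0 < Num.min (d / 2) (- C / 2) by rewrite lt_min; lra.
    have m1 : Num.min (d / 2) (- C / 2) <= d / 2 by rewrite ge_min lexx.
    have m2 : Num.min (d / 2) (- C / 2) <= - C / 2 by rewrite ge_min lexx orbT.
    have bt : b < t by rewrite /t; lra.
    have td : t < b + d by rewrite /t; lra.
    have [|h _ _] := gl t; first by rewrite bt ltW.
    by move: h; rewrite (HC t bt td) /t; lra.
  have bC : b + C < b + c.
    rewrite ltNge; apply/negP => h.
    have [|_ h1 _] := gl t0; first by rewrite bt0 ltW.
    by move: h1; rewrite (HC t0 bt0 t0d); lra.
  have lb : s * l b < s * k (b + C) by rewrite -kl; apply: inck; lra.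
  have cl : {for b, continuous (fun t => s * l t)}.
    apply: continuousM; first exact: cst_continuous.
    by apply: is_derive_cont (prof_k (Hl _)); rewrite lexx lerDl ltW.
  have /cvgr_lt/(_ _ lb) := cl => /near_right_seg[r r0 Hr].
  pose t := b + Num.min (d / 2) r.
  have m0 : 0 < Num.min (d / 2) r by rewrite lt_min r0 divr_gt0.
  have m1 : Num.min (d / 2) r <= d / 2 by rewrite ge_min lexx.
  have m2 : Num.min (d / 2) r <= r by rewrite ge_min lexx orbT.
  have bt : b < t by rewrite /t; lra.
  have td : t < b + d by rewrite /t; lra.
  have [|h1 h2 h3] := gl t; first by rewrite bt ltW.
  have lt1 : s * l t < s * k (b + C) by apply: Hr; rewrite ltW//= lerD2l.
  rewrite (HC t bt td) in h1 h2 h3.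
  have : s * k (b + C) < s * k (t + C) by apply: inck; rewrite ?ltrD2r//; lra.
  by rewrite h3; lra.
exists (d / 2); first by rewrite divr_gt0.
move=> t /andP[bt td].
move: bt; rewrite le_eqVlt => /orP[/eqP <-//|bt].
have td' : t < b + d by lra.
have [|_ _ <-] := gl t; first by rewrite bt ltW.
by rewrite (HC t bt td') C0 addr0.
Qed.

End TwoSolutions.

Lemma profile_reflect k k' k'' sig t : profile_at k k' k'' sig t ->
  profile_at (fun t => k (- t)) (fun t => - k' (- t)) (fun t => k'' (- t))
    (fun t => - sig (- t)) (- t).
Proof.
move=> [hP hk hk' hk'' hs hE hr].
have dN (f : R -> R) (a : R) : is_derive t 1 f a -> is_derive (- t) 1 (fun t => f (- t)) (- a).
  move=> df; have dopp : is_derive (- t) 1 (fun t : R => - t) (-1) by exact: is_deriveNid.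
  have df' : is_derive (- - t) 1 f a by rewrite opprK.
  by have := is_derive1_comp df' dopp; rewrite mulrN1.
split; rewrite ?opprK//.
- exact: dN.
- by rewrite -[k'' t]opprK; exact: (is_deriveN (dN k' _ hk')).
- apply: continuous_comp; first exact: opp_continuous.
  by rewrite opprK.
- by have := is_deriveN (dN sig _ hs); rewrite opprK.
- by rewrite sqrrN.
- by rewrite mulrN hr mulNr.
Qed.

Section Extension.
Variables (k k' k'' sig l l' l'' tau : R -> R).

Let agree t := k t = l t /\ sig t = tau t.

(** At [b] the two solutions share [k], [k'] and [k'']. Either [k'] and [k''] vanish there and
    both [k] and [l] vanish to the right, or one of them is nonzero and both solutions are
    monotone in the same sense to the right. *)
Lemma right_extension b e : 0 < e ->
  (forall t, b - e < t < b + e -> profile_at k k' k'' sig t) ->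
  (forall t, b - e < t < b + e -> profile_at l l' l'' tau t) ->
  (forall t, b - e < t <= b -> agree t) ->
  exists2 d, 0 < d & forall t, b <= t <= b + d -> agree t.
Proof.
move=> e0 Hk Hl A.
have sub t : b - e < t <= b -> b - e < t < b + e.
  by move=> /andP[-> h] /=; lra.
have bb : b - e < b <= b by rewrite lexx andbT; lra.
have j1 t : b - e < t <= b -> k' t = l' t.
  move=> /[dup] tb /andP[t1 t2].
  apply: (@left_derive_eq k l t _ _ (t - (b - e))).
  - lra.
  - exact: prof_k (Hk _ (sub _ tb)).
  - exact: prof_k (Hl _ (sub _ tb)).
  - move=> u /andP[u1 u2]; have [] // := A u; apply/andP; split; lra.
have j2 : k'' b = l'' b.
  apply: (@left_derive_eq k' l' b _ _ e) => //.
  - exact: prof_k' (Hk _ (sub _ bb)).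
  - exact: prof_k' (Hl _ (sub _ bb)).
have [kb sb] := A b bb; have k'b := j1 b bb.
have e2 : 0 < e / 2 by rewrite divr_gt0.
have Hk2 t : b <= t <= b + e / 2 -> profile_at k k' k'' sig t.
  by move=> /andP[h1 h2]; apply: Hk; apply/andP; split; lra.
have Hl2 t : b <= t <= b + e / 2 -> profile_at l l' l'' tau t.
  by move=> /andP[h1 h2]; apply: Hl; apply/andP; split; lra.
have bb2 : b <= b <= b + e / 2 by apply/andP; split; lra.
suff [d d0 Hd] : exists2 d, 0 < d & forall t, b <= t <= b + d -> k t = l t.
  have d'0 : 0 < Num.min d (e / 2) by rewrite lt_min d0.
  have m1 : Num.min d (e / 2) <= d by rewrite ge_min lexx.
  have m2 : Num.min d (e / 2) <= e / 2 by rewrite ge_min lexx orbT.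
  exists (Num.min d (e / 2)) => // t tb; have /andP[bt td] := tb.
  split; first by apply: Hd; apply/andP; split; lra.
  have dst u : b <= u <= b + Num.min d (e / 2) ->
      is_derive u 1 (fun u => sig u - tau u) 0.
    move=> /andP[bu ud].
    have ub : b <= u <= b + e / 2 by apply/andP; split; lra.
    have := is_deriveB (prof_sig (Hk2 _ ub)) (prof_sig (Hl2 _ ub)).
    have -> : - k u - - l u = 0 by rewrite (Hd u) ?subrr//; apply/andP; split; lra.
    exact.
  have := zero_derive_const dst tb; rewrite sb subrr => /eqP.
  by rewrite subr_eq0 => /eqP.
have mono (s : R) (r : R) : 0 < r -> (forall t, b < t <= b + r ->
     b <= t <= b + e / 2 -> 0 < s * k' t /\ 0 < s * l' t) ->
  exists2 d, 0 < d & forall t, b <= t <= b + d -> k t = l t.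
  move=> r0 S.
  have m0 : 0 < Num.min r (e / 2) by rewrite lt_min r0.
  have m1 : Num.min r (e / 2) <= r by rewrite ge_min lexx.
  have m2 : Num.min r (e / 2) <= e / 2 by rewrite ge_min lexx orbT.
  have subm t : b <= t <= b + Num.min r (e / 2) -> b <= t <= b + e / 2.
    by move=> /andP[h1 h2]; apply/andP; split; lra.
  have MP := @monotone_profile k k' k'' sig l l' l'' tau b _ m0
     (fun t h => Hk2 t (subm t h)) (fun t h => Hl2 t (subm t h)) kb s.
  apply: MP.
  by move=> t /andP[h1 h2]; apply: S; [|apply: subm]; apply/andP; split; lra.
have Pk := Hk2 _ bb2; have Pl := Hl2 _ bb2.
have [k'0|k'0] := eqVneq (k' b) 0; last first.
  have l'0 : l' b != 0 by rewrite -k'b.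
  have [r r0 Hr] := near_right_seg (filterI (cont_sign (is_derive_cont (prof_k' Pk)) k'0)
     (cont_sign (is_derive_cont (prof_k' Pl)) l'0)).
  apply: (mono (Num.sg (k' b)) r r0) => t /andP[h1 h2] _.
  by have [|? ?] := Hr t; [rewrite (ltW h1)|split=> //; rewrite k'b].
have [k''0|k''0] := eqVneq (k'' b) 0; last first.
  have l''0 : l'' b != 0 by rewrite -j2.
  have [r r0 Hr] := near_right_seg (filterI (cont_sign (prof_k'' Pk) k''0)
     (cont_sign (prof_k'' Pl) l''0)).
  have l'0 : l' b = 0 by rewrite -k'b.
  apply: (mono (Num.sg (k'' b)) r r0) => t /andP[h1 h2] /andP[h3 h4].
  split.
    have [|c /andP[c1 c2] E1] := @mvt_seg _ k' k'' b t h3.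
      by move=> u /andP[u1 u2]; apply: prof_k' (Hk2 _ _); apply/andP; split; lra.
    have [|S1 S2] := Hr c; first by rewrite c1 (le_trans c2).
    by rewrite k'0 subr0 in E1; rewrite E1 mulrA mulr_gt0// subr_gt0.
  have [|c /andP[c1 c2] E1] := @mvt_seg _ l' l'' b t h3.
    by move=> u /andP[u1 u2]; apply: prof_k' (Hl2 _ _); apply/andP; split; lra.
  have [|S1 S2] := Hr c; first by rewrite c1 (le_trans c2).
  by rewrite l'0 subr0 in E1; rewrite E1 j2 mulrA mulr_gt0// subr_gt0.
have [d1 d10 H1] := flat_profile e2 Hk2 k'0 k''0.
have l'0 : l' b = 0 by rewrite -k'b.
have l''0 : l'' b = 0 by rewrite -j2.
have [d2 d20 H2] := flat_profile e2 Hl2 l'0 l''0.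
exists (Num.min d1 d2); first by rewrite lt_min d10.
have m1 : Num.min d1 d2 <= d1 by rewrite ge_min lexx.
have m2 : Num.min d1 d2 <= d2 by rewrite ge_min lexx orbT.
move=> t /andP[h1 h2]; rewrite H1 ?H2//; apply/andP; split; lra.
Qed.

Lemma forward_unique (J : set R) t0 t1 : is_interval J -> open J -> J t0 -> J t1 ->
  (forall t, J t -> profile_at k k' k'' sig t) ->
  (forall t, J t -> profile_at l l' l'' tau t) ->
  (\forall t \near t0, agree t) -> t0 <= t1 -> agree t1.
Proof.
move=> iJ oJ J0 J1 Hk Hl A t01.
have /nbhs_ballP[e0 /= e00 He0] := A.
have A0 t : t0 - e0 < t < t0 + e0 -> agree t.
  by move=> h; apply: He0; rewrite -ball_normE /= ltr_norml; lra.
pose S := [set t | t0 <= t <= t1 /\ forall u, t0 <= u <= t -> agree u].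
have S0 : S t0.
  split=> [|u /andP[h1 h2]]; first by rewrite lexx.
  by apply: A0; lra.
have hS : has_sup S.
  by split; [exists t0|exists t1 => u [/andP[]]].
set b := sup S.
have b0 : t0 <= b by apply: sup_upper_bound.
have b1 : b <= t1 by apply: ge_sup; [exists t0|move=> u [/andP[]]].
have Ab u : t0 <= u -> u < b -> agree u.
  move=> u0 ub; have ep : 0 < b - u by rewrite subr_gt0.
  have [v [/andP[v0 v1] Hv] vb] := sup_adherent ep hS.
  by apply: Hv; rewrite u0 -/b /= in vb *; lra.
have Jb : J b by apply: (iJ t0 t1) => //; rewrite b0.
have /nbhs_ballP[e1 /= e10 He1] : nbhs b J by exact: open_nbhs_nbhs.
have Je t : b - e1 < t < b + e1 -> J t.
  by move=> h; apply: He1; rewrite -ball_normE /= ltr_norml; lra.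
pose e := Num.min e0 e1.
have m0 : 0 < e by rewrite lt_min e00.
have m1 : e <= e0 by rewrite ge_min lexx.
have m2 : e <= e1 by rewrite ge_min lexx orbT.
have Ab' : forall t, b - e < t < b -> agree t.
  move=> t /andP[h1 h2]; have [h|h] := leP t0 t; first exact: Ab.
  by apply: A0; lra.
have Hkb t : b - e < t < b + e -> profile_at k k' k'' sig t.
  by move=> h; apply: Hk; apply: Je; lra.
have Hlb t : b - e < t < b + e -> profile_at l l' l'' tau t.
  by move=> h; apply: Hl; apply: Je; lra.
have left_eq (f g : R -> R) : {for b, continuous f} -> {for b, continuous g} ->
    (forall t, b - e < t < b -> f t = g t) -> f b = g b.
  move=> cf cg fg; apply/eqP; rewrite -subr_eq0 -normr_le0.
  apply/ler_addgt0Pr => ep ep0; rewrite add0r.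
  have cfg : {for b, continuous (fun t => f t - g t)} by exact: continuousB.
  have /cvgrPdist_le/(_ ep ep0)/nbhs_ballP[r /= r0 Hr] := cfg.
  pose t := b - Num.min (e / 2) (r / 2).
  have q0 : 0 < Num.min (e / 2) (r / 2) by rewrite lt_min !divr_gt0.
  have q1 : Num.min (e / 2) (r / 2) <= e / 2 by rewrite ge_min lexx.
  have q2 : Num.min (e / 2) (r / 2) <= r / 2 by rewrite ge_min lexx orbT.
  have := Hr t; rewrite (fg t) ?subrr ?subr0; last by rewrite /t; lra.
  apply; rewrite -ball_normE /= /t opprB addrCA subrr addr0 gtr0_norm//; lra.
have bb : b - e < b < b + e by lra.
have agb : agree b.
  split; apply: left_eq.
  - exact: is_derive_cont (prof_k (Hkb _ bb)).
  - exact: is_derive_cont (prof_k (Hlb _ bb)).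
  - by move=> t /Ab'[].
  - exact: is_derive_cont (prof_sig (Hkb _ bb)).
  - exact: is_derive_cont (prof_sig (Hlb _ bb)).
  - by move=> t /Ab'[].
have [|d d0 Hd] := right_extension m0 Hkb Hlb.
  move=> t /andP[h1]; rewrite le_eqVlt => /orP[/eqP -> //|h2].
  by apply: Ab'; rewrite h1.
move: b1; rewrite le_eqVlt => /orP[/eqP <- //|b1].
pose c := Num.min (b + d) t1.
have cb : b < c by rewrite lt_min b1 ltrDl d0.
have c1 : c <= b + d by rewrite ge_min lexx.
have c2 : c <= t1 by rewrite ge_min lexx orbT.
have Sc : S c.
  split=> [|u /andP[u0 uc]]; first by lra.
  have [ub|ub] := ltP u b; first exact: Ab.
  by apply: Hd; lra.
have := sup_upper_bound hS Sc; rewrite -/b; lra.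
Qed.
End Extension.

(** The system is invariant under reversal of time together with [sig -> - sig], so agreement
    to the left follows from agreement to the right. *)
Theorem profile_unique (k k' k'' sig l l' l'' tau : R -> R) (J : set R) t0 :
  is_interval J -> open J -> J t0 ->
  (forall t, J t -> profile_at k k' k'' sig t) ->
  (forall t, J t -> profile_at l l' l'' tau t) ->
  (\forall t \near t0, k t = l t /\ sig t = tau t) ->
  forall t, J t -> k t = l t /\ sig t = tau t.
Proof.
move=> iJ oJ J0 Hk Hl A t Jt; have [h|/ltW h] := leP t0 t.
  exact: (forward_unique iJ oJ J0 Jt Hk Hl A h).
pose NJ := [set t | J (- t)].
have iNJ : is_interval NJ.
  move=> x y Jx Jy z /andP[xz zy]; apply: (iJ (- y) (- x)) => //.
  by rewrite !lerN2 xz zy.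
have oNJ : open NJ.
  by apply: open_comp => // x _; exact: opp_continuous.
have J0' : NJ (- t0) by rewrite /NJ /= opprK.
have Jt' : NJ (- t) by rewrite /NJ /= opprK.
have Hk' u : NJ u -> profile_at (fun t => k (- t)) (fun t => - k' (- t)) (fun t => k'' (- t))
    (fun t => - sig (- t)) u.
  by move=> Ju; rewrite -[u]opprK; apply: profile_reflect; apply: Hk.
have Hl' u : NJ u -> profile_at (fun t => l (- t)) (fun t => - l' (- t)) (fun t => l'' (- t))
    (fun t => - tau (- t)) u.
  by move=> Ju; rewrite -[u]opprK; apply: profile_reflect; apply: Hl.
have A' : \forall u \near - t0, k (- u) = l (- u) /\ - sig (- u) = - tau (- u).
  have : \forall u \near - t0, k (- u) = l (- u) /\ sig (- u) = tau (- u).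
    have A2 : nbhs (- - t0) [set t | k t = l t /\ sig t = tau t] by rewrite opprK.
    have c : {for - t0, continuous (fun t : R => - t)} by exact: opp_continuous.
    have NB : nbhs (- t0) ((fun u : R => - u) @^-1` [set t | k t = l t /\ sig t = tau t]).
      exact: (c _ A2).
    by [].
  by apply: filterS => u [-> ->].
have h' : - t0 <= - t by rewrite lerN2.
have [] := forward_unique iNJ oNJ J0' Jt' Hk' Hl' A' h'.
by rewrite opprK => -> /oppr_inj ->.
Qed.

End Uniqueness.

(** * The Lorentz form of L^5 *)

Section Lorentz.
Context {R : realType}.
Notation E5 := 'rV[R]_5.
Implicit Types (u v w p : E5).

Lemma ord5P (P : 'I_5 -> Prop) : P 0 -> P 1 -> P 2 -> P 3 -> P 4 -> forall i, P i.
Proof.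
move=> P0 P1 P2 P3 P4 [[|[|[|[|[|//]]]]] Hi].
- by rewrite (_ : Ordinal Hi = 0) //; apply: val_inj.
- by rewrite (_ : Ordinal Hi = 1) //; apply: val_inj.
- by rewrite (_ : Ordinal Hi = 2) //; apply: val_inj.
- by rewrite (_ : Ordinal Hi = 3) //; apply: val_inj.
- by rewrite (_ : Ordinal Hi = 4) //; apply: val_inj.
Qed.

Lemma sum5 (V : nmodType) (F : 'I_5 -> V) :
  \sum_(j < 5) F j = F 0 + F 1 + F 2 + F 3 + F 4.
Proof.
rewrite !big_ord_recr big_ord0 /= add0r.
by congr (F _ + F _ + F _ + F _ + F _); apply: val_inj.
Qed.

Lemma lorE u v : lor u v =
  - (u 0 0 * v 0 0) + u 0 1 * v 0 1 + u 0 2 * v 0 2 + u 0 3 * v 0 3 + u 0 4 * v 0 4.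
Proof.
have H (j : 'I_5) : (u *m Defs.eta) 0 j = u 0 j * (if j == 0 then -1 else 1).
  by rewrite /Defs.eta mul_mx_diag !mxE.
have T (j : 'I_5) : v^T j 0 = v 0 j by rewrite mxE.
by rewrite /lor mxE sum5 !H !T /= mulrN1 mulNr !mulr1.
Qed.

Lemma lorC u v : lor u v = lor v u. Proof. by rewrite !lorE; ring. Qed.
Lemma lorDl u v w : lor (u + v) w = lor u w + lor v w.
Proof. by rewrite /lor !mulmxDl mxE. Qed.
Lemma lorZl a u w : lor (a *: u) w = a * lor u w.
Proof. by rewrite /lor -!scalemxAl mxE. Qed.
Lemma lorNl u w : lor (- u) w = - lor u w.
Proof. by rewrite -scaleN1r lorZl mulN1r. Qed.
Lemma lorBl u v w : lor (u - v) w = lor u w - lor v w.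
Proof. by rewrite lorDl lorNl. Qed.
Lemma lor0l w : lor 0 w = 0.
Proof. by rewrite -(scale0r 0) lorZl mul0r. Qed.
Lemma lorDr u v w : lor w (u + v) = lor w u + lor w v.
Proof. by rewrite !(lorC w) lorDl. Qed.
Lemma lorZr a u w : lor w (a *: u) = a * lor w u.
Proof. by rewrite !(lorC w) lorZl. Qed.
Lemma lorNr u w : lor w (- u) = - lor w u.
Proof. by rewrite !(lorC w) lorNl. Qed.
Lemma lorBr u v w : lor w (u - v) = lor w u - lor w v.
Proof. by rewrite !(lorC w) lorBl. Qed.
Lemma lor0r w : lor w 0 = 0.
Proof. by rewrite lorC lor0l. Qed.

Definition lorD := (lorDl, lorDr, lorBl, lorBr, lorZl, lorZr, lorNl, lorNr, lor0l, lor0r).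

Lemma e5E j : (e5 : E5) 0 j = (j == 4)%:R.
Proof. by rewrite /e5 mxE eqxx. Qed.

Lemma lor_e5 u : lor u e5 = u 0 4.
Proof. by rewrite lorE !e5E /= !mulr0 mulr1 oppr0 !add0r. Qed.

Lemma lor_e55 : lor (e5 : E5) e5 = 1.
Proof. by rewrite lor_e5 e5E. Qed.

Lemma eta_unit : (Defs.eta : 'M[R]_5) *m Defs.eta = 1%:M.
Proof.
apply/matrixP => i j; rewrite /Defs.eta mul_mx_diag !mxE.
by have [->|] := eqVneq i j; rewrite ?mulr0n ?mul0r// mulr1n; case: ifP => _;
  rewrite ?mulrNN mulr1.
Qed.

(** The Gram matrix is diagonal and invertible, so the family is a basis. *)
Lemma orthogonal_complete (Fr : 'I_5 -> E5) v :
  (forall i j, i != j -> lor (Fr i) (Fr j) = 0) ->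
  (forall i, lor (Fr i) (Fr i) != 0) ->
  (forall i, lor v (Fr i) = 0) -> v = 0.
Proof.
move=> orth nz vF.
pose M := \matrix_(i < 5) Fr i : 'M[R]_5.
have rM i : row i M = Fr i by rewrite rowK.
have lorM u (j : 'I_5) : (u *m Defs.eta *m M^T) 0 j = lor u (Fr j).
  rewrite /lor -rM mxE [RHS]mxE; apply: eq_bigr => l _; congr (_ * _).
  by rewrite !mxE.
have E : M *m Defs.eta *m M^T = diag_mx (\row_i lor (Fr i) (Fr i)).
  apply/matrixP => i j.
  transitivity (lor (Fr i) (Fr j)); first by rewrite -lorM -rM -!row_mul [RHS]mxE.
  by rewrite !mxE; have [->|ij] := eqVneq i j; rewrite ?mulr1n// mulr0n orth.
have uM : M^T \in unitmx.
  have : M *m Defs.eta *m M^T \in unitmx.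
    rewrite E unitmxE det_diag unitfE prodf_seq_neq0.
    by apply/allP => i _; rewrite mxE /= nz.
  by rewrite unitmx_mul => /andP[].
have : v *m Defs.eta *m M^T = 0.
  by apply/rowP => j; rewrite [RHS]mxE -(vF j) lorM.
move/(congr1 (mulmx^~ (invmx M^T))); rewrite mulmxK// mul0mx.
by move/(congr1 (mulmx^~ Defs.eta)); rewrite -mulmxA eta_unit mulmx1 mul0mx.
Qed.

Section Frame.
Variables (a b c d f : E5) (na nb nc nd nf : R).
Hypotheses (ab : lor a b = 0) (ac : lor a c = 0) (ad : lor a d = 0) (af : lor a f = 0).
Hypotheses (bc : lor b c = 0) (bd : lor b d = 0) (bf : lor b f = 0).
Hypotheses (cd : lor c d = 0) (cf : lor c f = 0) (df : lor d f = 0).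
Hypotheses (aa : lor a a = na) (bb : lor b b = nb) (cc : lor c c = nc).
Hypotheses (dd : lor d d = nd) (ff : lor f f = nf).
Hypotheses (na0 : na != 0) (nb0 : nb != 0) (nc0 : nc != 0) (nd0 : nd != 0) (nf0 : nf != 0).

Lemma frame_expand v : v = (lor v a / na) *: a + (lor v b / nb) *: b +
  (lor v c / nc) *: c + (lor v d / nd) *: d + (lor v f / nf) *: f.
Proof.
apply/eqP; rewrite -subr_eq0; apply/eqP.
pose Fr (i : 'I_5) := nth 0 [:: a; b; c; d; f] i.
apply: (@orthogonal_complete Fr).
- by apply: ord5P; apply: ord5P => //; rewrite /Fr /= => _; rewrite // lorC.
- by apply: ord5P; rewrite /Fr /= ?aa ?bb ?cc ?dd ?ff.
- apply: ord5P; rewrite /Fr /= !lorD.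
  + by rewrite aa (lorC b) ab (lorC c) ac (lorC d) ad (lorC f) af; field; rewrite ?na0 ?nb0 ?nc0 ?nd0 ?nf0.
  + by rewrite ab bb (lorC c) bc (lorC d) bd (lorC f) bf; field; rewrite ?na0 ?nb0 ?nc0 ?nd0 ?nf0.
  + by rewrite ac bc cc (lorC d) cd (lorC f) cf; field; rewrite ?na0 ?nb0 ?nc0 ?nd0 ?nf0.
  + by rewrite ad bd cd dd (lorC f) df; field; rewrite ?na0 ?nb0 ?nc0 ?nd0 ?nf0.
  + by rewrite af bf cf df ff; field; rewrite ?na0 ?nb0 ?nc0 ?nd0 ?nf0.
Qed.

Lemma frame_parseval v w : lor v w = lor v a * lor w a / na + lor v b * lor w b / nb +
  lor v c * lor w c / nc + lor v d * lor w d / nd + lor v f * lor w f / nf.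
Proof.
rewrite {1}[w]frame_expand !lorD; ring.
Qed.
End Frame.

End Lorentz.

Section LorentzCalculus.
Context {R : realType} {V : normedModType R}.
Implicit Types (f g : V -> 'rV[R]_5).

Lemma lor_sum (u v : 'rV[R]_5) :
  lor u v = \sum_(j < 5) (if j == 0 then -1 else 1) * (u 0 j * v 0 j).
Proof. by rewrite lorE sum5 /= mulN1r !mul1r. Qed.

Lemma Ck_on_lor k D f g : open D -> Ck_on k D f -> Ck_on k D g ->
  Ck_on k D (fun q => lor (f q) (g q)).
Proof.
move=> oD /(Ck_on_rowP _ _ oD) Cf /(Ck_on_rowP _ _ oD) Cg.
under eq_fun do rewrite lor_sum.
apply: Ck_on_sum => // j _; apply: Ck_onM => //; first exact: Ck_on_cst.
exact: Ck_onM.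
Qed.

Lemma derive_lor f g p w : differentiable f p -> differentiable g p ->
  'D_w (fun q => lor (f q) (g q)) p = lor ('D_w f p) (g p) + lor (f p) ('D_w g p).
Proof.
move=> df dg; rewrite !lor_sum -big_split /=.
rewrite (_ : (fun q => _) = \sum_(j < 5)
   fun q => (if j == 0 then -1 else 1) * (f q 0 j * g q 0 j)); last first.
  by apply/funext => q; rewrite fct_sumE lor_sum.
have dfj j : derivable (fun q => f q 0 j) p w.
  by apply: diff_derivable; move/differentiable_rowP: df; apply.
have dgj j : derivable (fun q => g q 0 j) p w.
  by apply: diff_derivable; move/differentiable_rowP: dg; apply.
rewrite derive_sum; last first.
  by move=> j; apply: derivableM => //; apply: derivableM.
apply: eq_bigr => j _.
rewrite (@deriveM _ _ (cst (if j == 0 then -1 else 1)) (fun q => f q 0 j * g q 0 j))//; last first.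
  exact: derivableM.
rewrite (@deriveM _ _ (fun q => f q 0 j) (fun q => g q 0 j))// derive_cst.
rewrite scaler0 addr0 (derive_row _ _ df) (derive_row _ _ dg) /GRing.scale /=.
by rewrite -mulrDr; congr (_ * _); rewrite addrC mulrC.
Qed.

End LorentzCalculus.

Lemma nabla_mul (R : realType) (M : topologicalType) (x V : M -> 'rV[R]_5) (c : chart R M) p
    (w : 'rV[R]_3) :
  w *m nabla_mx x V c p = w *m dmx V c p + lor (w *m dmx V c p) (nu (x p)) *: nu (x p).
Proof.
rewrite /nabla_mx mulmxDr; congr (_ + _).
rewrite -mul_scalar_mx !mulmxA; congr (_ *m _).
by rewrite [LHS]mx11_scalar.
Qed.

(** * Structure equations and the principal plane *)

Opaque lor.

Section DeriveRules.
Context {R : realType} {V W : normedModType R}.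

Lemma deriveZ2 (a : V -> R) (f : V -> W) p v : differentiable a p -> differentiable f p ->
  'D_v (fun q => a q *: f q) p = 'D_v a p *: f p + a p *: 'D_v f p.
Proof. by move=> da df; have [_] := differentiable_scale da df; apply. Qed.

Lemma deriveB2 (f g : V -> W) p v : differentiable f p -> differentiable g p ->
  'D_v (fun q => f q - g q) p = 'D_v f p - 'D_v g p.
Proof. by move=> df dg; apply: (@deriveB _ _ _ f g); apply: diff_derivable. Qed.

Lemma deriveD2 (f g : V -> W) p v : differentiable f p -> differentiable g p ->
  'D_v (fun q => f q + g q) p = 'D_v f p + 'D_v g p.
Proof. by move=> df dg; apply: (@deriveD _ _ _ f g); apply: diff_derivable. Qed.

Lemma deriveM2 (f g : V -> R) p v : differentiable f p -> differentiable g p ->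
  'D_v (fun q => f q * g q) p = 'D_v f p * g p + f p * 'D_v g p.
Proof.
move=> df dg; rewrite (@deriveM _ _ f g); [|exact: diff_derivable|exact: diff_derivable].
by rewrite /GRing.scale /= addrC mulrC.
Qed.

Lemma derive_comb (f : V -> W) p (a1 a2 a3 : R) t1 t2 t3 : differentiable f p ->
  'D_(a1 *: t1 + a2 *: t2 + a3 *: t3) f p =
  a1 *: 'D_t1 f p + a2 *: 'D_t2 f p + a3 *: 'D_t3 f p.
Proof. by move=> df; rewrite !deriveE// !linearD !linearZ. Qed.

Lemma derive_eq_on (D : set V) (f g : V -> W) p v : open D -> D p ->
  (forall q, D q -> f q = g q) -> 'D_v f p = 'D_v g p.
Proof.
move=> oD Dp fg; apply: near_eq_derive.
have : nbhs p D by exact: open_nbhs_nbhs.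
by apply: filterS => q /fg.
Qed.

Lemma smooth_diff (D : set V) (f : V -> W) p : smooth_on D f -> D p -> differentiable f p.
Proof. by move=> sf Dp; have /Ck_onS[+ _] := sf 1%N; apply. Qed.

Lemma smooth_derive (D : set V) (f : V -> W) v : smooth_on D f -> smooth_on D ('D_v f).
Proof. by move=> sf k; have /Ck_onS[_ ] := sf k.+1; apply. Qed.

Lemma derive_on_cst (D : set V) (f : V -> W) (a : W) p v : open D -> D p ->
  (forall q, D q -> f q = a) -> 'D_v f p = 0.
Proof.
move=> oD Dp fa; rewrite -(derive_cst a p v).
exact: (derive_eq_on _ oD Dp).
Qed.

End DeriveRules.

Lemma derive_lor_cst (R : realType) (V : normedModType R) (D : set V)
    (f g : V -> 'rV[R]_5) (a : R) p v : open D -> D p ->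
  differentiable f p -> differentiable g p ->
  (forall q, D q -> lor (f q) (g q) = a) ->
  lor ('D_v f p) (g p) + lor (f p) ('D_v g p) = 0.
Proof.
move=> oD Dp df dg fa.
exact: etrans (esym (derive_lor v df dg)) (derive_on_cst v oD Dp fa).
Qed.

Lemma comb_aux (R : realType) (x1 x2 x3 X : 'rV[R]_5) (c h1 h2 h3 a1 a2 a3 : R) :
  (a1 *: x1 + a2 *: x2 + a3 *: x3) - (c * (a1 * h1 + a2 * h2 + a3 * h3)) *: X =
  a1 *: (x1 - (c * h1) *: X) + a2 *: (x2 - (c * h2) *: X) + a3 *: (x3 - (c * h3) *: X).
Proof. by apply/rowP => i; rewrite !mxE; ring. Qed.

Lemma form_aux (R : realType) (x1 x2 x3 y1 y2 y3 : 'rV[R]_5) (m a1 a2 a3 : R) :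
  a1 *: x1 + a2 *: x2 + a3 *: x3 - m *: (a1 *: y1 + a2 *: y2 + a3 *: y3) =
  a1 *: (x1 - m *: y1) + a2 *: (x2 - m *: y2) + a3 *: (x3 - m *: y3).
Proof. by apply/rowP => i; rewrite !mxE; ring. Qed.

Lemma curl_algebra (R : realType) (X xi Xu Xw xu xw Xuw xuw : 'rV[R]_5)
  (m m' c l hu hw huw : R) :
  xuw - ((l * hw * hu + c * huw) *: X + (c * hu) *: Xw) -
    ((m' * hw) *: (Xu - (c * hu) *: xi) +
     m *: (Xuw - ((l * hw * hu + c * huw) *: xi + (c * hu) *: xw))) -
  (xuw - ((l * hu * hw + c * huw) *: X + (c * hw) *: Xu) -
    ((m' * hu) *: (Xw - (c * hw) *: xi) +
     m *: (Xuw - ((l * hu * hw + c * huw) *: xi + (c * hw) *: xu)))) =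
  hu *: ((m' - c) *: (Xw - (c * hw) *: xi) + (c * m) *: (xw - (c * hw) *: X)) -
  hw *: ((m' - c) *: (Xu - (c * hu) *: xi) + (c * m) *: (xu - (c * hu) *: X)).
Proof. by apply/rowP => i; rewrite !mxE; ring. Qed.

Lemma lor_comb (R : realType) (a1 a2 a3 k2 k3 : R) (x y z : 'rV[R]_5) :
  lor (a1 *: 0 + a2 *: (k2 *: x) + a3 *: (k3 *: y)) z =
  a2 * k2 * lor x z + a3 * k3 * lor y z.
Proof. by rewrite !lorD; ring. Qed.

Lemma riccati_algebra (R : realType) (h m m3 m' c : R) (x y : 'rV[R]_5) :
  lor x x != 0 -> m - m3 != 0 -> h != 0 ->
  lor (0 *: y - h *: ((m' - c) *: x + (c * m) *: (m *: x))) ((m - m3) *: x) = 0 ->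
  m' = c * (1 - m ^+ 2).
Proof.
rewrite !lorD => n0 m0 h0 Ez.
have : (h * (m - m3) * lor x x) * (m' - c * (1 - m ^+ 2)) = 0.
  by rewrite -[RHS]oppr0 -Ez; ring.
by move/eqP; rewrite !mulf_eq0 (negPf h0) (negPf m0) (negPf n0) /= subr_eq0 => /eqP.
Qed.

Lemma curl_pair_aux (R : realType) (h m3 m k c : R) (x y z : 'rV[R]_5) :
  lor x y = 0 ->
  lor (0 *: z - h *: (k *: x + c *: (m *: x))) (m3 *: y) = 0.
Proof. by move=> xy; rewrite !lorD xy; ring. Qed.

Lemma orthogonal_aux (R : realType) (a1 a2 a3 b1 b2 b3 k2 k3 : R) (x y : 'rV[R]_5) :
  lor x y = 0 -> lor (a1 *: 0 + a2 *: (0 *: x) + a3 *: (k3 *: y))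
    (b1 *: 0 + b2 *: (k2 *: x) + b3 *: (0 *: y)) = 0.
Proof. by move=> xy; rewrite !lorD (lorC y) xy; ring. Qed.

Lemma zero_aux (R : realType) (x y z : 'rV[R]_5) : lor (0 *: x - 0 *: y) z = 0.
Proof. by rewrite !lorD; ring. Qed.

Lemma lin3l0 (R : realType) (a1 a2 a3 : R) (x y z w : 'rV[R]_5) :
  lor x w = 0 -> lor y w = 0 -> lor z w = 0 ->
  lor (a1 *: x + a2 *: y + a3 *: z) w = 0.
Proof. by move=> h1 h2 h3; rewrite !lorD h1 h2 h3; ring. Qed.

Lemma lin3r0 (R : realType) (a1 a2 a3 : R) (x y z w : 'rV[R]_5) :
  lor w x = 0 -> lor w y = 0 -> lor w z = 0 ->
  lor w (a1 *: x + a2 *: y + a3 *: z) = 0.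
Proof. by move=> h1 h2 h3; rewrite !lorD h1 h2 h3; ring. Qed.

Lemma scale0B (R : realType) (x y : 'rV[R]_5) : 0 *: x - 0 *: y = 0.
Proof. by rewrite !scale0r subrr. Qed.

Lemma differentiable_lor (R : realType) (V : normedModType R) (f g : V -> 'rV[R]_5) p :
  differentiable f p -> differentiable g p -> differentiable (fun q => lor (f q) (g q)) p.
Proof.
move=> /differentiable_rowP df /differentiable_rowP dg.
rewrite (_ : (fun q => _) = \sum_(j < 5)
   fun q => (if j == 0 then -1 else 1) * (f q 0 j * g q 0 j)); last first.
  by apply/funext => q; rewrite fct_sumE lor_sum.
apply: differentiable_sum => j; apply: differentiableM; first exact: differentiable_cst.
exact: differentiableM.
Qed.

Lemma derive_frac (R : realType) (V : normedModType R) (f g : V -> R) p w :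
  differentiable f p -> differentiable g p -> g p != 0 ->
  differentiable (fun q => f q * f q / g q) p /\
  'D_w (fun q => f q * f q / g q) p =
  ('D_w f p * f p + f p * 'D_w f p) / g p - f p * f p * ((g p)^-1 ^+ 2 * 'D_w g p).
Proof.
move=> df dg g0.
have dV : differentiable (fun q => (g q)^-1) p by exact: differentiableV.
have dff := differentiableM df df.
split; first exact: (differentiableM dff dV).
rewrite (deriveM2 w dff dV) (deriveM2 w df df) (deriveV g0); last exact: diff_derivable.
by rewrite /GRing.scale /= exprVn mulNr mulrN.
Qed.

Lemma scale_aux (R : realType) (d c h : R) (x : 'rV[R]_5) :
  d *: ((c * h) *: x) = (c * (d * h)) *: x.
Proof. by rewrite scalerA mulrCA. Qed.

Lemma half_le (R : realType) (x y : R) : `|x - y| <= `|x| / 2 -> `|x| / 2 <= `|y|.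
Proof. by move=> H; have := lerB_dist x y; lra. Qed.

Lemma b0_aux (R : realType) (b1 b2 b3 m2 m3 : R) (x y : 'rV[R]_5) :
  b1 *: 0 + b2 *: ((m2 - m3) *: x) + b3 *: ((m3 - m3) *: y) = (b2 * (m2 - m3)) *: x.
Proof. by rewrite subrr scale0r !scaler0 add0r addr0 scalerA. Qed.

(** The components of [V], [W], [V'] and [W'] in the orthogonal basis [X, xi, E2, E3, e5] that
    are known reduce [lor V W = lor V' W'] to a multiple of [m2 * m3 - 1]. *)
Lemma principal_product_algebra (R : realType) (X xi E2 E3 V W V' W' : 'rV[R]_5) (m2 m3 : R) :
  lor X X = -1 -> lor xi xi = 1 -> lor X xi = 0 ->
  lor X E2 = 0 -> lor X E3 = 0 -> lor X e5 = 0 ->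
  lor xi E2 = 0 -> lor xi E3 = 0 -> lor xi e5 = 0 ->
  lor E2 E3 = 0 -> lor E2 e5 = 0 -> lor E3 e5 = 0 ->
  0 < lor E2 E2 -> 0 < lor E3 E3 -> m2 != m3 ->
  lor V X = - ((m3 - m2) * lor E3 E3) -> lor V xi = - ((m3 - m2) * (m3 * lor E3 E3)) ->
  lor V E2 = 0 -> lor V e5 = 0 ->
  lor W X = - ((m2 - m3) * lor E2 E2) -> lor W xi = - ((m2 - m3) * (m2 * lor E2 E2)) ->
  lor W E3 = 0 ->
  lor V' X = 0 -> lor V' xi = 0 -> lor V' E2 = 0 -> lor V' e5 = 0 -> lor W' E3 = 0 ->
  lor V W = lor V' W' -> m2 * m3 = 1.
Proof.
move=> XX xx Xx X2 X3 X5 x2 x3 x5 E23 E25 E35 n2 n3 m23 VX Vx V2 V5 WX Wx W3.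
move=> V'X V'x V'2 V'5 W'3.
have n20 := lt0r_neq0 n2; have n30 := lt0r_neq0 n3.
have P := frame_parseval Xx X2 X3 X5 x2 x3 x5 E23 E25 E35 XX xx (erefl _) (erefl _)
  lor_e55 (ltr0_neq0 (ltrN10 _)) (oner_neq0 _) n20 n30 (oner_neq0 _).
rewrite (P V W) (P V' W') VX Vx V2 V5 WX Wx W3 V'X V'x V'2 V'5 W'3.
set a := lor E2 E2 in n20 *; set b := lor E3 E3 in n30 *.
rewrite !(mul0r, mulr0, addr0, divr1, invrN1, mulrN1) => /eqP.
rewrite -subr_eq0 => /eqP EE.
have : ((m3 - m2) * (m2 - m3) * a * b) * (m2 * m3 - 1) = 0 by rewrite -[RHS]EE; ring.
move/eqP; rewrite !mulf_eq0 (negPf n20) (negPf n30) !subr_eq0 (eq_sym m3) (negPf m23) /=.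
by move/eqP.
Qed.

(** Both sides are computed in the basis [X, xi, E2, E3, e5]; [m2 * m3 = 1] is what cancels the
    component along [E3]. *)
Lemma plane_quadratic_algebra (R : realType) (X xi E2 E3 DB v : 'rV[R]_5)
    (m2 m3 c hw d2 d3 b0 : R) :
  let B := b0 *: E2 in let b := X - m2 *: xi in
  let DX := (c * hw) *: xi + d2 *: E2 + d3 *: E3 in
  let Dx := (c * hw) *: X + d2 *: (m2 *: E2) + d3 *: (m3 *: E3) in
  let Dm := c * (1 - m2 ^+ 2) * hw in
  let Db := DX - (Dm *: xi + m2 *: Dx) in
  lor X X = -1 -> lor xi xi = 1 -> lor X xi = 0 ->
  lor X E2 = 0 -> lor X E3 = 0 -> lor X e5 = 0 ->
  lor xi E2 = 0 -> lor xi E3 = 0 -> lor xi e5 = 0 ->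
  lor E2 E3 = 0 -> lor E2 e5 = 0 -> lor E3 e5 = 0 ->
  0 < lor E2 E2 -> 0 < lor E3 E3 -> m2 * m3 = 1 -> 1 - m2 ^+ 2 != 0 -> b0 != 0 ->
  lor DB X = - lor B DX -> lor DB xi = - lor B Dx -> lor DB E3 = 0 -> lor DB e5 = 0 ->
  (lor DB v * lor B v + lor B v * lor DB v) / lor B B -
    lor B v * lor B v * ((lor B B)^-1 ^+ 2 * (lor DB B + lor B DB)) =
  (lor Db v * lor b v + lor b v * lor Db v) / (1 - m2 * m2) +
    lor b v * lor b v * ((1 - m2 * m2)^-1 ^+ 2 * (Dm * m2 + m2 * Dm)).
Proof.
move=> B b DX Dx Dm Db XX xx Xx X2 X3 X5 x2 x3 x5 E23 E25 E35 n2 n3 m1 m0 b00.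
move=> DBX DBx DB3 DB5.
have n20 := lt0r_neq0 n2; have n30 := lt0r_neq0 n3.
have P := frame_parseval Xx X2 X3 X5 x2 x3 x5 E23 E25 E35 XX xx (erefl _) (erefl _)
  lor_e55 (ltr0_neq0 (ltrN10 _)) (oner_neq0 _) n20 n30 (oner_neq0 _).
have eBX : lor B DX = b0 * d2 * lor E2 E2.
  by rewrite /B /DX !lorD (lorC E2 xi) x2 E23; ring.
have eBx : lor B Dx = b0 * d2 * m2 * lor E2 E2.
  by rewrite /B /Dx !lorD (lorC E2 X) X2 E23; ring.
have eDB : lor DB v = b0 * d2 * lor E2 E2 * lor X v - b0 * d2 * m2 * lor E2 E2 * lor xi v
   + lor DB E2 * lor E2 v / lor E2 E2.
  rewrite (P DB v) DBX DBx DB3 DB5 eBX eBx (lorC v X) (lorC v xi) (lorC v E2).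
  by rewrite invrN1 !divr1 !mul0r !addr0; ring.
have eDBB : lor DB B = b0 * lor DB E2 by rewrite /B lorZr.
have eDBB' : lor B DB = b0 * lor DB E2 by rewrite lorC.
have eBB : lor B B = b0 ^+ 2 * lor E2 E2 by rewrite /B !lorD; ring.
have eDb : lor Db v = d2 * (1 - m2 ^+ 2) * lor E2 v -
    c * hw * m2 * (lor X v - m2 * lor xi v).
  have -> : lor Db v = (c * hw) * lor xi v + d2 * lor E2 v + d3 * lor E3 v -
     (Dm * lor xi v + m2 * ((c * hw) * lor X v + d2 * (m2 * lor E2 v)) +
      (m2 * m3) * (d3 * lor E3 v)).
    by rewrite /Db /DX /Dx !lorD; ring.
  by rewrite m1 /Dm; ring.
have eb : lor b v = lor X v - m2 * lor xi v by rewrite /b !lorD.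
have eB : lor B v = b0 * lor E2 v by rewrite /B lorZl.
rewrite eDBB eDBB' eBB eDB eDb eb eB /Dm.
have m0' : 1 - m2 * m2 != 0 by rewrite -expr2.
set n := lor E2 E2 in n20 *.
move: (lor X v) (lor xi v) (lor E2 v) (lor DB E2) => x y z g.
by field; rewrite m0' n20 b00.
Qed.

Section LocalGeometry.
Context {R : realType} {V : normedModType R}.
Notation E5 := 'rV[R]_5.
Variables (D : set V) (X xi : V -> E5) (h c : V -> R).
Hypothesis oD : open D.
Hypotheses (sX : smooth_on D X) (sxi : smooth_on D xi).
Hypotheses (sh : smooth_on D h) (sc : smooth_on D c).
Hypothesis XX : forall p, D p -> lor (X p) (X p) = -1.
Hypothesis xixi : forall p, D p -> lor (xi p) (xi p) = 1.
Hypothesis Xxi : forall p, D p -> lor (X p) (xi p) = 0.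
Hypothesis X5 : forall p, D p -> lor (X p) e5 = 0.
Hypothesis xi5 : forall p, D p -> lor (xi p) e5 = 0.
Hypothesis dc : forall p, D p -> exists l, forall w, 'D_w c p = l * 'D_w h p.

(** The derivatives of [xi] and [X] with their part along [dh] removed: both vanish on the
    direction of [T], and on another principal direction [t] they take the values [m 'D_t X]
    and ['D_t X]. *)
Definition reduced_dxi (u q : V) : E5 := 'D_u xi q - (c q * 'D_u h q) *: X q.
Definition reduced_dX (u q : V) : E5 := 'D_u X q - (c q * 'D_u h q) *: xi q.
(** On the principal direction of curvature [m_i] this is [(m_i - m)] times the image of that
    direction under [dX]: with [m = m2] the values lie on the line of the third principal
    direction, with [m = m3] on that of the second. *)
Definition principal_form (m : V -> R) (u q : V) : E5 := reduced_dxi u q - m q *: reduced_dX u q.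

Lemma reduced_dxiE u q : reduced_dxi u q = 'D_u xi q - (c q * 'D_u h q) *: X q. Proof. by []. Qed.
Lemma reduced_dXE u q : reduced_dX u q = 'D_u X q - (c q * 'D_u h q) *: xi q. Proof. by []. Qed.
Lemma principal_formE m u q : principal_form m u q = reduced_dxi u q - m q *: reduced_dX u q. Proof. by []. Qed.

Record principal_frame (m2 m3 : V -> R) (p t1 t2 t3 : V) : Prop := PrincipalFrame {
  pf_h1 : 'D_t1 h p != 0;
  pf_h2 : 'D_t2 h p = 0;
  pf_h3 : 'D_t3 h p = 0;
  pf_X1 : 'D_t1 X p = (c p * 'D_t1 h p) *: xi p;
  pf_xi1 : 'D_t1 xi p = (c p * 'D_t1 h p) *: X p;
  pf_xi2 : 'D_t2 xi p = m2 p *: 'D_t2 X p;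
  pf_xi3 : 'D_t3 xi p = m3 p *: 'D_t3 X p;
  pf_E23 : lor ('D_t2 X p) ('D_t3 X p) = 0;
  pf_E22 : 0 < lor ('D_t2 X p) ('D_t2 X p);
  pf_E33 : 0 < lor ('D_t3 X p) ('D_t3 X p);
  pf_span : forall u, exists a1 a2 a3, u = a1 *: t1 + a2 *: t2 + a3 *: t3 }.

Let dX p : D p -> differentiable X p. Proof. exact: smooth_diff. Qed.
Let dxi p : D p -> differentiable xi p. Proof. exact: smooth_diff. Qed.
Let dh p : D p -> differentiable h p. Proof. exact: smooth_diff. Qed.
Let dcd p : D p -> differentiable c p. Proof. exact: smooth_diff. Qed.
Let dDX u p : D p -> differentiable ('D_u X) p.
Proof. by apply: smooth_diff; apply: smooth_derive. Qed.
Let dDxi u p : D p -> differentiable ('D_u xi) p.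
Proof. by apply: smooth_diff; apply: smooth_derive. Qed.
Let dDh u p : D p -> differentiable ('D_u h) p.
Proof. by apply: smooth_diff; apply: smooth_derive. Qed.

Lemma smooth_reduced_dxi u : smooth_on D (reduced_dxi u).
Proof.
move=> k; apply: (Ck_onB oD); first exact: smooth_derive.
by apply: (Ck_onZ oD) => //; apply: (Ck_onM oD) => //; exact: smooth_derive.
Qed.

Lemma smooth_reduced_dX u : smooth_on D (reduced_dX u).
Proof.
move=> k; apply: (Ck_onB oD); first exact: smooth_derive.
by apply: (Ck_onZ oD) => //; apply: (Ck_onM oD) => //; exact: smooth_derive.
Qed.

Lemma smooth_form m u : smooth_on D m -> smooth_on D (principal_form m u).
Proof.
move=> sm k; apply: (Ck_onB oD); first exact: smooth_reduced_dxi.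
by apply: (Ck_onZ oD) => //; exact: smooth_reduced_dX.
Qed.

Lemma derive_reduced_dxi u w p : D p -> 'D_w (reduced_dxi u) p = 'D_w ('D_u xi) p -
   (('D_w c p * 'D_u h p + c p * 'D_w ('D_u h) p) *: X p + (c p * 'D_u h p) *: 'D_w X p).
Proof.
move=> Dp.
have d1 : differentiable (fun q => c q * 'D_u h q) p.
  by apply: differentiableM; [exact: dcd|exact: dDh].
have [d2 _] := differentiable_scale d1 (dX Dp).
rewrite /reduced_dxi deriveB2//; last exact: dDxi.
by rewrite deriveZ2//; [rewrite deriveM2//; [exact: dcd|exact: dDh]|exact: dX].
Qed.

Lemma derive_reduced_dX u w p : D p -> 'D_w (reduced_dX u) p = 'D_w ('D_u X) p -
   (('D_w c p * 'D_u h p + c p * 'D_w ('D_u h) p) *: xi p + (c p * 'D_u h p) *: 'D_w xi p).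
Proof.
move=> Dp.
have d1 : differentiable (fun q => c q * 'D_u h q) p.
  by apply: differentiableM; [exact: dcd|exact: dDh].
have [d2 _] := differentiable_scale d1 (dxi Dp).
rewrite /reduced_dX deriveB2//; last exact: dDX.
by rewrite deriveZ2//; [rewrite deriveM2//; [exact: dcd|exact: dDh]|exact: dxi].
Qed.

Lemma derive_form m u w p : smooth_on D m -> D p ->
  'D_w (principal_form m u) p = 'D_w (reduced_dxi u) p - ('D_w m p *: reduced_dX u p + m p *: 'D_w (reduced_dX u) p).
Proof.
move=> sm Dp; have dm := smooth_diff sm Dp.
have dal := smooth_diff (smooth_reduced_dxi u) Dp; have dbe := smooth_diff (smooth_reduced_dX u) Dp.
have [d2 _] := differentiable_scale dm dbe.
by rewrite /principal_form deriveB2// deriveZ2.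
Qed.

Opaque reduced_dxi reduced_dX principal_form.

Lemma reduced_dxi_comb p a1 a2 a3 t1 t2 t3 : D p ->
  reduced_dxi (a1 *: t1 + a2 *: t2 + a3 *: t3) p = a1 *: reduced_dxi t1 p + a2 *: reduced_dxi t2 p + a3 *: reduced_dxi t3 p.
Proof.
move=> Dp; rewrite !reduced_dxiE (derive_comb _ _ _ _ _ _ (dxi Dp)) (derive_comb _ _ _ _ _ _ (dh Dp)).
exact: comb_aux.
Qed.

Lemma reduced_dX_comb p a1 a2 a3 t1 t2 t3 : D p ->
  reduced_dX (a1 *: t1 + a2 *: t2 + a3 *: t3) p = a1 *: reduced_dX t1 p + a2 *: reduced_dX t2 p + a3 *: reduced_dX t3 p.
Proof.
move=> Dp; rewrite !reduced_dXE (derive_comb _ _ _ _ _ _ (dX Dp)) (derive_comb _ _ _ _ _ _ (dh Dp)).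
exact: comb_aux.
Qed.

Lemma form_comb m p a1 a2 a3 t1 t2 t3 : D p ->
  principal_form m (a1 *: t1 + a2 *: t2 + a3 *: t3) p =
  a1 *: principal_form m t1 p + a2 *: principal_form m t2 p + a3 *: principal_form m t3 p.
Proof.
by move=> Dp; rewrite !principal_formE (reduced_dxi_comb _ _ _ _ _ _ Dp) (reduced_dX_comb _ _ _ _ _ _ Dp) form_aux.
Qed.

(** The second derivatives of [X], [xi] and [h] cancel by Schwarz's theorem, so the exterior
    derivative of a principal form is algebraic in the first derivatives. *)
Lemma curl_form m (m' : R) u w p : smooth_on D m -> D p ->
  (forall w, 'D_w m p = m' * 'D_w h p) ->
  'D_w (principal_form m u) p - 'D_u (principal_form m w) p =
  'D_u h p *: ((m' - c p) *: reduced_dX w p + (c p * m p) *: reduced_dxi w p) -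
  'D_w h p *: ((m' - c p) *: reduced_dX u p + (c p * m p) *: reduced_dxi u p).
Proof.
move=> sm Dp dm; have [l dcl] := dc Dp.
have E v y : 'D_y (principal_form m v) p = 'D_y ('D_v xi) p -
   ((l * 'D_y h p * 'D_v h p + c p * 'D_y ('D_v h) p) *: X p + (c p * 'D_v h p) *: 'D_y X p) -
   ((m' * 'D_y h p) *: ('D_v X p - (c p * 'D_v h p) *: xi p) +
    m p *: ('D_y ('D_v X) p -
   ((l * 'D_y h p * 'D_v h p + c p * 'D_y ('D_v h) p) *: xi p + (c p * 'D_v h p) *: 'D_y xi p))).
  have E0 := derive_form v y sm Dp.
  have E1 := derive_reduced_dxi v y Dp.
  have E2 := derive_reduced_dX v y Dp.
  rewrite dcl in E1 E2.
  rewrite E1 E2 dm reduced_dXE in E0.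
  exact: E0.
apply: etrans (congr2 (fun x y => x - y) (E u w) (E w u)) _.
rewrite !reduced_dxiE !reduced_dXE -(schwarz_row w u oD (sX 2) Dp) -(schwarz_row w u oD (sxi 2) Dp).
rewrite -(schwarz w u oD (sh 2) Dp).
exact: curl_algebra.
Qed.

Section AtPoint.
Variables (m2 m3 : V -> R) (p t1 t2 t3 : V).
Hypothesis Dp : D p.
Hypothesis F : principal_frame m2 m3 p t1 t2 t3.

Lemma reduced_dxi1 : reduced_dxi t1 p = 0. Proof. by rewrite reduced_dxiE (pf_xi1 F) subrr. Qed.
Lemma reduced_dX1 : reduced_dX t1 p = 0. Proof. by rewrite reduced_dXE (pf_X1 F) subrr. Qed.
Lemma reduced_dX2 : reduced_dX t2 p = 'D_t2 X p.
Proof. by rewrite reduced_dXE (pf_h2 F) mulr0 scale0r subr0. Qed.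
Lemma reduced_dX3 : reduced_dX t3 p = 'D_t3 X p.
Proof. by rewrite reduced_dXE (pf_h3 F) mulr0 scale0r subr0. Qed.
Lemma reduced_dxi2 : reduced_dxi t2 p = m2 p *: 'D_t2 X p.
Proof. by rewrite reduced_dxiE (pf_h2 F) mulr0 scale0r subr0 (pf_xi2 F). Qed.
Lemma reduced_dxi3 : reduced_dxi t3 p = m3 p *: 'D_t3 X p.
Proof. by rewrite reduced_dxiE (pf_h3 F) mulr0 scale0r subr0 (pf_xi3 F). Qed.
Lemma form1 m : principal_form m t1 p = 0. Proof. by rewrite principal_formE reduced_dxi1 reduced_dX1 scaler0 subrr. Qed.
Lemma form2 m : principal_form m t2 p = (m2 p - m p) *: 'D_t2 X p.
Proof. by rewrite principal_formE reduced_dxi2 reduced_dX2 scalerBl. Qed.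
Lemma form3 m : principal_form m t3 p = (m3 p - m p) *: 'D_t3 X p.
Proof. by rewrite principal_formE reduced_dxi3 reduced_dX3 scalerBl. Qed.

Lemma lorX_DX w : lor (X p) ('D_w X p) = 0.
Proof.
have := derive_lor_cst w oD Dp (dX Dp) (dX Dp) XX.
by rewrite (lorC ('D_w X p)) -mulr2n => /eqP; rewrite mulrn_eq0 => /eqP.
Qed.

Lemma lorX_Dxi w : lor (X p) ('D_w xi p) = - lor (xi p) ('D_w X p).
Proof.
have /eqP := derive_lor_cst w oD Dp (dX Dp) (dxi Dp) Xxi.
by rewrite (lorC ('D_w X p)) addrC addr_eq0 => /eqP.
Qed.

Lemma lorDX5 w : lor ('D_w X p) e5 = 0.
Proof.
have := derive_lor_cst w oD Dp (dX Dp) (differentiable_cst _ _) X5.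
by rewrite derive_cst lor0r addr0.
Qed.

End AtPoint.

Lemma lorxi_DX m2 m3 p t1 t2 t3 : D p -> principal_frame m2 m3 p t1 t2 t3 ->
  lor (xi p) ('D_t2 X p) = 0 /\ lor (xi p) ('D_t3 X p) = 0.
Proof.
move=> Dp F.
have e2 := lorX_Dxi Dp t2; have e3 := lorX_Dxi Dp t3.
rewrite (pf_xi2 F) lorZr (lorX_DX Dp) mulr0 in e2.
rewrite (pf_xi3 F) lorZr (lorX_DX Dp) mulr0 in e3.
by split; apply: oppr_inj; rewrite oppr0; [rewrite -e2|rewrite -e3].
Qed.

Section TwoForms.
Variables (m2 m3 m2' m3' : V -> R).
Hypotheses (sm2 : smooth_on D m2) (sm3 : smooth_on D m3).
Hypothesis dm2 : forall p, D p -> forall w, 'D_w m2 p = m2' p * 'D_w h p.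
Hypothesis dm3 : forall p, D p -> forall w, 'D_w m3 p = m3' p * 'D_w h p.
Hypothesis m23 : forall p, D p -> m2 p != m3 p.
Hypothesis frames : forall p, D p -> exists t1 t2 t3, principal_frame m2 m3 p t1 t2 t3.

Lemma form_orthogonal p u v : D p -> lor (principal_form m2 u p) (principal_form m3 v p) = 0.
Proof.
move=> Dp; have [t1 [t2 [t3 F]]] := frames Dp.
have [a1 [a2 [a3 ->]]] := pf_span F u; have [b1 [b2 [b3 ->]]] := pf_span F v.
rewrite !(form_comb _ _ _ _ _ _ _ Dp) !(form1 F) !(form2 F) !(form3 F) !subrr.
exact: orthogonal_aux (pf_E23 F).
Qed.

Lemma form_X p u m : D p -> lor (principal_form m u p) (X p) = 0.
Proof.
move=> Dp; have [t1 [t2 [t3 F]]] := frames Dp.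
have [a1 [a2 [a3 ->]]] := pf_span F u.
rewrite (form_comb _ _ _ _ _ _ _ Dp) (form1 F) (form2 F) (form3 F).
have n w : lor ('D_w X p) (X p) = 0 by rewrite lorC (lorX_DX Dp).
by rewrite lor_comb (n t2) (n t3); ring.
Qed.

Lemma form_xi p u m : D p -> lor (principal_form m u p) (xi p) = 0.
Proof.
move=> Dp; have [t1 [t2 [t3 F]]] := frames Dp.
have [a1 [a2 [a3 ->]]] := pf_span F u; have [e2 e3] := lorxi_DX Dp F.
rewrite (form_comb _ _ _ _ _ _ _ Dp) (form1 F) (form2 F) (form3 F).
rewrite lorC in e2; rewrite lorC in e3.
by rewrite lor_comb e2 e3; ring.
Qed.

Lemma form_e5 p u m : D p -> lor (principal_form m u p) e5 = 0.
Proof.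
move=> Dp; have [t1 [t2 [t3 F]]] := frames Dp.
have [a1 [a2 [a3 ->]]] := pf_span F u.
rewrite (form_comb _ _ _ _ _ _ _ Dp) (form1 F) (form2 F) (form3 F).
by rewrite lor_comb (lorDX5 Dp t2) (lorDX5 Dp t3); ring.
Qed.

Let df2 u p : D p -> differentiable (principal_form m2 u) p.
Proof. by apply: smooth_diff; apply: smooth_form. Qed.
Let df3 u p : D p -> differentiable (principal_form m3 u) p.
Proof. by apply: smooth_diff; apply: smooth_form. Qed.

Lemma skew p w u v : D p ->
  lor ('D_w (principal_form m2 u) p) (principal_form m3 v p) = - lor (principal_form m2 u p) ('D_w (principal_form m3 v) p).
Proof.
move=> Dp; apply/eqP; rewrite -addr_eq0; apply/eqP.
by apply: (derive_lor_cst w oD Dp (df2 u Dp) (df3 v Dp)) => q Dq; exact: form_orthogonal.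
Qed.

Definition pairing (p w u v : V) := lor ('D_w (principal_form m2 u) p) (principal_form m3 v p).
Lemma pairingE p w u v : pairing p w u v = lor ('D_w (principal_form m2 u) p) (principal_form m3 v p).
Proof. by []. Qed.
Opaque pairing.

Section Point.
Variables (p t1 t2 t3 : V).
Hypothesis Dp : D p.
Hypothesis F : principal_frame m2 m3 p t1 t2 t3.

Let E32 : lor ('D_t3 X p) ('D_t2 X p) = 0.
Proof. by rewrite lorC (pf_E23 F). Qed.

Let Phi_u1 w v : pairing p w t1 v = 0.
Proof. by rewrite pairingE skew// (form1 F) lor0l oppr0. Qed.
Let Phi_u2 w v : pairing p w t2 v = 0.
Proof. by rewrite pairingE skew// (form2 F) subrr scale0r lor0l oppr0. Qed.
Let Phi_v1 w u : pairing p w u t1 = 0.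
Proof. by rewrite pairingE (form1 F) lor0r. Qed.
Let Phi_v3 w u : pairing p w u t3 = 0.
Proof. by rewrite pairingE (form3 F) subrr scale0r lor0r. Qed.

Let Phi_curl w u v : pairing p w u v = pairing p u w v + lor ('D_u h p *: ((m2' p - c p) *: reduced_dX w p
   + (c p * m2 p) *: reduced_dxi w p) -
  'D_w h p *: ((m2' p - c p) *: reduced_dX u p + (c p * m2 p) *: reduced_dxi u p)) (principal_form m3 v p).
Proof.
by rewrite !pairingE -(curl_form u w sm2 Dp (dm2 Dp)) lorBl addrC subrK.
Qed.

(** Evaluate the exterior derivative of the form of [m2] on [(t1, t2)] and pair with the second
    principal direction: both derivatives drop out by orthogonality of the two forms, leaving
    the coefficient [m2' - c (1 - m2^2)]. *)
Lemma riccati : m2' p = c p * (1 - m2 p ^+ 2).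
Proof.
have := Phi_curl t1 t2 t2; rewrite Phi_u1 Phi_u2 add0r (reduced_dX2 F) (reduced_dxi2 F) (pf_h2 F).
rewrite (form2 F) => /esym; apply: riccati_algebra.
- by rewrite gt_eqF ?(pf_E22 F).
- by rewrite subr_eq0 m23.
- exact: pf_h1 F.
Qed.

Let Phi_232 : pairing p t2 t3 t2 = 0.
Proof.
rewrite Phi_curl Phi_u2 (pf_h2 F) (pf_h3 F) add0r; exact: zero_aux.
Qed.

Let Phi_132 : pairing p t1 t3 t2 = 0.
Proof.
rewrite Phi_curl Phi_u1 (pf_h3 F) (reduced_dX3 F) (reduced_dxi3 F) (form2 F) add0r.
exact: curl_pair_aux.
Qed.

Let Phi_332 : pairing p t3 t3 t2 = 0.
Proof.
have C := curl_form t2 t3 sm3 Dp (dm3 Dp).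
rewrite (pf_h2 F) (pf_h3 F) in C.
have {}C := subr0_eq (etrans C (scale0B _ _)).
have E1 : pairing p t3 t3 t2 = - lor (principal_form m2 t3 p) ('D_t3 (principal_form m3 t2) p) := skew t3 t3 t2 Dp.
have E2 : pairing p t2 t3 t3 = - lor (principal_form m2 t3 p) ('D_t2 (principal_form m3 t3) p) := skew t2 t3 t3 Dp.
exact: etrans E1 (etrans (congr1 (fun z => - lor (principal_form m2 t3 p) z) C)
  (etrans (esym E2) (Phi_v3 t2 t3))).
Qed.

(** The trilinear expression [pairing] is symmetric in [w] and [u] up to terms from
    [curl_form], and each of its values on the frame can be reached from one where a principal
    form vanishes. *)
Lemma derive_form_orthogonal w u v : lor ('D_w (principal_form m2 u) p) (principal_form m3 v p) = 0.
Proof.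
have [b1 [b2 [b3 Ev]]] := pf_span F v.
have [a1 [a2 [a3 Eu]]] := pf_span F u.
have [d1 [d2 [d3 Ew]]] := pf_span F w.
have N u' v' : lor (principal_form m2 u' p) ('D_w (principal_form m3 v') p) = - pairing p w u' v'.
  by rewrite pairingE (skew w u' v' Dp) opprK.
have P1 : lor ('D_t1 (principal_form m2 t3) p) (principal_form m3 t2 p) = 0 :=
  etrans (esym (pairingE p t1 t3 t2)) Phi_132.
have P2 : lor ('D_t2 (principal_form m2 t3) p) (principal_form m3 t2 p) = 0 :=
  etrans (esym (pairingE p t2 t3 t2)) Phi_232.
have P3 : lor ('D_t3 (principal_form m2 t3) p) (principal_form m3 t2 p) = 0 :=
  etrans (esym (pairingE p t3 t3 t2)) Phi_332.
have Z : pairing p w t3 t2 = 0.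
  apply: etrans (pairingE p w t3 t2) _.
  rewrite Ew (derive_comb _ _ _ _ _ _ (df2 t3 Dp)); exact: lin3l0.
have Y : lor ('D_w (principal_form m2 u) p) (principal_form m3 t2 p) = 0.
  apply: etrans (skew w u t2 Dp) _.
  rewrite Eu (form_comb _ _ _ _ _ _ _ Dp); apply: oppr_inj; rewrite opprK oppr0.
  by apply: lin3l0; rewrite N ?Phi_u1 ?Phi_u2 ?Z oppr0.
rewrite Ev (form_comb _ _ _ _ _ _ _ Dp); apply: lin3r0.
  exact: etrans (esym (pairingE p w u t1)) (Phi_v1 w u).
  exact: Y.
exact: etrans (esym (pairingE p w u t3)) (Phi_v3 w u).
Qed.

End Point.

Lemma derive_form_orth p w u v : D p -> lor ('D_w (principal_form m2 u) p) (principal_form m3 v p) = 0.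
Proof.
by move=> Dp; have [t1 [t2 [t3 F]]] := frames Dp; exact: (derive_form_orthogonal Dp F).
Qed.

Lemma form_derive_orth p w u v : D p -> lor (principal_form m2 u p) ('D_w (principal_form m3 v) p) = 0.
Proof.
move=> Dp; apply: oppr_inj; rewrite oppr0.
exact: etrans (esym (skew w u v Dp)) (derive_form_orth w u v Dp).
Qed.

Let dform m u p : smooth_on D m -> D p -> differentiable (principal_form m u) p.
Proof. by move=> sm; apply: smooth_diff; apply: smooth_form. Qed.

Lemma derive_form_X m p u w : smooth_on D m -> D p ->
  lor ('D_w (principal_form m u) p) (X p) = - lor (principal_form m u p) ('D_w X p).
Proof.
move=> sm Dp; apply/eqP; rewrite -addr_eq0; apply/eqP.
by apply: (derive_lor_cst w oD Dp (dform u sm Dp) (dX Dp)) => q Dq; exact: form_X.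
Qed.

Lemma derive_form_xi m p u w : smooth_on D m -> D p ->
  lor ('D_w (principal_form m u) p) (xi p) = - lor (principal_form m u p) ('D_w xi p).
Proof.
move=> sm Dp; apply/eqP; rewrite -addr_eq0; apply/eqP.
by apply: (derive_lor_cst w oD Dp (dform u sm Dp) (dxi Dp)) => q Dq; exact: form_xi.
Qed.

Lemma derive_form_e5 m p u w : smooth_on D m -> D p -> lor ('D_w (principal_form m u) p) e5 = 0.
Proof.
move=> sm Dp.
have := derive_lor_cst w oD Dp (dform u sm Dp) (differentiable_cst _ _)
  (fun q Dq => form_e5 u m Dq).
by rewrite derive_cst lor0r addr0.
Qed.

(** Differentiate [derive_form_orth] once more and exchange the order of differentiation. *)
Lemma cross_derivatives p w z u v : D p ->
  lor ('D_w (principal_form m2 u) p) ('D_z (principal_form m3 v) p) =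
  lor ('D_z (principal_form m2 u) p) ('D_w (principal_form m3 v) p).
Proof.
move=> Dp.
have H y x : lor ('D_y ('D_x (principal_form m2 u)) p) (principal_form m3 v p) +
    lor ('D_x (principal_form m2 u) p) ('D_y (principal_form m3 v) p) = 0.
  apply: (derive_lor_cst y oD Dp _ (dform v sm3 Dp)).
    by apply: smooth_diff Dp; apply: smooth_derive; exact: smooth_form.
  by move=> q Dq; exact: derive_form_orth.
have S := schwarz_row w z oD (smooth_form u sm2 2) Dp.
have H1 := H z w; have H2 := H w z; rewrite S in H2.
exact: addrI (etrans H1 (esym H2)).
Qed.

(** Take [w = u = t3] and [z = v = t2] in [cross_derivatives]: the right hand side vanishes,
    and the left hand side is a nonzero multiple of [m2 p * m3 p - 1]. *)
Lemma principal_product p : D p -> m2 p * m3 p = 1.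
Proof.
move=> Dp; have [t1 [t2 [t3 F]]] := frames Dp.
have [e2 e3] := lorxi_DX Dp F.
have E32 : lor ('D_t3 X p) ('D_t2 X p) = 0 by rewrite lorC (pf_E23 F).
have k0 : m2 p - m3 p != 0 by rewrite subr_eq0 m23.
have k0' : m3 p - m2 p != 0 by rewrite subr_eq0 eq_sym m23.
have O2 u : lor u (principal_form m3 t2 p) = 0 -> lor u ('D_t2 X p) = 0.
  by rewrite (form2 F) lorZr => /eqP; rewrite mulf_eq0 (negPf k0) => /eqP.
have O3 u : lor (principal_form m2 t3 p) u = 0 -> lor u ('D_t3 X p) = 0.
  by rewrite (form3 F) lorZl lorC => /eqP; rewrite mulf_eq0 (negPf k0') => /eqP.
apply: (@principal_product_algebra _ (X p) (xi p) ('D_t2 X p) ('D_t3 X p)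
  ('D_t3 (principal_form m2 t3) p) ('D_t2 (principal_form m3 t2) p)
  ('D_t2 (principal_form m2 t3) p) ('D_t3 (principal_form m3 t2) p) (m2 p) (m3 p)).
- exact: XX.
- exact: xixi.
- exact: Xxi.
- exact: lorX_DX Dp t2.
- exact: lorX_DX Dp t3.
- exact: X5.
- exact: e2.
- exact: e3.
- exact: xi5.
- exact: pf_E23 F.
- exact: lorDX5 Dp t2.
- exact: lorDX5 Dp t3.
- exact: pf_E22 F.
- exact: pf_E33 F.
- exact: m23.
- by rewrite (derive_form_X t3 t3 sm2 Dp) (form3 F) lorZl.
- by rewrite (derive_form_xi t3 t3 sm2 Dp) (form3 F) (pf_xi3 F) lorZl lorZr.
- exact: O2 (derive_form_orth t3 t3 t2 Dp).
- exact: derive_form_e5.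
- by rewrite (derive_form_X t2 t2 sm3 Dp) (form2 F) lorZl.
- by rewrite (derive_form_xi t2 t2 sm3 Dp) (form2 F) (pf_xi2 F) lorZl lorZr.
- exact: O3 (form_derive_orth t2 t3 t2 Dp).
- by rewrite (derive_form_X t3 t2 sm2 Dp) (form3 F) lorZl E32 mulr0 oppr0.
- by rewrite (derive_form_xi t3 t2 sm2 Dp) (form3 F) (pf_xi2 F) lorZl lorZr E32 !mulr0 oppr0.
- exact: O2 (derive_form_orth t2 t3 t2 Dp).
- exact: derive_form_e5.
- exact: O3 (form_derive_orth t3 t3 t2 Dp).
- exact: cross_derivatives.
Qed.

Lemma principal_sqr_neq1 p : D p -> 1 - m2 p ^+ 2 != 0.
Proof.
move=> Dp; apply/negP => /eqP E1; have := m23 Dp; apply/negP; rewrite negbK.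
have P := principal_product Dp.
have E2 : m2 p ^+ 2 = 1 by apply/eqP; rewrite eq_sym -subr_eq0 E1.
by rewrite -[m3 p]mul1r -E2 expr2 -mulrA P mulr1.
Qed.

(** The squared Lorentz length of the projection of [v] to the plane spanned by the second
    principal direction, given by [principal_form m3 v0], and by [X - m2 xi]. As a function of
    [v] it determines the plane. *)
Definition plane_quadratic (v0 : V) (v : E5) (q : V) : R :=
  lor (principal_form m3 v0 q) v * lor (principal_form m3 v0 q) v / lor (principal_form m3 v0 q) (principal_form m3 v0 q) -
  lor (X q - m2 q *: xi q) v * lor (X q - m2 q *: xi q) v / (1 - m2 q * m2 q).

(** By [riccati] and [principal_product] the derivatives of the two spanning vectors lie in the
    plane they span, so the projection to it does not move. *)
Lemma derive_plane_quadratic v0 v p w : D p -> lor (principal_form m3 v0 p) (principal_form m3 v0 p) != 0 ->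
  differentiable (plane_quadratic v0 v) p /\ 'D_w (plane_quadratic v0 v) p = 0.
Proof.
move=> Dp N0; have [t1 [t2 [t3 F]]] := frames Dp.
have dB := dform v0 sm3 Dp.
have dm : differentiable m2 p := smooth_diff sm2 Dp.
have dv : differentiable (fun=> v : E5) p by exact: differentiable_cst.
have [dmx _] := differentiable_scale dm (dxi Dp).
have db : differentiable (fun q => X q - m2 q *: xi q) p.
  exact: (differentiableB (dX Dp) dmx).
have dBv := derive_lor w dB dv; have dbv := derive_lor w db dv.
have dBB := derive_lor w dB dB.
rewrite derive_cst lor0r addr0 in dBv; rewrite derive_cst lor0r addr0 in dbv.
have diffBv := differentiable_lor dB dv; have diffbv := differentiable_lor db dv.
have diffBB := differentiable_lor dB dB.
have diffm : differentiable (fun q => 1 - m2 q * m2 q) p.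
  by apply: differentiableB; [exact: differentiable_cst|exact: differentiableM].
have m0 : 1 - m2 p * m2 p != 0 by rewrite -expr2 principal_sqr_neq1.
have [f1 e1] := derive_frac w diffBv diffBB N0.
have [f2 e2] := derive_frac w diffbv diffm m0.
split; first exact: (differentiableB f1 f2).
apply: etrans (deriveB2 w f1 f2) _.
rewrite e1 e2 dBv dbv dBB.
have -> : 'D_w (fun q => 1 - m2 q * m2 q) p = - ('D_w m2 p * m2 p + m2 p * 'D_w m2 p).
  have := deriveB2 w (differentiable_cst (1 : R) p) (differentiableM dm dm).
  by rewrite derive_cst sub0r (deriveM2 w dm dm).
have -> : 'D_w (fun q => X q - m2 q *: xi q) p =
    'D_w X p - ('D_w m2 p *: xi p + m2 p *: 'D_w xi p).
  by rewrite (deriveB2 w (dX Dp) dmx) (deriveZ2 w dm (dxi Dp)).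
rewrite 2!mulrN opprK; apply/eqP; rewrite subr_eq0; apply/eqP.
have [d1 [d2 [d3 Ew]]] := pf_span F w.
have [b1 [b2 [b3 Ev0]]] := pf_span F v0.
pose b0 := b2 * (m2 p - m3 p).
have EB : principal_form m3 v0 p = b0 *: 'D_t2 X p.
  rewrite Ev0 (form_comb _ _ _ _ _ _ _ Dp) (form1 F) (form2 F) (form3 F).
  exact: b0_aux.
have EX : 'D_w X p = (c p * (d1 * 'D_t1 h p)) *: xi p + d2 *: 'D_t2 X p + d3 *: 'D_t3 X p.
  rewrite Ew (derive_comb _ _ _ _ _ _ (dX Dp)) (pf_X1 F).
  by rewrite scale_aux.
have Exi : 'D_w xi p = (c p * (d1 * 'D_t1 h p)) *: X p + d2 *: (m2 p *: 'D_t2 X p)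
    + d3 *: (m3 p *: 'D_t3 X p).
  rewrite Ew (derive_comb _ _ _ _ _ _ (dxi Dp)) (pf_xi1 F) (pf_xi2 F) (pf_xi3 F).
  by rewrite scale_aux.
have Eh : 'D_w h p = d1 * 'D_t1 h p.
  rewrite Ew (derive_comb _ _ _ _ _ _ (dh Dp)) (pf_h2 F) (pf_h3 F) !scaler0 !addr0.
  by [].
have Em : 'D_w m2 p = c p * (1 - m2 p ^+ 2) * (d1 * 'D_t1 h p).
  by rewrite (dm2 Dp) Eh (riccati Dp F).
have DBX := derive_form_X v0 w sm3 Dp; have DBx := derive_form_xi v0 w sm3 Dp.
have DB5 := derive_form_e5 v0 w sm3 Dp.
have k0' : m3 p - m2 p != 0 by rewrite subr_eq0 eq_sym m23.
have DB3 : lor ('D_w (principal_form m3 v0) p) ('D_t3 X p) = 0.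
  have := form_derive_orth w t3 v0 Dp.
  by rewrite (form3 F) lorZl lorC => /eqP; rewrite mulf_eq0 (negPf k0') => /eqP.
have b00 : b0 != 0.
  by move: N0; rewrite EB; apply: contraNneq => ->; rewrite scale0r lor0l.
rewrite EX in DBX; rewrite Exi in DBx; rewrite EB in DBX DBx.
rewrite EX Exi Em EB.
have [x2 x3] := lorxi_DX Dp F.
exact: (plane_quadratic_algebra v (XX Dp) (xixi Dp) (Xxi Dp) (lorX_DX Dp t2) (lorX_DX Dp t3)
  (X5 Dp) x2 x3 (xi5 Dp) (pf_E23 F) (lorDX5 Dp t2) (lorDX5 Dp t3) (pf_E22 F) (pf_E33 F)
  (principal_product Dp) (principal_sqr_neq1 Dp) b00 DBX DBx DB3 DB5).
Qed.

Lemma plane_quadratic_locally_constant v0 p : D p -> lor (principal_form m3 v0 p) (principal_form m3 v0 p) != 0 ->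
  \forall q \near p, lor (principal_form m3 v0 q) (principal_form m3 v0 q) != 0 /\
     forall v, plane_quadratic v0 v q = plane_quadratic v0 v p.
Proof.
move=> Dp N0.
have cN : {for p, continuous (fun q => lor (principal_form m3 v0 q) (principal_form m3 v0 q))}.
  apply: differentiable_continuous.
  by have d := dform v0 sm3 Dp; exact: differentiable_lor.
have NN : nbhs p [set q | D q /\ lor (principal_form m3 v0 q) (principal_form m3 v0 q) != 0].
  apply: filterI; first exact: open_nbhs_nbhs.
  have : \forall q \near p, `|lor (principal_form m3 v0 p) (principal_form m3 v0 p)| / 2 <=
      `|lor (principal_form m3 v0 q) (principal_form m3 v0 q)|.
    have e0 : 0 < `|lor (principal_form m3 v0 p) (principal_form m3 v0 p)| / 2.
      by rewrite divr_gt0// normr_gt0.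
    have /cvgrPdist_le/(_ _ e0) := cN; apply: filterS => q.
    exact: half_le.
  apply: filterS => q; rewrite -normr_gt0; apply: lt_le_trans.
  by rewrite divr_gt0// normr_gt0.
move/nbhs_ballP: NN => [r /= r0 Hr].
apply/nbhs_ballP; exists r => // q qr.
have seg (s : R) : 0 <= s <= 1 -> ball p r (p + s *: (q - p)).
  move=> /andP[s0 s1]; move: qr; rewrite -!ball_normE /= => qr.
  rewrite opprD addrA subrr sub0r normrN normrZ ger0_norm// distrC.
  by apply: le_lt_trans qr; rewrite -[leRHS]mul1r ler_wpM2r.
have [_ Nq] := Hr _ qr; split=> // v.
have [s s01] := mvt_line (@ltr01 R) (fun s Hs =>
  (derive_plane_quadratic v 0 (Hr _ (seg s Hs)).1 (Hr _ (seg s Hs)).2).1).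
have [Ds Ns] := Hr _ (seg s s01).
rewrite (derive_plane_quadratic v (q - p) Ds Ns).2 mulr0 scale1r subrKC => /eqP.
by rewrite subr_eq0 => /eqP.
Qed.

End TwoForms.

End LocalGeometry.

(** * Tangent vectors of H^3 x R *)

Section H3Ralgebra.
Context {R : realType}.
Notation E5 := 'rV[R]_5.
Implicit Types (p u v : E5).

Lemma nuE p : nu p = p - p 0 4 *: e5.
Proof.
apply/rowP => j; rewrite !mxE eqxx /=; move: j; apply: ord5P;
  rewrite /= ?mulr0 ?subr0// mulr1 subrr//.
Qed.

Lemma lor_nu p v : lor v (nu p) = - (v 0 0 * p 0 0) + v 0 1 * p 0 1 + v 0 2 * p 0 2 + v 0 3 * p 0 3.
Proof. by rewrite lorE !mxE /= mulr0 addr0. Qed.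

Lemma nu5 p : lor (nu p) e5 = 0.
Proof. by rewrite lor_e5 mxE. Qed.

Lemma H3R_nu p : H3R p -> lor (nu p) (nu p) = -1.
Proof. by case=> E _; rewrite lor_nu !mxE /= -!expr2. Qed.

(** The metric of H^3 x R is Riemannian. *)
Lemma tangent_pos p v : H3R p -> tangent_H3R p v -> v != 0 -> 0 < lor v v.
Proof.
move=> [E p0]; rewrite /tangent_H3R lor_nu => T v0.
rewrite lorE.
set a := p 0 0 in E p0 T *; set x := p 0 1 in E T *; set y := p 0 2 in E T *.
set z := p 0 3 in E T *.
set va := v 0 0 in T *; set vx := v 0 1 in T *; set vy := v 0 2 in T *.
set vz := v 0 3 in T *; set w := v 0 4.
(* tangency gives a^2 <v,v> = a^2 w^2 + |v'|^2 + |v' x p'|^2, where v' and p' are the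
   coordinates 1, 2, 3 of v and p *)
have key : a ^+ 2 * (- (va * va) + vx * vx + vy * vy + vz * vz + w * w) =
   a ^+ 2 * w ^+ 2 + (vx ^+ 2 + vy ^+ 2 + vz ^+ 2) +
   ((vx * y - vy * x) ^+ 2 + (vx * z - vz * x) ^+ 2 + (vy * z - vz * y) ^+ 2).
  have a2 : a ^+ 2 = 1 + x ^+ 2 + y ^+ 2 + z ^+ 2 by lra.
  have av : va * a = vx * x + vy * y + vz * z by lra.
  have -> : a ^+ 2 * (- (va * va) + vx * vx + vy * vy + vz * vz + w * w) =
     - (va * a) ^+ 2 + a ^+ 2 * (vx * vx + vy * vy + vz * vz + w * w) by ring.
  by rewrite av a2; ring.
have nn : 0 <= vx ^+ 2 + vy ^+ 2 + vz ^+ 2 by rewrite !addr_ge0 ?sqr_ge0.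
have a20 : 0 < a ^+ 2 by rewrite exprn_gt0.
rewrite -(pmulr_rgt0 _ a20) key.
have c0 : 0 <= (vx * y - vy * x) ^+ 2 + (vx * z - vz * x) ^+ 2 + (vy * z - vz * y) ^+ 2.
  by rewrite !addr_ge0 ?sqr_ge0.
have w0 : 0 <= a ^+ 2 * w ^+ 2 by rewrite mulr_ge0 ?sqr_ge0.
have [z0|] := eqVneq (a ^+ 2 * w ^+ 2 + (vx ^+ 2 + vy ^+ 2 + vz ^+ 2)) 0; last first.
  by rewrite neq_lt => /orP[|]; lra.
have x0 : vx ^+ 2 = 0 by have := sqr_ge0 vx; have := sqr_ge0 vy; have := sqr_ge0 vz; lra.
have y0 : vy ^+ 2 = 0 by have := sqr_ge0 vx; have := sqr_ge0 vy; have := sqr_ge0 vz; lra.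
have zz0 : vz ^+ 2 = 0 by have := sqr_ge0 vx; have := sqr_ge0 vy; have := sqr_ge0 vz; lra.
have ww0 : a ^+ 2 * w ^+ 2 = 0 by lra.
have {}x0 : vx = 0 by apply/eqP; rewrite -sqrf_eq0 x0.
have {}y0 : vy = 0 by apply/eqP; rewrite -sqrf_eq0 y0.
have {}zz0 : vz = 0 by apply/eqP; rewrite -sqrf_eq0 zz0.
have {}ww0 : w = 0.
  by move/eqP: ww0; rewrite mulf_eq0 (gt_eqF a20) /= sqrf_eq0 => /eqP.
have va0 : va = 0.
  have : va * a = 0 by move: T; rewrite x0 y0 zz0; lra.
  by move/eqP; rewrite mulf_eq0 (gt_eqF p0) orbF => /eqP.
exfalso; move/eqP: v0; apply; apply/rowP; apply: ord5P; rewrite [RHS]mxE //.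
Qed.

(** The rows of [J] together with [nu p] and [n] are five independent vectors. *)
Lemma tangent_span p n (J : 'M[R]_(3, 5)) v : lor (nu p) (nu p) = -1 -> lor n n = 1 ->
  lor n (nu p) = 0 ->
  row_free J -> (forall w : 'rV_3, lor (nu p) (w *m J) = 0 /\ lor n (w *m J) = 0) ->
  lor v (nu p) = 0 -> lor v n = 0 -> (v <= J)%MS.
Proof.
move=> pp nn np fJ oJ vp vn.
pose M : 'M[R]_(3 + (1 + 1), 5) := col_mx J (col_mx (nu p) n).
have decomp (a : 'rV_3) (b c : 'rV_1) :
    row_mx a (row_mx b c) *m M = a *m J + (b 0 0 *: nu p + c 0 0 *: n).
  by rewrite !mul_row_col [b]mx11_scalar [c]mx11_scalar !mul_scalar_mx !mxE.
have inner (a : 'rV_3) (b c : 'rV_1) :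
    lor (row_mx a (row_mx b c) *m M) (nu p) = - b 0 0 /\
    lor (row_mx a (row_mx b c) *m M) n = c 0 0.
  have [h1 h2] := oJ a.
  rewrite decomp !lorD (lorC _ (nu p)) h1 (lorC _ n) h2 pp np nn (lorC (nu p)) np.
  by split; ring.
have spl (w : 'rV[R]_(3 + (1 + 1))) : exists a b c, w = row_mx a (row_mx b c).
  by exists (lsubmx w), (lsubmx (rsubmx w)), (rsubmx (rsubmx w)); rewrite !hsubmxK.
have fM : row_free M.
  rewrite -kermx_eq0; apply/rowV0P => w /sub_kermxP.
  have [a [b [c ->]]] := spl w => E.
  have [h1 h2] := inner a b c; rewrite E !lor0l in h1 h2.
  have b0 : b = 0 by apply/rowP => i; rewrite !ord1 mxE -[b 0 0]opprK -h1 oppr0.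
  have c0 : c = 0 by apply/rowP => i; rewrite !ord1 mxE -h2.
  rewrite decomp b0 c0 !mxE !scale0r !addr0 in E.
  by rewrite (row_free_inj fJ (etrans E (esym (mul0mx _ _)))) b0 c0 !row_mx0.
have uM : (M : 'M[R]_5) \in unitmx by rewrite -row_free_unit.
have Ev : v = (v *m invmx (M : 'M[R]_5)) *m (M : 'M[R]_5) by rewrite mulmxKV.
have [a [b [c Ew]]] := spl (v *m invmx (M : 'M[R]_5)).
rewrite Ew in Ev.
have [h1 h2] := inner a b c; rewrite -Ev vp vn in h1 h2.
rewrite decomp in Ev; rewrite Ev -h2 -[b 0 0]opprK -h1 oppr0 !scale0r !addr0.
exact: submxMl.
Qed.

End H3Ralgebra.

(** * Principal curvatures in one chart *)

Lemma independent_aux (R : realType) (a b d : R) (x y z : 'rV[R]_5) :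
  lor x y = 0 -> lor x z = 0 -> lor y z = 0 ->
  0 < lor x x -> 0 < lor y y -> 0 < lor z z ->
  a *: x + b *: y + d *: z = 0 -> a = 0 /\ b = 0 /\ d = 0.
Proof.
move=> xy xz yz xx yy zz E.
have S (t k : R) (w : 'rV[R]_5) : 0 < lor w w -> t * lor w w = 0 -> t = 0.
  by move=> w0 /eqP; rewrite mulf_eq0 (gt_eqF w0) orbF => /eqP.
have e1 : a * lor x x = 0.
  by have := congr1 (fun w => lor w x) E; rewrite !lorD (lorC y) xy (lorC z) xz; lra.
have e2 : b * lor y y = 0.
  by have := congr1 (fun w => lor w y) E; rewrite !lorD xy (lorC z) yz; lra.
have e3 : d * lor z z = 0.
  by have := congr1 (fun w => lor w z) E; rewrite !lorD xz yz; lra.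
split; first exact: (S a a x).
by split; [exact: (S b b y)|exact: (S d d z)].
Qed.

Lemma xi1_aux (R : realType) (nv z e : 'rV[R]_5) (s y k : R) :
  y * y * (1 - s * s) = 1 ->
  (y * y * y * s * - (k * (1 - s * s))) *: (s *: e - nv) +
   y *: (- (k * (1 - s * s)) *: e - (- (k *: (e - s *: nv)) - (s * (1 - s * s)) *: z)) =
  (s * y * (1 - s * s)) *: z.
Proof.
move=> H.
have -> : y * y * y * s * - (k * (1 - s * s)) = - (y * s * k).
  by transitivity (- ((y * y * (1 - s * s)) * (y * s * k))); [ring|rewrite H mul1r].
by apply/rowP => i; rewrite !mxE; ring.
Qed.

Lemma derive_r_aux (R : realType) (a b y s : R) :
  (a * y + y * a) * (1 - s * s) + y * y * - (b * s + s * b) = 0 ->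
  y * y * (1 - s * s) = 1 -> a = y * y * y * s * b.
Proof.
move=> H Rq.
have E : a * y * (1 - s * s) = y * y * (b * s) by lra.
transitivity (a * (y * y * (1 - s * s))); first by rewrite Rq mulr1.
transitivity (y * (a * y * (1 - s * s))); first by ring.
by rewrite E; ring.
Qed.

Lemma dk1_aux (R : realType) (a b x y z t : R) : y != 0 ->
  - (a * y + z * t) = - (b * x + z * t) -> a = b / y * x.
Proof.
move=> y0 /oppr_inj /addIr H.
by apply: (mulIf y0); rewrite H mulrAC divfK.
Qed.

(** [nabla_t n = - k dX(t)] in terms of the flat derivative: the last term is the component of
    [D_t n] along the normal line of H3R, found by differentiating [lor n (nu X) = 0]. *)
Definition weingarten (R : realType) (X n : 'rV[R]_3 -> 'rV[R]_5) (k : R) (u t : 'rV[R]_3) :=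
  'D_t n u = - (k *: 'D_t X u) - (n u 0 4 * ('D_t X u) 0 4) *: nu (X u).

Record patch_frame (R : realType) (X n : 'rV[R]_3 -> 'rV[R]_5) (k1 k2 k3 : 'rV[R]_3 -> R)
    (u t1 t2 t3 : 'rV[R]_3) : Prop := PatchFrame {
  pa_t1 : t1 != 0; pa_t2 : t2 != 0; pa_t3 : t3 != 0;
  pa_T : 'D_t1 X u = e5 - n u 0 4 *: n u;
  pa_1 : weingarten X n (k1 u) u t1;
  pa_2 : weingarten X n (k2 u) u t2;
  pa_3 : weingarten X n (k3 u) u t3 }.

Record principal_patch (R : realType) (D : set 'rV[R]_3) (X n : 'rV[R]_3 -> 'rV[R]_5)
    (k1 k2 k3 : 'rV[R]_3 -> R) (Dk : set R) (f1 f2 : R -> R) : Prop := PrincipalPatch {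
  pp_open : open D;
  pp_X : smooth_on D X;
  pp_n : smooth_on D n;
  pp_H3R : forall u, D u -> H3R (X u);
  pp_free : forall u w, D u -> 'D_w X u = 0 -> w = 0;
  pp_nX0 : forall u, D u -> lor (n u) (nu (X u)) = 0;
  pp_nn : forall u, D u -> lor (n u) (n u) = 1;
  pp_nX : forall u w, D u -> lor (n u) ('D_w X u) = 0;
  pp_k12 : forall u, D u -> k1 u != k2 u;
  pp_k13 : forall u, D u -> k1 u != k3 u;
  pp_k23 : forall u, D u -> k2 u != k3 u;
  pp_f1 : smooth_on Dk f1;
  pp_f2 : smooth_on Dk f2;
  pp_k1 : forall u, D u -> Dk (k1 u);
  pp_k2 : forall u, D u -> k2 u = f1 (k1 u);
  pp_k3 : forall u, D u -> k3 u = f2 (k1 u);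
  pp_frames : forall u, D u -> exists t1 t2 t3, patch_frame X n k1 k2 k3 u t1 t2 t3 }.

Section HorizontalPart.
Context {R : realType} {V : normedModType R}.
Variables (D : set V) (X : V -> 'rV[R]_5).
Hypotheses (oD : open D) (sX : smooth_on D X).

Let dX u : D u -> differentiable X u. Proof. exact: smooth_diff. Qed.

Lemma smooth_coord (j : 'I_5) : smooth_on D (fun u => X u 0 j).
Proof. by move=> k; have [/(_ (sX k) j)] := Ck_on_rowP k X oD. Qed.

Lemma derive_coord (j : 'I_5) u w : D u -> 'D_w (fun u => X u 0 j) u = ('D_w X u) 0 j.
Proof. by move=> Du; rewrite (derive_row w j (dX Du)). Qed.

Lemma nu_compE : (fun u => nu (X u)) = fun u => X u - X u 0 4 *: e5.
Proof. by apply/funext => u; rewrite nuE. Qed.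

Lemma smooth_nu : smooth_on D (fun u => nu (X u)).
Proof.
rewrite nu_compE => k; apply: (Ck_onB oD); first exact: sX.
by apply: (Ck_onZ oD); [exact: smooth_coord|exact: Ck_on_cst].
Qed.

Lemma derive_nu u w : D u ->
  'D_w (fun u => nu (X u)) u = 'D_w X u - ('D_w X u) 0 4 *: e5.
Proof.
move=> Du; have de : differentiable (fun=> e5 : 'rV[R]_5) u by exact: differentiable_cst.
have dh : differentiable (fun u => X u 0 4) u := smooth_diff (smooth_coord 4) Du.
have [d1 _] := differentiable_scale dh de.
rewrite nu_compE (deriveB2 w (dX Du) d1) (deriveZ2 w dh de) derive_cst scaler0 addr0.
by rewrite (derive_coord 4 w Du).
Qed.

Lemma nu_derive u w : (forall q, D q -> H3R (X q)) -> D u -> lor (nu (X u)) ('D_w X u) = 0.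
Proof.
move=> hH Du; have dnu := smooth_diff smooth_nu Du.
have := derive_lor_cst w oD Du dnu dnu (fun q Dq => H3R_nu (hH q Dq)).
rewrite (lorC ('D_w (fun u => nu (X u)) u)) -mulr2n => /eqP; rewrite mulrn_eq0 => /eqP.
by rewrite (derive_nu w Du) lorBr lorZr nu5 mulr0 subr0.
Qed.

End HorizontalPart.

Section TiltedNormal.
Context {R : realType}.
Implicit Types (p n E v : 'rV[R]_5) (k : R).

(** The inverse of the length of the horizontal part of a unit normal [n]. *)
Definition tilt n : R := (Num.sqrt (1 - n 0 4 * n 0 4))^-1.
Definition horizontal n : 'rV[R]_5 := tilt n *: (n 0 4 *: e5 - n).
(** The vector which, with a principal direction of curvature [k], spans the plane that turns
    out to be constant. *)
Definition centre p n k : 'rV[R]_5 := nu p - (k * tilt n) *: horizontal n.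
Definition plane_form p n k E v : R :=
  lor E v * lor E v / lor E E -
  lor (centre p n k) v * lor (centre p n k) v / (1 - (k * tilt n) * (k * tilt n)).

Lemma plane_formZ p n k (a : R) E v : a != 0 ->
  plane_form p n k (a *: E) v = plane_form p n k E v.
Proof.
move=> a0; rewrite /plane_form !lorZl !lorZr; congr (_ - _).
have [->|n0] := eqVneq (lor E E) 0; first by rewrite !mulr0 !invr0 !mulr0.
by field; rewrite a0 n0.
Qed.

Lemma horizontal5 n : lor (horizontal n) e5 = 0.
Proof. by rewrite /horizontal lorZl lorBl lorZl lor_e55 lor_e5; ring. Qed.

End TiltedNormal.

Section Patch.
Context {R : realType}.
Notation E5 := 'rV[R]_5.
Notation V := 'rV[R]_3.
Variables (D : set V) (X n : V -> E5) (k1 k2 k3 : V -> R).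
Variables (Dk : set R) (f1 f2 : R -> R).
Hypothesis P : principal_patch D X n k1 k2 k3 Dk f1 f2.

Let oD : open D := pp_open P.
Let sX : smooth_on D X := pp_X P.
Let sn : smooth_on D n := pp_n P.
Let hH u : D u -> H3R (X u). Proof. exact: (pp_H3R P). Qed.
Let hfree u w : D u -> 'D_w X u = 0 -> w = 0. Proof. exact: (pp_free P). Qed.
Let hn1 u : D u -> lor (n u) (nu (X u)) = 0. Proof. exact: (pp_nX0 P). Qed.
Let hnn u : D u -> lor (n u) (n u) = 1. Proof. exact: (pp_nn P). Qed.
Let hnX u w : D u -> lor (n u) ('D_w X u) = 0. Proof. exact: (pp_nX P). Qed.
Let k12 u : D u -> k1 u != k2 u. Proof. exact: (pp_k12 P). Qed.
Let k13 u : D u -> k1 u != k3 u. Proof. exact: (pp_k13 P). Qed.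
Let k23 u : D u -> k2 u != k3 u. Proof. exact: (pp_k23 P). Qed.
Let sf1 : smooth_on Dk f1 := pp_f1 P.
Let sf2 : smooth_on Dk f2 := pp_f2 P.
Let k1Dk u : D u -> Dk (k1 u). Proof. exact: (pp_k1 P). Qed.
Let rel2 u : D u -> k2 u = f1 (k1 u). Proof. exact: (pp_k2 P). Qed.
Let rel3 u : D u -> k3 u = f2 (k1 u). Proof. exact: (pp_k3 P). Qed.
Let pframes u : D u -> exists t1 t2 t3, patch_frame X n k1 k2 k3 u t1 t2 t3.
Proof. exact: (pp_frames P). Qed.

Notation weingarten := (weingarten X n).
Notation patch_frame := (patch_frame X n k1 k2 k3).

Let h (u : V) : R := X u 0 4.
Let sg (u : V) : R := n u 0 4.
Let X0 (u : V) : E5 := nu (X u).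
Let r (u : V) : R := tilt (n u).
Let xi (u : V) : E5 := horizontal (n u).
Let xiE : xi = fun u => r u *: (sg u *: e5 - n u). Proof. by []. Qed.
Let c (u : V) : R := sg u * r u.
Let m2 (u : V) : R := k2 u * r u.
Let m3 (u : V) : R := k3 u * r u.

Let dX u : D u -> differentiable X u. Proof. exact: smooth_diff. Qed.
Let dn u : D u -> differentiable n u. Proof. exact: smooth_diff. Qed.

Let smooth_h : smooth_on D h := smooth_coord oD sX 4.
Let smooth_sg : smooth_on D sg := smooth_coord oD sn 4.
Let smooth_X0 : smooth_on D X0 := smooth_nu oD sX.

Let dh u : D u -> differentiable h u. Proof. exact: smooth_diff smooth_h. Qed.
Let dsg u : D u -> differentiable sg u. Proof. exact: smooth_diff smooth_sg. Qed.

Let derive_h u w : D u -> 'D_w h u = ('D_w X u) 0 4. Proof. exact: derive_coord. Qed.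
Let derive_sg u w : D u -> 'D_w sg u = ('D_w n u) 0 4. Proof. exact: derive_coord. Qed.
Let derive_X0 u w : D u -> 'D_w X0 u = 'D_w X u - ('D_w X u) 0 4 *: e5.
Proof. exact: derive_nu. Qed.

Let patch_XX u : D u -> lor (X0 u) (X0 u) = -1.
Proof. by move=> Du; exact: H3R_nu (hH Du). Qed.
Let patch_X5 u : D u -> lor (X0 u) e5 = 0.
Proof. by move=> _; exact: nu5. Qed.
Let patch_ne5 u : lor (n u) e5 = sg u. Proof. exact: lor_e5. Qed.

Let patch_X0DX u w : D u -> lor (X0 u) ('D_w X u) = 0.
Proof. exact: nu_derive. Qed.

Lemma patch_DX_pos u w : D u -> w != 0 -> 0 < lor ('D_w X u) ('D_w X u).
Proof.
move=> Du w0; apply: (tangent_pos (hH Du)).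
  by rewrite /tangent_H3R lorC; exact: patch_X0DX.
by apply: contraNneq w0 => /(hfree Du) ->.
Qed.

Lemma second_form_sym u w v : D u ->
  lor ('D_w n u) ('D_v X u) = lor ('D_v n u) ('D_w X u).
Proof.
move=> Du.
have H a b z : 'D_a ('D_b X) u = z -> lor ('D_a n u) ('D_b X u) = - lor (n u) z.
  move=> <-; apply/eqP; rewrite -addr_eq0; apply/eqP.
  apply: (derive_lor_cst a oD Du (dn Du)) => [|q Dq]; last exact: hnX.
  exact: (smooth_diff (smooth_derive b sX) Du).
have S := schwarz_row w v oD (sX 2) Du.
exact: etrans (H w v _ S) (esym (H v w _ erefl)).
Qed.

Lemma weingarten_lor u k t v : D u -> weingarten k u t ->
  lor ('D_t n u) ('D_v X u) = - (k * lor ('D_t X u) ('D_v X u)).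
Proof.
move=> Du ->; have Z := patch_X0DX v Du; rewrite -/(X0 u).
move: ('D_t X u) ('D_v X u) (X0 u) Z => a b z Z.
by rewrite !lorD Z mulr0 subr0.
Qed.

(** Principal directions are orthogonal because the second fundamental form is symmetric. *)
Lemma principal_orthogonal u k l t v : D u -> weingarten k u t -> weingarten l u v ->
  k != l -> lor ('D_t X u) ('D_v X u) = 0.
Proof.
move=> Du wt wv kl.
have sym : lor ('D_v n u) ('D_t X u) = - (l * lor ('D_t X u) ('D_v X u)).
  exact: etrans (weingarten_lor t Du wv) (congr1 (fun z => - (l * z)) (lorC _ _)).
have := etrans (esym (weingarten_lor v Du wt)) (etrans (second_form_sym t v Du) sym).
move: (lor _ _) => a /eqP; rewrite eqr_opp -subr_eq0 -mulrBl mulf_eq0 subr_eq0.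
by rewrite (negPf kl) => /eqP.
Qed.

Section AtPatchPoint.
Variables (u t1 t2 t3 : V).
Hypothesis Du : D u.
Hypothesis F : patch_frame u t1 t2 t3.

Lemma patch_h1 : 'D_t1 h u = 1 - sg u * sg u.
Proof.
rewrite (derive_h t1 Du) (pa_T F); apply: etrans (esym (lor_e5 _)) _.
by rewrite lorBl lor_e55 lorZl patch_ne5.
Qed.

Lemma patch_h1_pos : 0 < 'D_t1 h u.
Proof.
have := patch_DX_pos Du (pa_t1 F).
have -> // : lor ('D_t1 X u) ('D_t1 X u) = 'D_t1 h u.
rewrite patch_h1 (pa_T F) -/(sg u).
have H1 := hnn Du; have H2 := patch_ne5 u.
by rewrite !lorD lor_e55 (lorC e5) H1 H2; ring.
Qed.

(** The gradient of the height is [T], which is orthogonal to the other principal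
    directions. *)
Lemma patch_h_other k t : weingarten k u t -> k1 u != k -> 'D_t h u = 0.
Proof.
move=> wt kk; have := principal_orthogonal Du (pa_1 F) wt kk.
rewrite (pa_T F) lorBl lorZl (hnX t Du) mulr0 subr0 lorC lor_e5 => Z.
exact: etrans (derive_h t Du) Z.
Qed.

Lemma patch_h2 : 'D_t2 h u = 0.
Proof. exact: patch_h_other (pa_2 F) (k12 Du). Qed.
Lemma patch_h3 : 'D_t3 h u = 0.
Proof. exact: patch_h_other (pa_3 F) (k13 Du). Qed.

Lemma patch_span w : exists a1 a2 a3, w = a1 *: t1 + a2 *: t2 + a3 *: t3.
Proof.
pose M : 'M[R]_(1 + (1 + 1), 3) := col_mx t1 (col_mx t2 t3).
have decomp (a b d : 'rV_1) :
    row_mx a (row_mx b d) *m M = a 0 0 *: t1 + b 0 0 *: t2 + d 0 0 *: t3.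
  by rewrite !mul_row_col [a]mx11_scalar [b]mx11_scalar [d]mx11_scalar !mul_scalar_mx !mxE /= !mulr1n addrA.
have spl (z : 'rV[R]_(1 + (1 + 1))) : exists a b d, z = row_mx a (row_mx b d).
  by exists (lsubmx z), (lsubmx (rsubmx z)), (rsubmx (rsubmx z)); rewrite !hsubmxK.
have o12 := principal_orthogonal Du (pa_1 F) (pa_2 F) (k12 Du).
have o13 := principal_orthogonal Du (pa_1 F) (pa_3 F) (k13 Du).
have o23 := principal_orthogonal Du (pa_2 F) (pa_3 F) (k23 Du).
have p1 := patch_DX_pos Du (pa_t1 F).
have p2 := patch_DX_pos Du (pa_t2 F).
have p3 := patch_DX_pos Du (pa_t3 F).
have fM : row_free M.
  rewrite -kermx_eq0; apply/rowV0P => z /sub_kermxP.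
  have [a [b [d ->]]] := spl z => E; rewrite decomp in E.
  have E0 : a 0 0 *: 'D_t1 X u + b 0 0 *: 'D_t2 X u + d 0 0 *: 'D_t3 X u = 0.
    by rewrite -(derive_comb _ _ _ _ _ _ (dX Du)) E derive0.
  have [h1 [h2 h3]] := independent_aux o12 o13 o23 p1 p2 p3 E0.
  have a0 : a = 0 by apply/rowP => i; rewrite !ord1 mxE.
  have b0 : b = 0 by apply/rowP => i; rewrite !ord1 mxE.
  have d0 : d = 0 by apply/rowP => i; rewrite !ord1 mxE.
  by rewrite a0 b0 d0 !row_mx0.
have uM : (M : 'M[R]_3) \in unitmx by rewrite -row_free_unit.
have [a [b [d Ew]]] := spl (w *m invmx (M : 'M[R]_3)).
exists (a 0 0), (b 0 0), (d 0 0).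
by rewrite -decomp -Ew mulmxKV.
Qed.

End AtPatchPoint.

(** On a principal direction [t] of curvature [k], [d sg (t) = - k dh(t)]; and [dh] vanishes on
    the directions of [k2] and [k3]. *)
Lemma patch_dsg u w : D u -> 'D_w sg u = - (k1 u * 'D_w h u).
Proof.
move=> Du; have [t1 [t2 [t3 F]]] := pframes Du.
have [a1 [a2 [a3 ->]]] := patch_span Du F w.
rewrite (derive_comb _ _ _ _ _ _ (dsg Du)) (derive_comb _ _ _ _ _ _ (dh Du)).
have H k t : weingarten k u t -> 'D_t sg u = - (k * 'D_t h u).
  move=> wt; rewrite (derive_sg t Du) (derive_h t Du) wt.
  have X5 := patch_X5 Du; rewrite lor_e5 in X5.
  move: X5; rewrite -/(X0 u); move: ('D_t X u) (X0 u) => a z z5.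
  by rewrite !mxE z5 mulr0 subr0.
rewrite (H _ _ (pa_1 F)) (H _ _ (pa_2 F)) (H _ _ (pa_3 F)).
rewrite (patch_h2 Du F) (patch_h3 Du F) /GRing.scale /=; ring.
Qed.

(** Locally [k1] is the quotient of two derivatives along a fixed vector on which [dh] does not
    vanish. *)
Lemma smooth_k1 : smooth_on D k1.
Proof.
move=> k; apply: Ck_on_local => u Du; have [t1 [t2 [t3 F]]] := pframes Du.
have h0 := patch_h1_pos Du F.
have ch : {for u, continuous ('D_t1 h)}.
  exact: Ck_on_cont (smooth_derive t1 smooth_h 0) Du.
have /cvgr_gt/(_ _ h0) N := ch.
have [U [oU Uu HU]] : exists U : set V, [/\ open U, U u &
    forall q, U q -> D q /\ 0 < 'D_t1 h q].
  have : nbhs u [set q | D q /\ 0 < 'D_t1 h q].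
    by apply: filterI; [exact: open_nbhs_nbhs|exact: N].
  by rewrite nbhsE => -[U [oU Uu] HU]; exists U; split.
exists U; first exact: open_nbhs_nbhs.
exists (fun q => - 'D_t1 sg q / 'D_t1 h q); split.
  apply: (Ck_onM oU).
    by apply: (Ck_onN oU); apply: (Ck_on_sub _ (smooth_derive t1 smooth_sg k)) => q /HU[].
  apply: (Ck_onV oU); first by move=> q /HU[_ /lt0r_neq0].
  by apply: (Ck_on_sub _ (smooth_derive t1 smooth_h k)) => q /HU[].
move=> q /HU[Dq hq]; rewrite (patch_dsg t1 Dq) opprK mulfK//.
exact: lt0r_neq0.
Qed.

Let dk1 u : D u -> differentiable k1 u. Proof. exact: smooth_diff smooth_k1. Qed.

(** Symmetry of the second derivatives of [sg] and [h] in [d sg = - k1 dh]. *)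
Lemma patch_dk1 u : D u -> exists l, forall w, 'D_w k1 u = l * 'D_w h u.
Proof.
move=> Du; have [t1 [t2 [t3 F]]] := pframes Du.
exists ('D_t1 k1 u / 'D_t1 h u) => w.
have E x y : 'D_y ('D_x sg) u = - ('D_y k1 u * 'D_x h u + k1 u * 'D_y ('D_x h) u).
  have dDh : differentiable ('D_x h) u := smooth_diff (smooth_derive x smooth_h) Du.
  rewrite (derive_eq_on y oD Du (fun q Dq => patch_dsg x Dq)).
  have dM := differentiableM (dk1 Du) dDh.
  apply: etrans (_ : _ = 'D_y (fun q => 0 - k1 q * 'D_x h q) u) _.
    by apply: (derive_eq_on y oD Du) => q _; rewrite sub0r.
  rewrite (deriveB2 y (differentiable_cst (0 : R) u) dM) derive_cst sub0r.
  by rewrite (deriveM2 y (dk1 Du) dDh).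
have S1 := schwarz w t1 oD (smooth_sg 2) Du.
have S2 := schwarz w t1 oD (smooth_h 2) Du.
rewrite (E t1 w) (E w t1) S2 in S1.
have h0 := lt0r_neq0 (patch_h1_pos Du F).
exact: dk1_aux S1.
Qed.

Definition proportional (f : V -> R) u := exists l, forall w, 'D_w f u = l * 'D_w h u.

Lemma proportional_comp1 (phi : R -> R) (f : V -> R) u : differentiable f u ->
  differentiable phi (f u) -> proportional f u -> proportional (phi \o f) u.
Proof.
move=> df dphi [l lf]; exists (l * 'D_1 phi (f u)) => w.
by rewrite (derive_comp1 w df dphi) lf /GRing.scale /= mulrAC.
Qed.

Lemma proportionalM (f g : V -> R) u : differentiable f u -> differentiable g u ->
  proportional f u -> proportional g u -> proportional (fun q => f q * g q) u.
Proof.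
move=> df dg [l lf] [k kg]; exists (l * g u + f u * k) => w.
by rewrite (deriveM2 w df dg) lf kg; ring.
Qed.

Lemma proportional_eq (f g : V -> R) u : D u -> (forall q, D q -> f q = g q) ->
  proportional f u -> proportional g u.
Proof.
by move=> Du fg [l lf]; exists l => w; rewrite -lf; apply/esym/(derive_eq_on w oD Du).
Qed.

Lemma patch_sg_lt1 u : D u -> 0 < 1 - sg u * sg u.
Proof.
move=> Du; have [t1 [t2 [t3 F]]] := pframes Du.
by rewrite -(patch_h1 Du F); exact: patch_h1_pos F.
Qed.

Let rfun (y : R) : R := (Num.sqrt (1 - y * y))^-1.
Lemma smooth_rfun : smooth_on [set y : R | 0 < 1 - y * y] rfun.
Proof.
move=> k; have oE : open [set y : R | 0 < 1 - y * y].
  have d (y : R) : differentiable (fun y : R => 1 - y * y) y.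
    have dy : differentiable (fun y : R => y) y by [].
    exact: (differentiableB (differentiable_cst (1 : R) y) (differentiableM dy dy)).
  apply: (@open_comp _ _ (fun y : R => 1 - y * y) [set z : R | 0 < z]); last exact: open_pos.
  by move=> y _; apply: differentiable_continuous; exact: d.
apply: (Ck_onV oE); first by move=> y /= y0; rewrite gt_eqF// sqrtr_gt0.
apply: (Ck_on_sqrt oE) => //.
apply: (Ck_onB oE); first exact: Ck_on_cst.
by apply: (Ck_onM oE); exact: Ck_on_id.
Qed.

Lemma smooth_r : smooth_on D r.
Proof.
move=> k; apply: (Ck_on_comp1 oD (f := sg) (g := rfun) _ (smooth_rfun k) (smooth_sg k)).
by move=> u Du /=; exact: patch_sg_lt1.
Qed.

Let dr u : D u -> differentiable r u. Proof. exact: smooth_diff smooth_r. Qed.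

Lemma proportional_sg u : D u -> proportional sg u.
Proof. by move=> Du; exists (- k1 u) => w; rewrite patch_dsg// mulNr. Qed.

Lemma proportional_r u : D u -> proportional r u.
Proof.
move=> Du; apply: (@proportional_comp1 rfun sg) (proportional_sg Du).
  exact: dsg.
by apply: smooth_diff smooth_rfun _; exact: patch_sg_lt1.
Qed.

Lemma smooth_fk (f : R -> R) (sf : smooth_on Dk f) : smooth_on D (f \o k1).
Proof. by move=> k; exact: (Ck_on_comp1 oD k1Dk (sf k) (smooth_k1 k)). Qed.

Lemma smooth_kr (k : V -> R) (f : R -> R) : smooth_on Dk f -> (forall u, D u -> k u = f (k1 u)) ->
  smooth_on D (fun u => k u * r u) /\ forall u, D u -> proportional (fun u => k u * r u) u.
Proof.
move=> sf kf.
have sfk := smooth_fk sf.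
split=> [j|u Du].
  apply: (Ck_on_eq oD (f := fun u => (f \o k1) u * r u)).
    by move=> q Dq; rewrite kf.
  by apply: (Ck_onM oD); [exact: sfk|exact: smooth_r].
apply: (@proportional_eq (fun u => (f \o k1) u * r u)) => //.
  by move=> q Dq; rewrite kf.
apply: proportionalM; [exact: smooth_diff sfk Du|exact: dr| |exact: proportional_r].
apply: proportional_comp1; [exact: dk1| |exact: patch_dk1].
exact: smooth_diff sf (k1Dk Du).
Qed.

Lemma smooth_c : smooth_on D c.
Proof. by move=> k; apply: (Ck_onM oD); [exact: smooth_sg|exact: smooth_r]. Qed.

Lemma proportional_c u : D u -> proportional c u.
Proof.
move=> Du; apply: proportionalM; [exact: dsg|exact: dr|exact: proportional_sg|].
exact: proportional_r.
Qed.

Lemma smooth_xi : smooth_on D xi.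
Proof.
move=> k; apply: (Ck_onZ oD); first exact: smooth_r.
apply: (Ck_onB oD); last exact: sn.
by apply: (Ck_onZ oD); [exact: smooth_sg|exact: Ck_on_cst].
Qed.

Lemma r_sqr u : D u -> r u * r u * (1 - sg u * sg u) = 1.
Proof.
move=> Du; have p := patch_sg_lt1 Du.
rewrite /r /tilt -invfM -expr2 sqr_sqrtr ?ltW// mulVf//.
exact: lt0r_neq0.
Qed.

Lemma derive_r u w : D u -> 'D_w r u = r u * r u * r u * sg u * 'D_w sg u.
Proof.
move=> Du.
have drr := differentiableM (dr Du) (dr Du).
have dss := differentiableM (dsg Du) (dsg Du).
have d1 : differentiable (fun u => 1 - sg u * sg u) u.
  exact: (differentiableB (differentiable_cst (1 : R) u) dss).
have := derive_on_cst w oD Du r_sqr.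
rewrite (deriveM2 w drr d1) (deriveM2 w (dr Du) (dr Du)).
rewrite (deriveB2 w (differentiable_cst (1 : R) u) dss) derive_cst (deriveM2 w (dsg Du) (dsg Du)).
rewrite sub0r => H; exact: derive_r_aux H (r_sqr Du).
Qed.

Lemma derive_xi u w : D u -> 'D_w xi u =
  (r u * r u * r u * sg u * 'D_w sg u) *: (sg u *: e5 - n u) +
  r u *: ('D_w sg u *: e5 - 'D_w n u).
Proof.
move=> Du; have de : differentiable (fun=> e5 : E5) u by exact: differentiable_cst.
have [d1 _] := differentiable_scale (dsg Du) de.
have d2 : differentiable (fun u => sg u *: e5 - n u) u by exact: (differentiableB d1 (dn Du)).
rewrite (deriveZ2 w (dr Du) d2) (deriveB2 w d1 (dn Du)) (deriveZ2 w (dsg Du) de).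
by rewrite derive_cst scaler0 addr0 derive_r.
Qed.

Lemma patch_xixi u : D u -> lor (xi u) (xi u) = 1.
Proof.
move=> Du; have Rq := r_sqr Du; have nn := hnn Du; have ne := patch_ne5 u.
rewrite xiE !lorD lor_e55 (lorC e5) nn ne -[RHS]Rq; ring.
Qed.

Lemma patch_Xxi u : D u -> lor (X0 u) (xi u) = 0.
Proof.
move=> Du; have nX := hn1 Du; have X5 := patch_X5 Du; rewrite -/(X0 u) in nX.
by rewrite xiE !lorD X5 (lorC (X0 u)) nX; ring.
Qed.

Let patch_xi5 u : D u -> lor (xi u) e5 = 0.
Proof. by move=> _; exact: horizontal5. Qed.

(** Along the principal directions orthogonal to [T], [xi] varies as [n] does, rescaled by [r];
    along [T] the pair [(X0, xi)] undergoes an infinitesimal hyperbolic rotation. *)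
Lemma patch_principal_frame u t1 t2 t3 : D u -> patch_frame u t1 t2 t3 ->
  principal_frame X0 xi h c m2 m3 u t1 t2 t3.
Proof.
move=> Du F; have Rq := r_sqr Du.
have h1 := patch_h1 Du F; have h2 := patch_h2 Du F; have h3 := patch_h3 Du F.
have hX t : ('D_t X u) 0 4 = 'D_t h u by rewrite (derive_h t Du).
have Dt k t : weingarten k u t -> 'D_t h u = 0 ->
    'D_t X0 u = 'D_t X u /\ 'D_t xi u = (k * r u) *: 'D_t X0 u.
  move=> wt ht.
  have E : 'D_t X0 u = 'D_t X u by rewrite (derive_X0 t Du) hX ht scale0r subr0.
  split=> //; rewrite (derive_xi t Du) (patch_dsg t Du) ht E wt hX ht.
  move: ('D_t X u) (nu (X u)) (n u) => a z nv.
  by apply/rowP => i; rewrite !mxE; ring.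
have [e2 x2] := Dt _ _ (pa_2 F) h2; have [e3 x3] := Dt _ _ (pa_3 F) h3.
apply: PrincipalFrame.
- exact: lt0r_neq0 (patch_h1_pos Du F).
- exact: h2.
- exact: h3.
- rewrite (derive_X0 t1 Du) hX h1 (pa_T F) -/(sg u) xiE /c.
  rewrite scalerA.
  have -> : sg u * r u * (1 - sg u * sg u) * r u = sg u.
    by transitivity ((r u * r u * (1 - sg u * sg u)) * sg u); [ring|rewrite Rq mul1r].
  move: (n u) (sg u) => nv s; apply/rowP => i; rewrite !mxE; ring.
- rewrite (derive_xi t1 Du) (patch_dsg t1 Du) h1 (pa_1 F) hX h1 (pa_T F) -/(sg u) -/(X0 u) /c.
  move: (n u) (X0 u) (sg u) (r u) (k1 u) Rq => nv z s y k Rq.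
  exact: xi1_aux.
- exact: x2.
- exact: x3.
- by rewrite e2 e3; exact: principal_orthogonal Du (pa_2 F) (pa_3 F) (k23 Du).
- by rewrite e2; exact: patch_DX_pos Du (pa_t2 F).
- by rewrite e3; exact: patch_DX_pos Du (pa_t3 F).
- exact: patch_span Du F.
Qed.

Lemma proportional_choice (f : V -> R) : (forall u, D u -> proportional f u) ->
  exists f', forall u, D u -> forall w, 'D_w f u = f' u * 'D_w h u.
Proof.
move=> pf; have H u : exists l, D u -> forall w, 'D_w f u = l * 'D_w h u.
  have [Du|nDu] := pselect (D u); first by have [l Hl] := pf u Du; exists l.
  by exists 0.
by have [f' Hf] := choice H; exists f'.
Qed.

Let sm2 : smooth_on D m2. Proof. exact: (smooth_kr sf1 rel2).1. Qed.
Let sm3 : smooth_on D m3. Proof. exact: (smooth_kr sf2 rel3).1. Qed.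
Let pm2 u : D u -> proportional m2 u. Proof. exact: (smooth_kr sf1 rel2).2. Qed.
Let pm3 u : D u -> proportional m3 u. Proof. exact: (smooth_kr sf2 rel3).2. Qed.

Lemma patch_r_gt0 u : D u -> 0 < r u.
Proof. by move=> Du; rewrite /r /tilt invr_gt0 sqrtr_gt0 patch_sg_lt1. Qed.

Let m23 u : D u -> m2 u != m3 u.
Proof.
move=> Du; have r0 := lt0r_neq0 (patch_r_gt0 Du).
by apply: contraNneq (k23 Du) => H; apply/eqP; exact: (mulIf r0 H).
Qed.

Let frames u : D u -> exists t1 t2 t3, principal_frame X0 xi h c m2 m3 u t1 t2 t3.
Proof.
move=> Du; have [t1 [t2 [t3 F]]] := pframes Du.
by exists t1, t2, t3; exact: patch_principal_frame.
Qed.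

Lemma patch_product u : D u -> k2 u * k3 u = 1 - sg u * sg u.
Proof.
move=> Du; have [m2' dm2] := proportional_choice pm2.
have [m3' dm3] := proportional_choice pm3.
have := principal_product oD smooth_X0 smooth_xi smooth_h smooth_c patch_XX patch_xixi
  patch_Xxi patch_X5 patch_xi5 proportional_c sm2 sm3 dm2 dm3 m23 frames Du.
rewrite /m2 /m3 => H.
transitivity (k2 u * k3 u * (r u * r u * (1 - sg u * sg u))); first by rewrite r_sqr// mulr1.
by transitivity ((k2 u * r u * (k3 u * r u)) * (1 - sg u * sg u)); [ring|rewrite H mul1r].
Qed.

Lemma patch_m2_neq1 u : D u -> 1 - m2 u ^+ 2 != 0.
Proof.
move=> Du; have [m2' dm2] := proportional_choice pm2.
have [m3' dm3] := proportional_choice pm3.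
exact: (principal_sqr_neq1 oD smooth_X0 smooth_xi smooth_h smooth_c patch_XX patch_xixi
  patch_Xxi patch_X5 patch_xi5 proportional_c sm2 sm3 dm2 dm3 m23 frames Du).
Qed.

Lemma patch_riccati u w : D u -> 'D_w m2 u = c u * (1 - m2 u ^+ 2) * 'D_w h u.
Proof.
move=> Du; have [m2' dm2] := proportional_choice pm2.
have [t1 [t2 [t3 F]]] := frames Du.
by rewrite (dm2 u Du) (riccati oD smooth_X0 smooth_xi smooth_h smooth_c
  proportional_c sm2 sm3 dm2 m23 frames Du F).
Qed.

(** Near [u], the form of [m3] applied to the fixed vector [t] is a nonzero multiple of the
    second principal direction, so any principal direction for [k2] may take its place. *)
Lemma plane_form_locally_constant u t : D u -> t != 0 -> weingarten (k2 u) u t ->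
  \forall q \near u, forall t', t' != 0 -> weingarten (k2 q) q t' ->
    forall v, plane_form (X q) (n q) (k2 q) ('D_t' X q) v =
      plane_form (X u) (n u) (k2 u) ('D_t X u) v.
Proof.
move=> Du t0 wt; have [m2' dm2] := proportional_choice pm2.
have [m3' dm3] := proportional_choice pm3.
have frame q t' : D q -> t' != 0 -> weingarten (k2 q) q t' -> exists t1 t3,
    principal_frame X0 xi h c m2 m3 q t1 t' t3 /\ 'D_t' X0 q = 'D_t' X q.
  move=> Dq t'0 wt'; have [t1 [t2 [t3 [h1 _ h3 hT w1 _ w3]]]] := pframes Dq.
  have F := PatchFrame h1 t'0 h3 hT w1 wt' w3.
  exists t1, t3; split; first exact: patch_principal_frame.
  by rewrite (derive_X0 t' Dq) -(derive_h t' Dq) (patch_h2 Dq F) scale0r subr0.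
pose FF := principal_form X0 xi h c m3.
have [t1 [t3 [F Ft]]] := frame u t Du t0 wt.
have E0 : FF t u = (m2 u - m3 u) *: 'D_t X u by rewrite /FF (form2 F) Ft.
have N0 : lor (FF t u) (FF t u) != 0.
  rewrite E0 lorZl lorZr !mulf_neq0 ?subr_eq0 ?m23//.
  exact: lt0r_neq0 (patch_DX_pos Du t0).
have H := plane_quadratic_locally_constant oD smooth_X0 smooth_xi smooth_h smooth_c patch_XX patch_xixi
  patch_Xxi patch_X5 patch_xi5 proportional_c sm2 sm3 dm2 dm3 m23 frames Du N0.
have ND : nbhs u D by exact: open_nbhs_nbhs.
have HN : nbhs u [set q | (lor (FF t q) (FF t q) != 0 /\
    forall v, plane_quadratic X0 xi h c m2 m3 t v q = plane_quadratic X0 xi h c m2 m3 t v u) /\ D q].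
  exact: filterI H ND.
apply: filterS HN => q [[Nq Hq] Dq] t' t'0 wt' v.
have [s1 [s3 [Fq Fqt]]] := frame q t' Dq t'0 wt'.
have [a1 [a2 [a3 Et]]] := pf_span Fq t.
have Eq : FF t q = (a2 * (m2 q - m3 q)) *: 'D_t' X q.
  rewrite /FF Et.
  apply: etrans (form_comb c smooth_X0 smooth_xi smooth_h m3 a1 a2 a3 s1 t' s3 Dq) _.
  rewrite (form1 Fq) (form2 Fq) (form3 Fq) Fqt; exact: b0_aux.
have a0 : a2 * (m2 q - m3 q) != 0.
  move: Nq; rewrite -/FF Eq; apply: contraNneq => ->; by rewrite scale0r lor0l.
transitivity (plane_form (X q) (n q) (k2 q) (FF t q) v); first by rewrite Eq plane_formZ.
transitivity (plane_form (X u) (n u) (k2 u) (FF t u) v); first exact: Hq.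
by rewrite E0 plane_formZ// subr_eq0 m23.
Qed.

End Patch.

(** * Functions whose differential is proportional to that of the height *)

Section LevelCurve.
Context {R : realType} {n : nat}.
Notation V := 'rV[R]_n.
Variables (h : V -> R) (D : set V) (u0 w : V).
Hypotheses (oD : open D) (sh : smooth_on D h) (Du0 : D u0) (hw : 'D_w h u0 != 0).

Let dh u : D u -> differentiable h u. Proof. exact: smooth_diff. Qed.
Let L : {linear V -> R} := 'd h u0.
Let LE v : L v = 'D_v h u0. Proof. by rewrite deriveE//; exact: dh. Qed.
Let cL : continuous L. Proof. exact: diff_continuous (dh Du0). Qed.
Let b : V := (L w)^-1 *: w.
Let Lb : L b = 1. Proof. by rewrite linearZ /= LE /GRing.scale /= mulVf. Qed.
Let Psi (u : V) : V := u + (h u - L u) *: b.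

Lemma straighten_height u : L (Psi u) = h u.
Proof. by rewrite /Psi linearD linearZ /= Lb /GRing.scale /= mulr1 subrKC. Qed.

Lemma straighten_smooth : smooth_on D Psi.
Proof.
move=> k; apply: (Ck_onD oD); first exact: Ck_on_id.
apply: (Ck_onZ oD); last exact: Ck_on_cst.
apply: (Ck_onB oD); first exact: sh.
exact: Ck_on_sub (Ck_on_lin k cL).
Qed.

Lemma straighten_jacobian : 'J Psi u0 \in unitmx.
Proof.
have dL : differentiable L u0 := smooth_diff (fun k => Ck_on_lin k cL) (I : setT u0).
have dhL : differentiable (fun u => h u - L u) u0 by exact: (differentiableB (dh Du0) dL).
have db : differentiable (fun=> b : V) u0 by exact: differentiable_cst.
have [dsb _] := differentiable_scale dhL db.
have did : differentiable (fun u : V => u) u0 by [].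
have dP : differentiable Psi u0 := differentiableD did dsb.
suff -> : 'J Psi u0 = 1%:M by exact: unitmx1.
apply/row_matrixP => i; rewrite !rowE mulmx1 -(deriveEjacobian _ dP).
set v := delta_mx 0 i.
rewrite /Psi (deriveD2 v did dsb) (deriveZ2 v dhL db) (deriveB2 v (dh Du0) dL) derive_cst scaler0 addr0.
have -> : 'D_v L u0 = L v by rewrite (deriveE v dL) (diff_lin u0 cL).
by rewrite derive_id -LE subrr scale0r addr0.
Qed.

(** [Psi] is a local diffeomorphism that makes [h] linear. In the new coordinates the level
    sets are affine, so a function whose differential is proportional to [dh] is constant on
    them, and a straight line transversal to them gives [gam]. *)
Lemma level_curve : exists (gam : R -> V) (U : set R),
  [/\ open U, U (h u0), smooth_on U gam,
      (forall t, U t -> D (gam t) /\ h (gam t) = t) &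
      forall f : V -> R, (forall u, D u -> differentiable f u) ->
        (forall u, D u -> exists l, forall v, 'D_v f u = l * 'D_v h u) ->
        \forall u \near u0, U (h u) /\ f u = f (gam (h u))].
Proof.
have ex := inverse_function oD straighten_smooth Du0 straighten_jacobian.
have [r [r0 [G [BD oOm GK sG]]]] := filter_ex (filterI (nbhs_right_gt (0 : R)) ex).
set Om := Psi @` ball u0 r in oOm sG.
have Bu0 : ball u0 r u0 by exact: ballxx.
have Omy0 : Om (Psi u0) by exists u0.
have /nbhs_ballP[e /= e0 He] : nbhs (Psi u0) Om by exact: open_nbhs_nbhs.
pose ell (t : R) : V := Psi u0 + (t - h u0) *: b.
have sell k (E : set R) : open E -> Ck_on k E ell.
  move=> oE; apply: (Ck_onD oE); first exact: Ck_on_cst.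
  apply: (Ck_onZ oE); last exact: Ck_on_cst.
  by apply: (Ck_onB oE); [exact: Ck_on_id|exact: Ck_on_cst].
have cell : continuous ell.
  by move=> t; exact: (Ck_on_cont (sell 0%N setT openT) (I : setT t)).
pose U : set R := ell @^-1` ball (Psi u0) e.
have oU : open U by apply: open_comp => [t _|]; [exact: cell|exact: ball_open].
have ell0 : ell (h u0) = Psi u0 by rewrite /ell subrr scale0r addr0.
have Uh0 : U (h u0) by rewrite /U /= ell0; exact: ballxx.
have Lell t : L (ell t) = t.
  rewrite /ell linearD linearZ /= Lb straighten_height /GRing.scale /= mulr1.
  by rewrite subrKC.
have gamE t : U t -> exists2 u, ball u0 r u & Psi u = ell t /\ G (ell t) = u.
  by move=> /He [u Bu E]; exists u => //; split=> //; rewrite -E GK.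
exists (G \o ell), U; split.
- exact: oU.
- exact: Uh0.
- by move=> k; apply: (Ck_on_comp oU (fun t Ut => He _ Ut) (sG k)); exact: sell.
- move=> t Ut; have [u Bu [E1 E2]] := gamE t Ut; rewrite /= E2; split; first exact: BD.
  by rewrite -straighten_height E1 Lell.
move=> f df pf.
have cPsi : {for u0, continuous Psi} := Ck_on_cont (straighten_smooth 0%N) Du0.
have ch : {for u0, continuous h} := Ck_on_cont (sh 0%N) Du0.
have N1 : nbhs u0 (Psi @^-1` ball (Psi u0) e) by apply: cPsi; exact: nbhsx_ballx.
have N2 : nbhs u0 (h @^-1` U) by apply: ch; exact: open_nbhs_nbhs.
have N3 : nbhs u0 (ball u0 r) by exact: nbhsx_ballx.
apply: filterS (filterI (filterI N1 N2) N3) => u [[Pu Uu] Bu]; split; first exact: Uu.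
rewrite -{1}(GK u Bu) /=.
set y := Psi u; set z := ell (h u).
have seg (s : R) : 0 <= s <= 1 -> ball (Psi u0) e (y + s *: (z - y)).
  move=> /andP[s0 s1]; move: Pu Uu; rewrite /U /= -/y -/z -!ball_normE /= => yB zB.
  have -> : Psi u0 - (y + s *: (z - y)) = (1 - s) *: (Psi u0 - y) + s *: (Psi u0 - z).
    by apply/rowP => i; rewrite !mxE; ring.
  rewrite (le_lt_trans (ler_normD _ _))// !normrZ (ger0_norm s0) ger0_norm ?subr_ge0//.
  have [->|sn1] := eqVneq s 1; first by rewrite subrr mul0r add0r mul1r.
  have s1' : 0 < 1 - s by rewrite subr_gt0 lt_neqAle sn1.
  have : (1 - s) * `|Psi u0 - y| < (1 - s) * e by rewrite ltr_pM2l.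
  have : s * `|Psi u0 - z| <= s * e by rewrite ler_wpM2l// ltW.
  lra.
have dG q : Om q -> differentiable G q := smooth_diff sG.
have DG q : Om q -> D (G q) by case=> v Bv <-; rewrite GK//; exact: BD.
have dfG q : Om q -> differentiable (f \o G) q.
  by move=> Oq; apply: (differentiable_comp (dG _ Oq)); exact: df (DG _ Oq).
have [s s01] := mvt_line (@ltr01 R) (fun s Hs => dfG _ (He _ (seg s Hs))).
have Oq := He _ (seg s s01); set q := y + s *: (z - y) in Oq *.
rewrite (derive_comp _ (dG _ Oq) (df _ (DG _ Oq))).
have [l ->] := pf _ (DG _ Oq).
rewrite -(derive_comp _ (dG _ Oq) (dh (DG _ Oq))).
have -> : 'D_(z - y) (h \o G) q = 0.
  rewrite (derive_eq_on (g := L) _ oOm Oq); last first.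
    by move=> _ [v Bv <-] /=; rewrite GK// straighten_height.
  rewrite deriveE; last exact: smooth_diff (fun k => Ck_on_lin k cL) (I : setT q).
  by rewrite diff_lin// linearB /z Lell /y straighten_height subrr.
by rewrite !mulr0 scale1r subrKC => /eqP; rewrite subr_eq0 => /eqP /esym.
Qed.
End LevelCurve.

(** * Continuation over a connected space *)

Lemma locally_constant_connected (M : topologicalType) (P : M -> Prop) (p0 : M) :
  connected [set: M] ->
  (forall p : M, exists2 U : set M, nbhs p U & forall q q', U q -> U q' -> P q -> P q') ->
  P p0 -> forall p, P p.
Proof.
move=> cM loc P0 p; suff -> : P p = setT p by [].
suff <- : [set p | P p] = setT by [].
apply: cM; first by exists p0.
- exists [set p | P p]; last by rewrite setTI.
  rewrite openE => q /= Pq; rewrite /interior /=; have [U Uq HU] := loc q.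
  by apply: (filterS _ Uq) => q' Uq'; exact: (HU q q' (nbhs_singleton Uq)).
- exists [set p | P p]; last by rewrite setTI.
  rewrite -[X in closed X]setCK; apply: open_closedC; rewrite openE => q /= Pq.
  rewrite /interior /=; have [U Uq HU] := loc q.
  apply: (filterS _ Uq) => q' Uq' /= Pq'; apply: Pq; exact: (HU q' q Uq' (nbhs_singleton Uq)).
Qed.

Section Continuation.
Context {R : realType} {M : topologicalType} {Y : Type}.
Variables (sol : (R -> Y) -> R -> Prop) (h : M -> R) (K : M -> Y).
Hypothesis sol_local : forall f g t, (\forall s \near t, f s = g s) -> sol f t -> sol g t.
Hypothesis sol_unique : forall f g (J : set R) t0, open J -> is_interval J -> J t0 ->
  (forall t, J t -> sol f t) -> (forall t, J t -> sol g t) ->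
  (\forall t \near t0, f t = g t) -> forall t, J t -> f t = g t.
Hypothesis ch : continuous h.
Hypothesis cM : connected [set: M].
Hypothesis germ : forall p, exists f (U : set R), [/\ open U, is_interval U, U (h p),
  (forall t, U t -> sol f t) & \forall q \near p, K q = f (h q)].
Hypothesis h_open : forall p (N : set M), nbhs p N -> nbhs (h p) (h @` N).

Lemma intervalI (I J : set R) : is_interval I -> is_interval J -> is_interval (I `&` J).
Proof.
move=> iI iJ x y [Ix Jx] [Iy Jy] z xzy; split; first exact: iI xzy.
exact: iJ xzy.
Qed.

Lemma intervalU (I J : set R) t : is_interval I -> is_interval J -> I t -> J t ->
  is_interval (I `|` J).
Proof.
move=> iI iJ It Jt x y xIJ yIJ z /andP[xz zy].
have [zt|/ltW tz] := leP z t.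
  by case: xIJ => Hx; [left; apply: (iI x t) => //; rewrite xz zt|
    right; apply: (iJ x t) => //; rewrite xz zt].
by case: yIJ => Hy; [left; apply: (iI t y) => //; rewrite tz zy|
  right; apply: (iJ t y) => //; rewrite tz zy].
Qed.

(** [Js] is the union of the intervals that carry a solution with the germ at [p0], and [F] is
    the common extension of these solutions. The points of the space where [K] has the germ of
    [F \o h] form a clopen set: if such points accumulate at [p], the solution at [p] extends
    [F], and maximality of [Js] makes it a restriction of [F]. *)
Lemma unique_continuation (p0 : M) : exists f (J : set R),
  [/\ open J, is_interval J, (forall t, J t -> sol f t) &
      forall q, J (h q) /\ K q = f (h q)].
Proof.
have [f0 [U0 [oU0 iU0 U0p sU0 K0]]] := germ p0.
set t0 := h p0 in U0p.
pose ext (J : set R) (f : R -> Y) := [/\ open J, is_interval J, J t0,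
  (forall t, J t -> sol f t) & \forall s \near t0, f s = f0 s].
have ext0 : ext U0 f0 by split=> //; exact: filterE.
have agree J f J' f' : ext J f -> ext J' f' -> forall t, J t -> J' t -> f t = f' t.
  move=> [oJ iJ Jt sJ eJ] [oJ' iJ' Jt' sJ' eJ'] t t1 t2.
  apply: (sol_unique (J := J `&` J') (t0 := t0)); try by [].
  - exact: openI.
  - exact: intervalI.
  - by move=> s [Js _]; exact: sJ.
  - by move=> s [_ Js]; exact: sJ'.
  by apply: filterS (filterI eJ eJ') => s [-> ->].
have ex t : exists y, forall J f, ext J f -> J t -> f t = y.
  have [[J [f [E Jt]]]|nE] := pselect (exists J f, ext J f /\ J t).
    by exists (f t) => J' f' E' Jt'; exact: agree E' E t Jt' Jt.
  by exists (f0 t) => J f E Jt; exfalso; apply: nE; exists J, f.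
have [F HF] := choice ex.
pose Js : set R := [set t | exists J f, ext J f /\ J t].
have sub J f : ext J f -> J `<=` Js by move=> E t Jt; exists J, f.
have near_open (J : set R) t : open J -> J t -> nbhs t J by move=> oJ Jt; exact: open_nbhs_nbhs.
have FE J f t : ext J f -> J t -> \forall s \near t, f s = F s.
  move=> E Jt; have [oJ _ _ _ _] := E; apply: filterS (near_open _ _ oJ Jt) => s Js'.
  exact: HF Js'.
have extS : ext Js F.
  split.
  - rewrite openE => t [J [f [E Jt]]]; rewrite /interior /=; have [oJ _ _ _ _] := E.
    exact: filterS (sub _ _ E) (near_open _ _ oJ Jt).
  - move=> x y [J [f [E Jx]]] [J' [f' [E' Jy]]] z /andP[xz zy].
    have [_ iJ Jt _ _] := E; have [_ iJ' Jt' _ _] := E'.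
    have [zt|/ltW tz] := leP z t0.
      by apply: (sub _ _ E); apply: (iJ x t0) => //; rewrite xz zt.
    by apply: (sub _ _ E'); apply: (iJ' t0 y) => //; rewrite tz zy.
  - exact: sub ext0 _ U0p.
  - move=> t [J [f [E Jt]]]; have [_ _ _ sf _] := E.
    exact: sol_local (FE _ _ _ E Jt) (sf t Jt).
  - by apply: filterS (FE _ _ _ ext0 U0p) => s ->.
have [oJs iJs Jst0 sF eF] := extS.
exists F, Js; split=> //.
pose good p := Js (h p) /\ \forall q \near p, K q = F (h q).
suff H : forall q, good q by move=> q; have [h1 /nbhs_singleton h2] := H q.
apply: (@locally_constant_connected _ good p0) => //; last first.
  split; first exact: Jst0.
  have N : nbhs p0 (h @^-1` [set s | f0 s = F s]) by apply: ch; exact: FE ext0 U0p.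
  by apply: filterS (filterI K0 N) => q [-> /= ->].
move=> p; have [f [U [oU iU Up sU Kp]]] := germ p.
have NU : nbhs p (h @^-1` U) by apply: ch; exact: near_open.
pose W := [set q | U (h q) /\ \forall q' \near q, K q' = f (h q')].
exists W.
  have Kpp : nbhs p [set q | \forall q' \near q, K q' = f (h q')] by exact: nbhs_interior Kp.
  by apply: filterS (filterI NU Kpp) => q.
move=> q q' [Uq Kq] [Uq' Kq'] [Jq Gq].
have fF : \forall t \near h q, f t = F t.
  have N : nbhs q [set q | K q = f (h q) /\ K q = F (h q)] by exact: filterI Kq Gq.
  by apply: filterS (h_open N) => _ [z [e1 e2] <-]; rewrite -e1.
have fFU t : U t -> Js t -> f t = F t.
  move=> Ut Jt; apply: (sol_unique (J := U `&` Js) (t0 := h q)); try by [].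
  - exact: openI.
  - exact: intervalI.
  - by move=> s [Us _]; exact: sU.
  - by move=> s [_ Ss]; exact: sF.
pose g t := if `[< Js t >] then F t else f t.
have gF t : Js t -> F t = g t by move=> Jt; rewrite /g asboolT.
have gf t : U t -> f t = g t.
  by move=> Ut; rewrite /g; case: asboolP => // Jt; exact: fFU.
have extg : ext (Js `|` U) g.
  split.
  - exact: openU.
  - exact: intervalU Jq Uq.
  - by left.
  - move=> t [Jt|Ut].
      apply: sol_local (sF t Jt).
      by apply: filterS (near_open _ _ oJs Jt) => s; exact: gF.
    apply: sol_local (sU t Ut).
    by apply: filterS (near_open _ _ oU Ut) => s; exact: gf.
  - by apply: filterS (filterI (near_open _ _ oJs Jst0) eF) => s [Jt <-]; rewrite gF.
have UJ t : U t -> Js t by move=> Ut; apply: (sub _ _ extg); right.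
split; first exact: UJ.
have N : nbhs q' (h @^-1` U) by apply: ch; exact: near_open.
by apply: filterS (filterI Kq' N) => z [-> Uz]; apply: fFU => //; exact: UJ.
Qed.

End Continuation.

(** * Primitives and inverses on open intervals *)

Section Primitive.
Context {R : realType}.
Implicit Types (phi S F : R -> R) (J : set R).

Lemma is_derive_near_eq (f g : R -> R) (t l : R) : (\forall s \near t, f s = g s) ->
  is_derive t 1 f l -> is_derive t 1 g l.
Proof.
move=> fg [df ef]; have dfd : differentiable f t by apply/derivable1_diffP.
have dg : differentiable g t by exact: near_eq_differentiable fg dfd.
split; first by apply/derivable1_diffP.
by rewrite -ef; apply/esym/near_eq_derive.
Qed.

Lemma segment_primitive phi a b : a < b ->
  (forall t, a <= t <= b -> {for t, continuous phi}) ->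
  exists F, forall t, a < t < b -> is_derive t 1 F (phi t).
Proof.
move=> ab cphi.
pose F x := (\int[lebesgue_measure]_(t in [set` `[a, x]]) phi t)%R.
exists F => t /andP[at_ tb].
have ic : (@lebesgue_measure R).-integrable `[a, b] (EFin \o phi).
  apply: continuous_compact_integrable; first exact: segment_compact.
  apply/continuous_in_subspaceT => x; rewrite inE /= in_itv /=; exact: cphi.
have ct : {for t, continuous phi} by apply: cphi; rewrite !ltW.
have [d e] := continuous_FTC1_closed tb ic at_ ct.
by split; [exact: d|rewrite -[RHS]e derive1E].
Qed.

Lemma open_interval_margin J t : open J -> J t -> exists a b, [/\ J a, J b & a < t < b].
Proof.
move=> oJ Jt; have /nbhs_ballP[e /= e0 He] : nbhs t J by exact: open_nbhs_nbhs.
exists (t - e / 2), (t + e / 2); split.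
- apply: He; rewrite -ball_normE /= opprB addrCA subrr addr0 ger0_norm; lra.
- apply: He; rewrite -ball_normE /= opprD addrA subrr sub0r normrN ger0_norm; lra.
by apply/andP; split; lra.
Qed.

(** Primitives on segments around a base point, normalised there, agree on overlaps. *)
Lemma primitive phi J : open J -> is_interval J -> (forall t, J t -> {for t, continuous phi}) ->
  exists S, forall t, J t -> is_derive t 1 S (phi t).
Proof.
move=> oJ iJ cphi; have [[t0 J0]|nJ] := pselect (exists t, J t); last first.
  by exists (fun=> 0) => t Jt; exfalso; apply: nJ; exists t.
pose ext a b F := [/\ J a, J b, a < t0 < b, F t0 = 0 &
  forall t, a < t < b -> is_derive t 1 F (phi t)].
have ex t : exists y, forall a b F, ext a b F -> a < t < b -> F t = y.
  have [[a [b [F [E abt]]]]|nE] := pselect (exists a b F, ext a b F /\ a < t < b); last first.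
    by exists 0 => a b F E abt; exfalso; apply: nE; exists a, b, F.
  exists (F t) => a' b' F' E' abt'.
  have [_ _ /andP[h1 h2] F0 dF] := E; have [_ _ /andP[h1' h2'] F0' dF'] := E'.
  move/andP: abt => [h3 h4]; move/andP: abt' => [h3' h4'].
  have dd x y z : a < x -> a' < x -> y < b -> y < b' -> x <= z <= y ->
      is_derive z 1 (F' - F) 0.
    move=> ax ax' yb yb' /andP[xz zy]; rewrite -[0](subrr (phi z)).
    by apply: is_deriveB; [apply: dF'|apply: dF]; apply/andP; split; lra.
  have [tt|/ltW tt] := leP t0 t.
    have := zero_derive_const (fun z => dd t0 t z h1 h1' h4 h4') (t := t).
    rewrite tt lexx /= !fctE F0 F0' subrr => /(_ isT) /eqP.
    by rewrite subr_eq0 => /eqP.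
  have := zero_derive_const (fun z => dd t t0 z h3 h3' h2 h2') (t := t0).
  rewrite tt lexx /= !fctE F0 F0' subrr => /(_ isT) /esym /eqP.
  by rewrite subr_eq0 => /eqP.
have [S HS] := choice ex; exists S => t Jt.
have [a0 [b0 [Ja0 Jb0 /andP[a00 b00]]]] := open_interval_margin oJ J0.
have [a1 [b1 [Ja1 Jb1 /andP[a11 b11]]]] := open_interval_margin oJ Jt.
pose a := Num.min a0 a1; pose b := Num.max b0 b1.
have Ja : J a by rewrite /a; case: ltP.
have Jb : J b by rewrite /b; case: ltP.
have at0 : a < t0 by rewrite /a gt_min a00.
have att : a < t by rewrite /a gt_min a11 orbT.
have bt0 : t0 < b by rewrite /b lt_max b00.
have btt : t < b by rewrite /b lt_max b11 orbT.
have [F dF] := segment_primitive (lt_trans at0 bt0) (fun z Hz => cphi z (iJ _ _ Ja Jb z Hz)).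
pose G z := F z - F t0.
have dG z : a < z < b -> is_derive z 1 G (phi z).
  move=> Hz; rewrite -[phi z]subr0; apply: is_deriveB; first exact: dF.
have E : ext a b G by split=> //; [rewrite at0 bt0|rewrite /G subrr].
apply: is_derive_near_eq (dG t _); last by rewrite att btt.
have N : nbhs t [set z | a < z < b].
  have : nbhs t `]a, b[%classic by apply: open_nbhs_nbhs; split=> //=; rewrite in_itv /= att btt.
  by apply: filterS => z /=; rewrite in_itv.
by apply: (filterS _ N) => z Hz; exact: HS E Hz.
Qed.

Section Inverse.
Variables (S phi psi : R -> R) (J : set R).
Hypotheses (oJ : open J) (iJ : is_interval J).
Hypothesis dS : forall t, J t -> is_derive t 1 S (phi t).
Hypothesis phi_gt0 : forall t, J t -> 0 < phi t.

Let cS t : J t -> {for t, continuous S}. Proof. by move=> /dS /is_derive_cont. Qed.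

Lemma increasing_on x y : J x -> J y -> x < y -> S x < S y.
Proof.
move=> Jx Jy xy; have [|c /andP[xc cy] E] := @mvt_seg R S phi x y (ltW xy).
  by move=> t Ht; apply: dS; exact: iJ Ht.
rewrite -subr_gt0 E mulr_gt0 ?subr_gt0//; apply: phi_gt0.
by apply: (iJ Jx Jy); rewrite xc cy.
Qed.

Lemma increasing_inj x y : J x -> J y -> S x = S y -> x = y.
Proof.
move=> Jx Jy E; have [xy|xy|//] := ltgtP x y.
  by have := increasing_on Jx Jy xy; rewrite E ltxx.
by have := increasing_on Jy Jx xy; rewrite E ltxx.
Qed.

Lemma image_ivt x y z : J x -> J y -> x <= y -> S x <= z <= S y ->
  exists2 t, x <= t <= y & S t = z.
Proof.
move=> Jx Jy xy /andP[xz zy]; have [||t] := @IVT R S x y z xy.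
- apply/continuous_in_subspaceT => t; rewrite inE /= in_itv /= => Ht.
  by apply: cS; exact: iJ Ht.
- by rewrite ge_min xz le_max zy orbT.
- by rewrite in_itv /= => Ht; exists t.
Qed.

Let I : set R := S @` J.

Lemma image_interval : is_interval I.
Proof.
move=> _ _ [x Jx <-] [y Jy <-] z xzy.
have [xy|/ltW xy] := leP x y.
  have [t Ht <-] := image_ivt Jx Jy xy xzy; exists t => //; exact: iJ Ht.
have Sxy : S y <= S x.
  by move: xy; rewrite le_eqVlt => /orP[/eqP->//|/(increasing_on Jy Jx)/ltW].
have E : z = S y.
  by move/andP: xzy => [h1 h2]; apply/eqP; rewrite eq_le h2 (le_trans Sxy).
by rewrite E; exists y.
Qed.

Lemma image_open : open I.
Proof.
rewrite openE => _ [t Jt <-]; rewrite /interior /=.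
have [a [b [Ja Jb /andP[at_ tb]]]] := open_interval_margin oJ Jt.
have N : nbhs (S t) `]S a, S b[%classic.
  apply: open_nbhs_nbhs; split=> //=.
  by rewrite in_itv /= !increasing_on.
apply: (filterS _ N) => z /=; rewrite in_itv /= => /andP[h1 h2].
have [s Hs <-] := image_ivt Ja Jb (ltW (lt_trans at_ tb)) (introT andP (conj (ltW h1) (ltW h2))).
by exists s => //; exact: iJ Hs.
Qed.

(** The inverse satisfies [g' = psi \o g], from which it gains regularity order by order. *)
Lemma smooth_increasing_inverse : smooth_on J psi -> (forall t, J t -> psi t = (phi t)^-1) ->
  exists g, [/\ (forall t, J t -> g (S t) = t),
    (forall s, I s -> J (g s) /\ S (g s) = s),
    smooth_on I g & forall s, I s -> is_derive s 1 g (psi (g s))].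
Proof.
move=> spsi psiE.
have ex s : exists t, I s -> J t /\ S t = s.
  have [[t Jt <-]|nI] := pselect (I s); first by exists t.
  by exists 0.
have [g Hg] := choice ex.
have gK t : J t -> g (S t) = t.
  move=> Jt; have [Jg E] : J (g (S t)) /\ S (g (S t)) = S t by apply: Hg; exists t.
  exact: increasing_inj.
have dg s : I s -> is_derive s 1 g (psi (g s)).
  move=> Is; have [Jg E] := Hg s Is.
  rewrite -[X in is_derive X]E psiE//; apply: (@is_derive_inverse R S g (phi (g s)) (g s)).
  - have N : nbhs (g s) J by exact: open_nbhs_nbhs.
    by apply: (filterS _ N) => t; exact: gK.
  - have N : nbhs (g s) J by exact: open_nbhs_nbhs.
    by apply: (filterS _ N) => t; exact: cS.
  - exact: dS.
  - exact: lt0r_neq0 (phi_gt0 Jg).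
exists g; split=> //.
elim=> [|k IH]; first by move=> s Is; exact: is_derive_cont (dg s Is).
apply: (Ck_on1 (f' := fun s => psi (g s)) image_open) => //.
by apply: (Ck_on_comp1 image_open (fun s Is => (Hg s Is).1) (spsi k) IH).
Qed.

End Inverse.
End Primitive.

(** * From the profile equations to the profile curve *)

Lemma smooth_is_derive (R : realType) (D : set R) (f : R -> R) t : smooth_on D f -> D t ->
  is_derive t 1 f ('D_1 f t).
Proof. by move=> sf Dt; split=> //; apply: diff_derivable; exact: smooth_diff Dt. Qed.

Section ProfileSystem.
Context {R : realType}.
Variables (Dk : set R) (f1 f2 : R -> R).
Hypothesis oDk : open Dk.
Hypotheses (sf1 : smooth_on Dk f1) (sf2 : smooth_on Dk f2).

(** On a hypersurface, with argument [k1], the functions [curv_product] and [curv_ratio] are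
    [1 - sigma^2] and [m2], and [curv_speed] is the factor of [sigma] in the Riccati
    equation. *)
Definition curv_product (x : R) := f1 x * f2 x.
Definition curv_ratio (x : R) := f1 x / Num.sqrt (curv_product x).
Definition admissible : set R := [set x | [/\ Dk x, 0 < curv_product x & f1 x ^+ 2 < curv_product x]].
Definition curv_speed (x : R) := (1 - curv_ratio x ^+ 2) / Num.sqrt (curv_product x).

Record profile_near (U : set R) (k sig : R -> R) : Prop := ProfileNear {
  pn_open : open U;
  pn_k : smooth_on U k;
  pn_sig : smooth_on U sig;
  pn_P : forall s, U s -> admissible (k s);
  pn_dsig : forall s, U s -> 'D_1 sig s = - k s;
  pn_E : forall s, U s -> sig s ^+ 2 = 1 - curv_product (k s);
  pn_ratio : forall s, U s -> 'D_1 (curv_ratio \o k) s = sig s * curv_speed (k s) }.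

(** The neighbourhood makes this a property of germs, including smoothness. *)
Definition profile_sol (f : R -> R * R) (t : R) : Prop :=
  exists2 U, U t & profile_near U (fun s => (f s).1) (fun s => (f s).2).

Let U0 : set R := [set x | Dk x /\ 0 < curv_product x].

Lemma smooth_curv_product : smooth_on Dk curv_product.
Proof. by move=> k; exact: (Ck_onM oDk (sf1 k) (sf2 k)). Qed.

Let oU0 : open U0.
Proof.
rewrite openE => x [Dx gx]; rewrite /interior /=.
have /cvgr_gt/(_ _ gx) N := Ck_on_cont (smooth_curv_product 0%N) Dx.
have ND : nbhs x Dk by exact: open_nbhs_nbhs.
exact: filterI ND N.
Qed.

Lemma smooth_ratio : smooth_on U0 curv_ratio.
Proof.
move=> k; apply: (Ck_onM oU0); first by apply: (Ck_on_sub _ (sf1 k)) => x [].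
apply: (Ck_onV oU0); first by move=> x [_ g0]; rewrite gt_eqF ?sqrtr_gt0.
apply: (Ck_on_sqrt oU0); first by move=> x [].
by apply: (Ck_on_sub _ (smooth_curv_product k)) => x [].
Qed.

Lemma admissible_U0 x : admissible x -> U0 x. Proof. by case. Qed.

Lemma ratio_sqr x : admissible x -> curv_ratio x ^+ 2 = f1 x ^+ 2 / curv_product x.
Proof. by case=> _ g0 _; rewrite /curv_ratio expr_div_n sqr_sqrtr ?(ltW g0). Qed.

Lemma ratio_lt1 x : admissible x -> curv_ratio x ^+ 2 < 1.
Proof. by move=> Px; rewrite ratio_sqr//; case: Px => _ g0 H; rewrite ltr_pdivrMr// mul1r. Qed.

Lemma ratio_neq0 x : admissible x -> curv_ratio x != 0.
Proof.
case=> _ g0 _; rewrite /curv_ratio mulf_neq0//.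
  by move: g0; apply: contraTneq => f0; rewrite /curv_product f0 mul0r ltxx.
by rewrite invr_eq0 gt_eqF ?sqrtr_gt0.
Qed.

Lemma smooth_speed : smooth_on U0 curv_speed.
Proof.
move=> k; apply: (Ck_onM oU0).
  apply: (Ck_onB oU0); first exact: Ck_on_cst.
  by apply: (Ck_onM oU0); exact: smooth_ratio.
apply: (Ck_onV oU0); first by move=> x [_ g0]; rewrite gt_eqF ?sqrtr_gt0.
apply: (Ck_on_sqrt oU0); first by move=> x [].
by apply: (Ck_on_sub _ (smooth_curv_product k)) => x [].
Qed.

Lemma profile_sol_local (f g : R -> R * R) t : (\forall s \near t, f s = g s) ->
  profile_sol f t -> profile_sol g t.
Proof.
move=> fg [U Ut H]; have [oU sk ssig HP Hd HE Hr] := H.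
have NU : nbhs t U by exact: open_nbhs_nbhs.
have : nbhs t [set s | U s /\ f s = g s] by exact: filterI NU fg.
rewrite nbhsE => -[W [oW Wt] HW]; exists W => //.
have WU : W `<=` U by move=> s /HW[].
have k1E s : W s -> (f s).1 = (g s).1 by move=> /HW[_ ->].
have k2E s : W s -> (f s).2 = (g s).2 by move=> /HW[_ ->].
split=> //.
- by move=> k; apply: (Ck_on_eq oW k1E); exact: Ck_on_sub (sk k).
- by move=> k; apply: (Ck_on_eq oW k2E); exact: Ck_on_sub (ssig k).
- by move=> s Ws; rewrite -k1E//; exact: HP (WU _ Ws).
- by move=> s Ws; rewrite -(derive_eq_on _ oW Ws k2E) -k1E// Hd//; exact: WU.
- by move=> s Ws; rewrite -k1E// -k2E// HE//; exact: WU.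
move=> s Ws; rewrite -k1E// -k2E// -Hr; last exact: WU.
by apply: (derive_eq_on _ oW Ws) => z Wz /=; rewrite k1E.
Qed.

Lemma profile_sol_at (f : R -> R * R) t : profile_sol f t ->
  profile_at admissible ('D_1 curv_ratio) (fun x => 1 - curv_product x) curv_speed (fun s => (f s).1)
    ('D_1 (fun s => (f s).1)) ('D_1 ('D_1 (fun s => (f s).1))) (fun s => (f s).2) t.
Proof.
move=> [U Ut [oU sk ssig HP Hd HE Hr]].
have s1 := smooth_derive (1 : R) sk.
split.
- exact: HP.
- exact: smooth_is_derive sk Ut.
- exact: smooth_is_derive s1 Ut.
- exact: Ck_on_cont (smooth_derive (1 : R) s1 0%N) Ut.
- by rewrite -(Hd t Ut); exact: smooth_is_derive ssig Ut.
- exact: HE.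
rewrite -(Hr t Ut).
have dk : differentiable (fun s => (f s).1) t by exact: smooth_diff sk Ut.
have dr : differentiable curv_ratio (f t).1.
  exact: smooth_diff smooth_ratio (admissible_U0 (HP t Ut)).
by apply: etrans (mulrC _ _) _; apply: esym; exact: derive_comp1 dk dr.
Qed.

Lemma profile_sol_unique (f g : R -> R * R) (J : set R) t0 : open J -> is_interval J -> J t0 ->
  (forall t, J t -> profile_sol f t) -> (forall t, J t -> profile_sol g t) ->
  (\forall t \near t0, f t = g t) -> forall t, J t -> f t = g t.
Proof.
move=> oJ iJ J0 Hf Hg fg t Jt.
have drho x : admissible x -> is_derive x 1 ('D_1 curv_ratio) ('D_1 ('D_1 curv_ratio) x).
  move=> Px; exact: smooth_is_derive (smooth_derive (1 : R) smooth_ratio) (admissible_U0 Px).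
have Psi0 x : admissible x -> curv_speed x != 0.
  move=> Px; have g0 : 0 < curv_product x by case: Px.
  rewrite /curv_speed mulf_neq0//; last by rewrite invr_eq0 gt_eqF ?sqrtr_gt0.
  by rewrite subr_eq0 eq_sym lt_eqF// ratio_lt1.
have cPsi x : admissible x -> {for x, continuous curv_speed}.
  by move=> Px; exact: Ck_on_cont (smooth_speed 0%N) (admissible_U0 Px).
have [|e1 e2] := profile_unique drho Psi0 cPsi iJ oJ J0
  (fun s Js => profile_sol_at (Hf s Js)) (fun s Js => profile_sol_at (Hg s Js)) _ Jt.
  by apply: (filterS _ fg) => s ->.
by rewrite (surjective_pairing (f t)) e1 e2 -surjective_pairing.
Qed.

Section ProfileCurve.
Variables (f : R -> R * R) (J : set R).
Hypotheses (oJ : open J) (iJ : is_interval J).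
Hypothesis sol : forall t, J t -> profile_sol f t.

Let k t := (f t).1.
Let sg t := (f t).2.
Let g t := curv_product (k t).
Let m t := curv_ratio (k t).
(* [|m|], written so as to be visibly smooth where [m] does not vanish *)
Let mu t : R := Num.sqrt (m t * m t).
Let r t : R := 2^-1 * (ln (1 + mu t) - ln (1 - mu t)).

Let HP t : J t -> admissible (k t). Proof. by move=> /sol[U Ut H]; exact: pn_P H _ Ut. Qed.

Let sk : smooth_on J k.
Proof.
move=> j; apply: Ck_on_local => t /sol[U Ut H]; have oU := pn_open H.
by exists U; [exact: open_nbhs_nbhs|exists k; split=> //; exact: (pn_k H)].
Qed.

Let g0 t : J t -> 0 < g t. Proof. by move=> /HP[]. Qed.

Let sg_ : smooth_on J g.
Proof.
by move=> j; apply: (Ck_on_comp1 (g := curv_product) oJ _ (smooth_curv_product j) (sk j)) => t /HP[].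
Qed.

Let sm : smooth_on J m.
Proof.
move=> j; apply: (Ck_on_comp1 (g := curv_ratio) oJ _ (smooth_ratio j) (sk j)) => t /HP.
exact: admissible_U0.
Qed.

Let mm0 t : J t -> 0 < m t * m t.
Proof.
by move=> Jt; rewrite -expr2 lt_neqAle sqr_ge0 andbT eq_sym sqrf_eq0; exact: ratio_neq0 (HP Jt).
Qed.

Let smu : smooth_on J mu.
Proof.
move=> j; apply: (Ck_on_sqrt oJ) => //.
by apply: (Ck_onM oJ); exact: sm.
Qed.

Let mu0 t : J t -> 0 < mu t. Proof. by move=> Jt; rewrite sqrtr_gt0 mm0. Qed.

Let mumu t : J t -> mu t * mu t = m t * m t.
Proof. by move=> Jt; rewrite -expr2 sqr_sqrtr// ltW// mm0. Qed.

Let mu1 t : J t -> mu t < 1.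
Proof.
move=> Jt; have := ratio_lt1 (HP Jt); rewrite -/(m t) expr2 -mumu// => H.
by have [//|h] := ltP (mu t) 1; have := mu0 Jt; nra.
Qed.

Let D1mu (e t : R) : J t -> differentiable (fun t => 1 + e * mu t) t /\
  'D_1 (fun t => 1 + e * mu t) t = e * 'D_1 mu t.
Proof.
move=> Jt; have dmu : differentiable mu t := smooth_diff smu Jt.
have de : differentiable (fun=> e : R) t by exact: differentiable_cst.
have d1 : differentiable (fun=> 1 : R) t by exact: differentiable_cst.
have dM := differentiableM de dmu.
split; first exact: (differentiableD d1 dM).
rewrite (deriveD2 (1 : R) d1 dM) (deriveM2 (1 : R) de dmu) !derive_cst; ring.
Qed.

Let pos (e t : R) : e ^+ 2 = 1 -> J t -> 0 < 1 + e * mu t.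
Proof.
move=> /eqP; rewrite sqrf_eq1 => /orP[] /eqP -> Jt; have := mu0 Jt; have := mu1 Jt; lra.
Qed.

Let smooth_ln1 (e : R) : e ^+ 2 = 1 -> smooth_on J (fun t => ln (1 + e * mu t)).
Proof.
move=> e1 j; apply: (Ck_on_comp1 (g := @ln R) (f := fun t => 1 + e * mu t) oJ _ (smooth_ln j)).
  by move=> t Jt /=; exact: pos.
apply: (Ck_onD oJ); first exact: Ck_on_cst.
by apply: (Ck_onM oJ); [exact: Ck_on_cst|exact: smu].
Qed.

Let D1ln (e t : R) : e ^+ 2 = 1 -> J t ->
  'D_1 (fun t => ln (1 + e * mu t)) t = e * 'D_1 mu t / (1 + e * mu t).
Proof.
move=> e1 Jt; have [d E] := D1mu e Jt; have p := pos e1 Jt.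
have [dl el] := is_derive1_ln p.
have dln : differentiable (@ln R) (1 + e * mu t) by apply/derivable1_diffP.
apply: etrans (derive_comp1 (1 : R) d dln) _.
by rewrite E el.
Qed.

Let rE : r = fun t => 2^-1 * (ln (1 + 1 * mu t) - ln (1 + (-1) * mu t)).
Proof. by apply/funext => t; rewrite mul1r mulN1r. Qed.

Let e1 : (1 : R) ^+ 2 = 1. Proof. exact: expr1n. Qed.
Let eN1 : (-1 : R) ^+ 2 = 1. Proof. by rewrite sqrrN expr1n. Qed.

Let sr : smooth_on J r.
Proof.
rewrite rE => j; apply: (Ck_onM oJ); first exact: Ck_on_cst.
by apply: (Ck_onB oJ); exact: smooth_ln1.
Qed.

Let Dr_sqr t : J t -> ('D_1 r t) ^+ 2 * g t = sg t ^+ 2.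
Proof.
move=> Jt.
have d1 : differentiable (fun t => ln (1 + 1 * mu t)) t by exact: smooth_diff (smooth_ln1 e1) Jt.
have d2 : differentiable (fun t => ln (1 + (-1) * mu t)) t.
  exact: smooth_diff (smooth_ln1 eN1) Jt.
have dc : differentiable (fun=> 2^-1 : R) t by exact: differentiable_cst.
rewrite rE (deriveM2 (1 : R) dc (differentiableB d1 d2)) derive_cst mul0r add0r.
rewrite (deriveB2 (1 : R) d1 d2) (D1ln e1 Jt) (D1ln eN1 Jt).
have dmu : differentiable mu t := smooth_diff smu Jt.
have dm : differentiable m t := smooth_diff sm Jt.
have Dmm : 'D_1 mu t * mu t = 'D_1 m t * m t.
  have := derive_eq_on (1 : R) oJ Jt mumu.
  rewrite (deriveM2 (1 : R) dmu dmu) (deriveM2 (1 : R) dm dm); lra.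
have [U Ut H] := sol Jt; have Em : 'D_1 m t = sg t * curv_speed (k t) := pn_ratio H Ut.
rewrite Em in Dmm.
have p1 := pos e1 Jt; have p2 := pos eN1 Jt; rewrite mul1r in p1; rewrite mulN1r in p2.
have sq : Num.sqrt (g t) ^+ 2 = g t by rewrite sqr_sqrtr// ltW// g0.
have s0 : 0 < Num.sqrt (g t) by rewrite sqrtr_gt0 g0.
have Esp : curv_speed (k t) * Num.sqrt (g t) = 1 - m t * m t.
  by rewrite /curv_speed -expr2 mulfVK// gt_eqF.
rewrite -mumu// in Esp.
have M := mumu Jt; have m0 := mu0 Jt.
move: ('D_1 mu t) Dmm => d Dmm.
have -> : 2^-1 * (1 * d / (1 + 1 * mu t) - (-1) * d / (1 + (-1) * mu t)) =
    d / (1 - mu t * mu t).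
  by field; rewrite mulN1r !gt_eqF//; nra.
have n0 : 0 < 1 - mu t * mu t by nra.
have D2 : d ^+ 2 * g t = sg t ^+ 2 * (1 - mu t * mu t) ^+ 2.
  have mm : mu t * mu t != 0 by rewrite mulf_neq0// gt_eqF.
  apply: (mulIf mm).
  transitivity ((d * mu t) ^+ 2 * Num.sqrt (g t) ^+ 2); first by rewrite sq; ring.
  rewrite Dmm; transitivity (sg t ^+ 2 * (curv_speed (k t) * Num.sqrt (g t)) ^+ 2 * (m t * m t)).
    by ring.
  by rewrite Esp M.
by rewrite expr_div_n mulrAC D2 mulfK// expf_neq0// gt_eqF.
Qed.

Let cosh_sinh_r t : J t -> let z := r t in
  [/\ 0 < cosh z, cosh z ^+ 2 = (1 - m t ^+ 2)^-1,
     0 < sinh z & sinh z ^+ 2 = m t ^+ 2 / (1 - m t ^+ 2)].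
Proof.
move=> Jt z; have p1 : 0 < 1 + mu t by have := mu0 Jt; lra.
have p2 : 0 < 1 - mu t by have := mu1 Jt; lra.
set x := expR z; have x0 : 0 < x by exact: expR_gt0.
have xx : x ^+ 2 = (1 + mu t) / (1 - mu t).
  rewrite /x -expRM_natl /z /r.
  have -> : 2%:R * (2^-1 * (ln (1 + mu t) - ln (1 - mu t))) = ln (1 + mu t) - ln (1 - mu t) :> R.
    by rewrite mulrA mulfV ?mul1r// pnatr_eq0.
  by rewrite expRD expRN !lnK.
have x1 : 1 < x.
  have : 1 < x ^+ 2 by rewrite xx ltr_pdivlMr// mul1r; have := mu0 Jt; lra.
  by have [//|h] := ltP 1 x; nra.
have M : m t ^+ 2 = mu t ^+ 2 by rewrite !expr2 mumu.
have xn : x != 0 by rewrite gt_eqF.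
have e2 : cosh z = (x ^+ 2 + 1) / (2 * x).
  by rewrite /cosh expRN -/x; field.
have e3 : sinh z = (x ^+ 2 - 1) / (2 * x).
  by rewrite /sinh expRN -/x; field.
have n1 : 1 - mu t != 0 by rewrite gt_eqF.
have n2 : 1 + mu t != 0 by rewrite gt_eqF.
have n3 : 1 - mu t ^+ 2 != 0.
  have -> : 1 - mu t ^+ 2 = (1 - mu t) * (1 + mu t) by ring.
  exact: mulf_neq0.
have E : 2 * x != 0 by rewrite mulf_neq0 ?pnatr_eq0.
split.
- by rewrite e2 divr_gt0// ?mulr_gt0// ltr_pwDr// sqr_ge0.
- rewrite e2 expr_div_n exprMn xx M; by field; rewrite ?n3 ?n1 ?n2.
- by rewrite e3 divr_gt0// ?mulr_gt0// subr_gt0 expr_gt1// ltW.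
- rewrite e3 expr_div_n exprMn xx M; by field; rewrite ?n3 ?n1 ?n2.
Qed.

(** The arc length [S] is a primitive of [1 / sqrt (1 - sig^2)] with respect to the height,
    [a2] is its inverse and [a1] is [artanh |m|] in the new parameter. The Riccati equation
    gives [a1'^2 = sig^2]. *)
Lemma profile_curve : exists (S : R -> R) (I : set R) (a1 a2 : R -> R),
  [/\ profile I a1 a2, smooth_on J S & forall t, J t ->
    [/\ I (S t), a2 (S t) = t, 0 < cosh (a1 (S t)), 0 < sinh (a1 (S t)) &
     cosh (a1 (S t)) ^+ 2 = (1 - m t ^+ 2)^-1 /\
     sinh (a1 (S t)) ^+ 2 = m t ^+ 2 / (1 - m t ^+ 2)]].
Proof.
pose psi t : R := Num.sqrt (g t); pose phi t : R := (psi t)^-1.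
have psi0 t : J t -> 0 < psi t by move=> Jt; rewrite sqrtr_gt0 g0.
have spsi : smooth_on J psi by move=> j; apply: (Ck_on_sqrt oJ g0 (sg_ j)).
have sphi : smooth_on J phi.
  by move=> j; apply: (Ck_onV oJ _ (spsi j)) => t /psi0 /lt0r_neq0.
have phi0 t : J t -> 0 < phi t by move=> Jt; rewrite invr_gt0 psi0.
have [S dS] := primitive oJ iJ (fun t Jt => Ck_on_cont (sphi 0%N) Jt).
have [a2 [a2K SK sa2 da2]] := smooth_increasing_inverse oJ iJ dS phi0 spsi
  (fun t Jt => esym (invrK _)).
have oI := image_open oJ iJ dS phi0; have iI := image_interval iJ dS phi0.
have sS : smooth_on J S.
  by case=> [|j]; [move=> t Jt; exact: is_derive_cont (dS t Jt)|exact: Ck_on1 dS (sphi j)].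
exists S, (S @` J), (r \o a2), a2; split.
- split=> //.
    by move=> j; exact: (Ck_on_comp1 oI (fun s Is => (SK s Is).1) (sr j) (sa2 j)).
  move=> s Is; have [Ja Es] := SK s Is; split; last first.
    by have [_ _ h _] := cosh_sinh_r Ja.
  have [da ea] := da2 s Is.
  have dda : differentiable a2 s by apply/derivable1_diffP.
  have ddr : differentiable r (a2 s) := smooth_diff sr Ja.
  rewrite !derive1E ea (derive_comp1 (1 : R) dda ddr) ea.
  have sq : psi (a2 s) ^+ 2 = g (a2 s) by rewrite sqr_sqrtr// ltW// g0.
  rewrite exprMn sq [X in X + _]mulrC Dr_sqr//.
  have [U Ut H] := sol Ja.
  have E : sg (a2 s) ^+ 2 = 1 - g (a2 s) := pn_E H Ut.
  by rewrite E subrK.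
- exact: sS.
move=> t Jt; rewrite /= a2K//; have [h1 h2 h3 h4] := cosh_sinh_r Jt.
by split=> //; exists t.
Qed.

End ProfileCurve.

End ProfileSystem.

(** * Hypersurfaces seen through their charts *)

Section Charts.
Context {R : realType} {M : topologicalType}.
Implicit Types (A : set (chart R M)) (c : chart R M).

Lemma chart_codP c u : is_chart c -> chart_cod c u ->
  chart_dom c (chart_inv c u) /\ chart_map c (chart_inv c u) = u.
Proof. by case=> _ _ K _ _ [p Dp <-]; rewrite K. Qed.

Lemma chart_cod_map c p : chart_dom c p -> chart_cod c (chart_map c p).
Proof. by exists p. Qed.

Lemma chart_near c p (Q : M -> Prop) : is_chart c -> chart_dom c p ->
  (\forall u \near chart_map c p, Q (chart_inv c u)) -> \forall q \near p, Q q.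
Proof.
move=> [oD _ K cm _] Dp N.
have N1 : nbhs p (chart_map c @^-1` [set u | Q (chart_inv c u)]) by exact: (cm p Dp).
have N2 : nbhs p (chart_dom c) by exact: open_nbhs_nbhs.
by apply: filterS (filterI N1 N2) => q [/= + Dq]; rewrite K.
Qed.

Lemma chart_near_inv c p (Q : M -> Prop) : is_chart c -> chart_dom c p ->
  (\forall q \near p, Q q) -> \forall u \near chart_map c p, Q (chart_inv c u).
Proof.
move=> [_ _ K _ ci] Dp N.
have cu := ci _ (chart_cod_map Dp).
by apply: (cu [set q | Q q]); rewrite /= K.
Qed.

Lemma chart_image_open c (U : set M) : is_chart c -> open U ->
  open (chart_map c @` (chart_dom c `&` U)).
Proof.
move=> ic oU; have [oD oC K cm ci] := ic; rewrite openE => _ [p [Dp Up] <-].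
rewrite /interior /=.
have NU : \forall q \near p, U q by exact: open_nbhs_nbhs.
have N1 := chart_near_inv ic Dp NU.
have N2 : nbhs (chart_map c p) (chart_cod c).
  by apply: open_nbhs_nbhs; split=> //; exact: chart_cod_map.
apply: filterS (filterI N1 N2) => u [Uu Cu].
by have [h1 h2] := chart_codP ic Cu; exists (chart_inv c u).
Qed.

Lemma smooth_near_continuous A (W : normedModType R) (f : M -> W) c p : is_chart c ->
  chart_dom c p -> {for chart_map c p, continuous (f \o chart_inv c)} -> {for p, continuous f}.
Proof.
move=> ic Dp cf B; have [_ _ K _ _] := ic => NB.
have N : nbhs (chart_map c p) ((f \o chart_inv c) @^-1` B) by apply: cf; rewrite /= K.
exact: chart_near ic Dp N.
Qed.

Lemma derive_chart_change (W : normedModType R) (f : M -> W) c c' p w :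
  is_chart c -> is_chart c' -> smooth_transition c' c -> chart_dom c p -> chart_dom c' p ->
  smooth_on (chart_cod c) (f \o chart_inv c) ->
  'D_w (f \o chart_inv c') (chart_map c' p) =
  'D_('D_w (chart_map c \o chart_inv c') (chart_map c' p)) (f \o chart_inv c) (chart_map c p).
Proof.
move=> ic ic' st Dp Dp' sf; have [oD _ K _ _] := ic; have [_ _ K' _ _] := ic'.
pose E := chart_map c' @` (chart_dom c' `&` chart_dom c).
have oE : open E by exact: chart_image_open.
have Ep : E (chart_map c' p) by exists p.
set tau := chart_map c \o chart_inv c'.
have tp : tau (chart_map c' p) = chart_map c p by rewrite /tau /= K'.
have dt : differentiable tau (chart_map c' p) by exact: smooth_diff st Ep.
have df : differentiable (f \o chart_inv c) (tau (chart_map c' p)).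
  by rewrite tp; apply: smooth_diff sf _; exact: chart_cod_map.
rewrite -tp -(derive_comp w dt df); apply: (derive_eq_on w oE Ep) => _ [q [Dq' Dq] <-].
by rewrite /tau /= K' ?K.
Qed.

End Charts.

(** The data of the theorem, gathered so that the pairs [(k2, f1)] and [(k3, f2)] can be
    exchanged. *)
Record hypersurface (R : realType) (M : topologicalType) (A : set (chart R M))
    (x N T : M -> 'rV[R]_5) (sigma k1 k2 k3 : M -> R) (D : set R) (f1 f2 : R -> R) : Prop :=
  Hypersurface {
  hs_M : manifold3 A;
  hs_x : immersion_H3R A x;
  hs_N : unit_normal A x N;
  hs_T : forall p, e5 = T p + sigma p *: N p;
  hs_T0 : forall p, T p != 0;
  hs_k2 : principal_curvature A x N k2;
  hs_k3 : principal_curvature A x N k3;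
  hs_k12 : forall p, k1 p != k2 p;
  hs_k13 : forall p, k1 p != k3 p;
  hs_k23 : forall p, k2 p != k3 p;
  hs_ST : shape_scales A x N T k1;
  hs_D : open D;
  hs_k1D : forall p, D (k1 p);
  hs_f1 : smooth_on D f1;
  hs_f2 : smooth_on D f2;
  hs_rel2 : forall p, k2 p = f1 (k1 p);
  hs_rel3 : forall p, k3 p = f2 (k1 p) }.

Section Hypersurface.
Context {R : realType} {M : topologicalType}.
Variables (A : set (chart R M)) (x N T : M -> 'rV[R]_5) (sigma k1 k2 k3 : M -> R).
Variables (Dk : set R) (f1 f2 : R -> R).
Hypothesis H : hypersurface A x N T sigma k1 k2 k3 Dk f1 f2.

Let atlas : smooth_atlas A. Proof. by case: (hs_M H). Qed.
Let cM : connected [set: M]. Proof. by case: (hs_M H). Qed.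
Let Ac c : A c -> is_chart c. Proof. by case: atlas => h _ _; exact: h. Qed.
Let sx c : A c -> smooth_on (chart_cod c) (x \o chart_inv c).
Proof. by case: (hs_x H) => h _ _; exact: h. Qed.
Let sN c : A c -> smooth_on (chart_cod c) (N \o chart_inv c).
Proof. by case: (hs_N H) => h _ _ _; exact: h. Qed.

Section InChart.
Variables (c : chart R M).
Hypothesis hc : A c.
Let ic : is_chart c := Ac hc.
Let X := x \o chart_inv c.
Let n := N \o chart_inv c.
Let D := chart_cod c.

Let oD : open D. Proof. by case: ic. Qed.
Let inv_map p : chart_dom c p -> chart_inv c (chart_map c p) = p. Proof. by case: ic => _ _ K _ _; exact: K. Qed.

Let dX u : D u -> differentiable X u. Proof. exact: smooth_diff (sx hc). Qed.
Let dn u : D u -> differentiable n u. Proof. exact: smooth_diff (sN hc). Qed.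

Lemma dmxE p w : chart_dom c p -> w *m dmx x c p = 'D_w X (chart_map c p) /\
  w *m dmx N c p = 'D_w n (chart_map c p).
Proof.
move=> Dp; have Du := chart_cod_map Dp.
by split; [rewrite (deriveEjacobian _ (dX Du))|rewrite (deriveEjacobian _ (dn Du))].
Qed.

Let hH u : D u -> H3R (X u).
Proof. by move=> _; case: (hs_x H) => _ h _; exact: h. Qed.
Let nX0 u : D u -> lor (n u) (nu (X u)) = 0.
Proof. by move=> _; case: (hs_N H) => _ h _ _; exact: h. Qed.
Let nn u : D u -> lor (n u) (n u) = 1.
Proof. by move=> _; case: (hs_N H) => _ _ h _; exact: h. Qed.

Let nX u w : D u -> lor (n u) ('D_w X u) = 0.
Proof.
move=> Du; have [Dp Ep] := chart_codP ic Du.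
have [E _] := dmxE w Dp; rewrite Ep in E; rewrite -E.
by case: (hs_N H) => _ _ _ h; exact: h hc Dp.
Qed.

Let free u w : D u -> 'D_w X u = 0 -> w = 0.
Proof.
move=> Du; have [Dp Ep] := chart_codP ic Du.
have [E _] := dmxE w Dp; rewrite Ep in E; rewrite -E => Z.
case: (hs_x H) => _ _ h; apply: (row_free_inj (h c _ hc Dp)).
by rewrite Z mul0mx.
Qed.

Let dnu u : D u -> differentiable (fun u => nu (X u)) u.
Proof. exact: smooth_diff (smooth_nu oD (sx hc)). Qed.

Let nu_DX u w : D u -> lor (nu (X u)) ('D_w X u) = 0.
Proof. exact: (nu_derive oD (sx hc) w hH). Qed.

(** The covariant derivative of the unit normal is tangent, so [pinvmx] recovers its
    coordinates exactly. *)
Lemma shape_weingarten u t k : D u -> t *m Defs.shape x N c (chart_inv c u) = k *: t ->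
  weingarten X n k u t.
Proof.
move=> Du; have [Dp Ep] := chart_codP ic Du; set p := chart_inv c u in Dp Ep *.
have Et w : w *m dmx x c p = 'D_w X u /\ w *m dmx N c p = 'D_w n u by rewrite -Ep; exact: dmxE.
have fr : row_free (dmx x c p) by case: (hs_x H) => _ _ h; exact: h.
have nuX : lor (nu (x p)) (nu (x p)) = -1 by apply: H3R_nu; exact: hH Du.
have E5 w : lor ('D_w n u) (nu (X u)) = n u 0 4 * ('D_w X u) 0 4.
  have := derive_lor_cst w oD Du (dn Du) (dnu Du) nX0.
  rewrite (derive_nu oD (sx hc) w Du) lorBr (nX w Du) lorZr lor_e5 => /eqP.
  by rewrite sub0r subr_eq0 mulrC => /eqP.
have nbl w : w *m nabla_mx x N c p = 'D_w n u + (n u 0 4 * ('D_w X u) 0 4) *: nu (X u).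
  by rewrite nabla_mul (Et w).2 -[nu (x p)]/(nu (X u)) (E5 w).
have sub : (nabla_mx x N c p <= dmx x c p)%MS.
  apply/row_subP => i; rewrite rowE; set w := delta_mx 0 i.
  apply: (tangent_span nuX (nn Du) (nX0 Du) fr).
  - by move=> v; rewrite (Et v).1; split; [exact: nu_DX|exact: nX].
  - by rewrite nbl lorDl lorZl (E5 w) nuX; ring.
  rewrite nbl lorDl lorZl [lor (nu (X u)) _]lorC (nX0 Du) mulr0 addr0.
  have := derive_lor_cst w oD Du (dn Du) (dn Du) nn.
  by rewrite (lorC (n u)) -mulr2n => /eqP; rewrite mulrn_eq0 => /eqP.
move=> E; have := congr1 (mulmx^~ (dmx x c p)) E.
rewrite /Defs.shape /= -mulmxA 2!mulNmx mulmxKpV// mulmxN nbl -scalemxAl (Et t).1 => E'.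
rewrite /weingarten -E' opprK.
by move: ('D_t n u) (_ *: _) => a b; rewrite addrK.
Qed.

(** Pair the decomposition of [e5] with the unit normal, to which [T] is orthogonal. *)
Lemma normal_height p : sigma p = N p 0 4 /\ T p = e5 - N p 0 4 *: N p.
Proof.
have [c' Ac' Dp] : exists2 c, A c & chart_dom c p by case: atlas => _ h _; exact: h.
have [t Tt _] := hs_ST H Ac' Dp.
have NT : lor (N p) (T p) = 0.
  by rewrite Tt; case: (hs_N H) => _ _ _ h; exact: h.
have np : lor (N p) (N p) = 1 by case: (hs_N H) => _ _ h _; exact: h.
have E := hs_T H p.
have sE : sigma p = N p 0 4.
  by rewrite -lor_e5 E lorDr NT lorZr np add0r mulr1.
by split=> //; rewrite -sE [in RHS]E addrK.
Qed.

Lemma hypersurface_patch : principal_patch D X n (k1 \o chart_inv c) (k2 \o chart_inv c)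
  (k3 \o chart_inv c) Dk f1 f2.
Proof.
split.
- exact: oD.
- exact: sx.
- exact: sN.
- exact: hH.
- exact: free.
- exact: nX0.
- exact: nn.
- exact: nX.
- by move=> u _; exact: hs_k12 H _.
- by move=> u _; exact: hs_k13 H _.
- by move=> u _; exact: hs_k23 H _.
- exact: hs_f1 H.
- exact: hs_f2 H.
- by move=> u _; exact: hs_k1D H _.
- by move=> u _; exact: hs_rel2 H _.
- by move=> u _; exact: hs_rel3 H _.
move=> u Du; have [Dp Ep] := chart_codP ic Du.
have [t1 Tt S1] := hs_ST H hc Dp.
have /eigenvalueP[t2 S2 t20] := hs_k2 H hc Dp.
have /eigenvalueP[t3 S3 t30] := hs_k3 H hc Dp.
have [E1 _] := dmxE t1 Dp; rewrite Ep in E1.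
exists t1, t2, t3; split.
- by have := hs_T0 H (chart_inv c u); rewrite Tt; apply: contraNneq => ->; rewrite mul0mx.
- exact: t20.
- exact: t30.
- by rewrite -E1 -Tt; exact: (normal_height _).2.
- exact: shape_weingarten.
- exact: shape_weingarten.
- exact: shape_weingarten.
Qed.

End InChart.

Let height p : R := x p 0 4.
Let sg p : R := N p 0 4.
Let m p : R := k2 p * tilt (N p).

Lemma chart_at p : exists2 c, A c & chart_dom c p.
Proof. by case: atlas => _ h _; exact: h. Qed.

Let at_patch p c : A c -> chart_dom c p ->
  chart_cod c (chart_map c p) /\ chart_inv c (chart_map c p) = p.
Proof.
by move=> hc Dp; split; [exact: chart_cod_map|case: (Ac hc) => _ _ K _ _; exact: K].
Qed.

Lemma curvature_product p : k2 p * k3 p = 1 - sg p * sg p.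
Proof.
have [c hc Dp] := chart_at p; have [Du Ep] := at_patch hc Dp.
by have := patch_product (hypersurface_patch hc) Du; rewrite /= Ep.
Qed.

Lemma normal_tilted p : 0 < 1 - sg p * sg p.
Proof.
have [c hc Dp] := chart_at p; have [Du Ep] := at_patch hc Dp.
by have := patch_sg_lt1 (hypersurface_patch hc) Du; rewrite /= Ep.
Qed.

Lemma tilt_sqr p : tilt (N p) ^+ 2 * (1 - sg p * sg p) = 1.
Proof.
have s0 := normal_tilted p.
by rewrite /tilt exprVn sqr_sqrtr ?mulVf ?gt_eqF// ltW.
Qed.

Lemma tilted_curvature_neq1 p : 1 - m p ^+ 2 != 0.
Proof.
have [c hc Dp] := chart_at p; have [Du Ep] := at_patch hc Dp.
by have := patch_m2_neq1 (hypersurface_patch hc) Du; rewrite /= Ep.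
Qed.

Lemma continuous_via_chart (f : M -> R) :
  (forall c, A c -> Ck_on 0 (chart_cod c) (f \o chart_inv c)) -> continuous f.
Proof.
move=> Cf p; have [c hc Dp] := chart_at p.
exact: smooth_near_continuous (Ac hc) Dp (Cf c hc _ (chart_cod_map Dp)).
Qed.

Lemma height_continuous : continuous height.
Proof.
apply: continuous_via_chart => c hc.
by have oD : open (chart_cod c) := pp_open (hypersurface_patch hc); exact: smooth_coord oD (sx hc) 4 0%N.
Qed.

Lemma tilted_curvature_continuous : continuous m.
Proof.
apply: continuous_via_chart => c hc; have P := hypersurface_patch hc.
exact: (smooth_kr P (pp_f1 P) (pp_k2 P)).1 0%N.
Qed.

(** [m^2] never takes the value 1, and the space is connected. *)
Lemma curvature_dichotomy : (forall p, m p ^+ 2 < 1) \/ (forall p, 1 < m p ^+ 2).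
Proof.
have cm2 : continuous (fun p => m p ^+ 2).
  by move=> p; apply: (@cvgM _ _ _ _ m m); exact: tilted_curvature_continuous.
have loc (Q : R -> Prop) : (forall s, Q s -> s != 1 -> \forall z \near s, Q z) ->
    forall p, Q (m p ^+ 2) -> nbhs p [set q | Q (m q ^+ 2)].
  move=> HQ p Qp; apply: (cm2 p [set z | Q z]); apply: HQ => //.
  by rewrite eq_sym -subr_eq0; exact: tilted_curvature_neq1.
have lt1 := loc (fun z => z < 1) (fun s h _ => lt_nbhsl h).
have gt1 := loc (fun z => 1 < z) (fun s h _ => lt_nbhsr h).
have [[p0 h0]|n0] := pselect (exists p, m p ^+ 2 < 1); last first.
  right=> p; have := tilted_curvature_neq1 p; rewrite subr_eq0 neq_lt => /orP[//|h].
  by exfalso; apply: n0; exists p.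
left; apply: (locally_constant_connected (p0 := p0) cM) => // p.
have := tilted_curvature_neq1 p; rewrite subr_eq0 neq_lt => /orP[h|h].
  by exists [set q | 1 < m q ^+ 2]; [exact: gt1|move=> q q' /= h1 _ h2; have := lt_trans h1 h2; rewrite ltxx].
by exists [set q | m q ^+ 2 < 1]; [exact: lt1|move=> q q'].
Qed.

(** A curve on which the height is the parameter exists inside any neighbourhood of the
    point. *)
Lemma height_open p (B : set M) : nbhs p B -> nbhs (height p) (height @` B).
Proof.
move=> NB; have [c hc Dp] := chart_at p; have [Du Ep] := at_patch hc Dp.
have P := hypersurface_patch hc; have oD := pp_open P.
have [t1 [t2 [t3 F]]] := pp_frames P Du.
have h1 := lt0r_neq0 (patch_h1_pos P Du F).
have N1 := chart_near_inv (Ac hc) Dp NB.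
have : nbhs (chart_map c p) [set u | B (chart_inv c u) /\ chart_cod c u].
  by apply: filterI N1 _; exact: open_nbhs_nbhs.
rewrite nbhsE => -[W [oW Wu] HW].
have sW : smooth_on W (fun u => (x \o chart_inv c) u 0 4).
  by move=> k; apply: (Ck_on_sub _ (smooth_coord oD (sx hc) 4 k)) => u /HW[].
have [gam [U [oU Uh _ HU _]]] := level_curve oW sW Wu h1.
rewrite /= Ep in Uh.
have NU : nbhs (height p) U by exact: open_nbhs_nbhs.
apply: (filterS _ NU) => t Ut; have [Wt Et] := HU t Ut.
by exists (chart_inv c (gam t)); [exact: (HW _ Wt).1|exact: Et].
Qed.

Section Ordered.
Hypothesis m_lt1 : forall p, m p ^+ 2 < 1.

Lemma curvature_admissible p : admissible Dk f1 f2 (k1 p) /\ curv_ratio f1 f2 (k1 p) = m p.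
Proof.
have E : curv_product f1 f2 (k1 p) = 1 - sg p * sg p.
  by rewrite /curv_product -(hs_rel2 H) -(hs_rel3 H) curvature_product.
split; last by rewrite /curv_ratio E -(hs_rel2 H).
split; first exact: hs_k1D H p.
  by rewrite E; exact: normal_tilted.
rewrite E -(hs_rel2 H); have := m_lt1 p; rewrite /m exprMn => h.
have s0 := normal_tilted p.
have -> : k2 p ^+ 2 = k2 p ^+ 2 * tilt (N p) ^+ 2 * (1 - sg p * sg p).
  by rewrite -mulrA tilt_sqr mulr1.
by rewrite -[ltRHS]mul1r ltr_pM2r.
Qed.

(** The equations hold along the curve of [level_curve], on which the derivative of the height
    is 1. *)
Lemma profile_germ p : exists f (U : set R), [/\ open U, is_interval U, U (height p),
  (forall t, U t -> profile_sol Dk f1 f2 f t) & \forall q \near p, (k1 q, sg q) = f (height q)].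
Proof.
have [c hc Dp] := chart_at p; have [Du Ep] := at_patch hc Dp.
have P := hypersurface_patch hc; have oD := pp_open P.
have [t1 [t2 [t3 F]]] := pp_frames P Du.
have h1 := lt0r_neq0 (patch_h1_pos P Du F).
set X := x \o chart_inv c in P F h1; set n := N \o chart_inv c in P F.
pose hX u := X u 0 4; pose sn u := n u 0 4.
pose K1 := k1 \o chart_inv c.
have sh : smooth_on (chart_cod c) hX := smooth_coord oD (sx hc) 4.
have ss : smooth_on (chart_cod c) sn := smooth_coord oD (sN hc) 4.
have sk : smooth_on (chart_cod c) K1 := smooth_k1 P.
have [gam [U [oU Uh sgam HU Hf]]] := level_curve oD sh Du h1.
rewrite /hX /X /= Ep in Uh.
have [e e0 He] : exists2 e, 0 < e & ball (height p) e `<=` U.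
  have /nbhs_ballP[e /= e0 He] : nbhs (height p) U by exact: open_nbhs_nbhs.
  by exists e.
pose f t := (K1 (gam t), sn (gam t)).
exists f, (ball (height p) e); split.
- exact: ball_open.
- move=> a b; rewrite -ball_normE /= => ha hb z /andP[az zb].
  by move: ha hb; rewrite !ltr_distlC => /andP[a1 a2] /andP[b1 b2]; apply/andP; split; lra.
- exact: ballxx.
- move=> t /He Ut; exists U => //.
  have DU s : U s -> chart_cod c (gam s) by move=> /HU[].
  have dg s : U s -> differentiable gam s := smooth_diff sgam.
  have hg s : U s -> 'D_('D_(1 : R) gam s) hX (gam s) = 1.
    move=> Us; have dh : differentiable hX (gam s) := smooth_diff sh (DU s Us).
    rewrite -(derive_comp (1 : R) (dg s Us) dh).
    rewrite (derive_eq_on (g := id) _ oU Us); last by move=> z Uz; exact: (HU z Uz).2.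
    exact: derive_id.
  split.
  + exact: oU.
  + by move=> k; exact: (Ck_on_comp oU DU (sk k) (sgam k)).
  + by move=> k; exact: (Ck_on_comp oU DU (ss k) (sgam k)).
  + by move=> s Us; exact: (curvature_admissible _).1.
  + move=> s Us; have Ds := DU s Us.
    apply: etrans (derive_comp (1 : R) (dg s Us) (smooth_diff ss Ds)) _.
    apply: etrans (patch_dsg P _ Ds) _.
    by rewrite -[X in _ * X]/('D_('D_(1 : R) gam s) hX (gam s)) (hg s Us) mulr1.
  + move=> s Us; rewrite /f /curv_product /=.
    have E := curvature_product (chart_inv c (gam s)).
    by rewrite -(hs_rel2 H) -(hs_rel3 H) E /sn /n /= -/(sg _) -expr2; ring.
  move=> s Us; have Ds := DU s Us.
  pose mc u := (k2 \o chart_inv c) u * tilt (n u).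
  have smc : smooth_on (chart_cod c) mc := (smooth_kr P (pp_f1 P) (pp_k2 P)).1.
  have -> : curv_ratio f1 f2 \o (fun s => (f s).1) = mc \o gam.
    by apply/funext => z /=; exact: (curvature_admissible _).2.
  apply: etrans (derive_comp (1 : R) (dg s Us) (smooth_diff smc Ds)) _.
  apply: etrans (patch_riccati P _ Ds) _.
  rewrite -[X in _ * X]/('D_('D_(1 : R) gam s) hX (gam s)) (hg s Us) mulr1.
  have [_ Er] := curvature_admissible (chart_inv c (gam s)).
  rewrite /curv_speed /f /= Er /curv_product -(hs_rel2 H) -(hs_rel3 H) curvature_product.
  by rewrite -mulrA; congr (_ * _); rewrite mulrC.
have dK1 u : chart_cod c u -> differentiable K1 u := smooth_diff sk.
have dsn u : chart_cod c u -> differentiable sn u := smooth_diff ss.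
have psn u : chart_cod c u -> exists l, forall v, 'D_v sn u = l * 'D_v hX u.
  by move=> Cu; exists (- K1 u) => v; rewrite mulNr; exact (patch_dsg P v Cu).
have N1 := Hf K1 dK1 (fun u Cu => patch_dk1 P Cu).
have N2 := Hf sn dsn psn.
apply: (chart_near (Ac hc) Dp).
have N3 : nbhs (chart_map c p) (chart_cod c) by exact: open_nbhs_nbhs.
apply: filterS (filterI (filterI N1 N2) N3) => u [[[_ E1] [_ E2]] Cu].
by congr (_, _); [exact: E1|exact: E2].
Qed.

Lemma global_profile (p0 : M) : exists (S : R -> R) (I J : set R) (a1 a2 : R -> R),
  [/\ profile I a1 a2, open J, smooth_on J S & forall q,
    [/\ J (height q), I (S (height q)) /\ a2 (S (height q)) = height q,
     0 < cosh (a1 (S (height q))), 0 < sinh (a1 (S (height q))) &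
     cosh (a1 (S (height q))) ^+ 2 = (1 - m q ^+ 2)^-1 /\
     sinh (a1 (S (height q))) ^+ 2 = m q ^+ 2 / (1 - m q ^+ 2)]].
Proof.
have [f [J [oJ iJ sJ HJ]]] := unique_continuation (K := fun q => (k1 q, sg q))
  (@profile_sol_local R Dk f1 f2)
  (fun f g J t0 => @profile_sol_unique R Dk f1 f2 (hs_D H) (hs_f1 H) (hs_f2 H) f g J t0)
  height_continuous cM profile_germ height_open p0.
have [S [I [a1 [a2 [HI sS HS]]]]] := profile_curve (hs_D H) (hs_f1 H) (hs_f2 H) oJ iJ sJ.
exists S, I, J, a1, a2; split=> // q; have [Jq Kq] := HJ q.
have [h1 h2 h3 h4] := HS _ Jq.
rewrite -Kq /= (curvature_admissible q).2.
by move=> h5; split.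
Qed.

End Ordered.

End Hypersurface.

(** * Lorentz frames and isometries *)

Section LorentzFrame.
Context {R : realType}.
Notation E5 := 'rV[R]_5.

Record lorentz_frame (a b c d : E5) : Prop := LorentzFrame {
  lf_aa : lor a a = -1; lf_bb : lor b b = 1; lf_cc : lor c c = 1; lf_dd : lor d d = 1;
  lf_ab : lor a b = 0; lf_ac : lor a c = 0; lf_ad : lor a d = 0;
  lf_bc : lor b c = 0; lf_bd : lor b d = 0; lf_cd : lor c d = 0;
  lf_a5 : lor a e5 = 0; lf_b5 : lor b e5 = 0; lf_c5 : lor c e5 = 0; lf_d5 : lor d e5 = 0;
  lf_pos : 0 < a 0 0 }.

(** The reversed Cauchy-Schwarz inequality for future directed vectors, through Lagrange's
    identity. *)
Lemma future_pairing (p a : E5) : H3R p -> lor a a = -1 -> lor a e5 = 0 -> 0 < a 0 0 ->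
  lor p a < 0.
Proof.
move=> [E p0]; rewrite lor_e5 !lorE => aa a5 a0; rewrite a5 in aa *.
move: (p 0 0) (p 0 1) (p 0 2) (p 0 3) (p 0 4) (a 0 0) (a 0 1) (a 0 2) (a 0 3) E p0 aa a0.
move=> t x y z h s u v w E t0 aa s0.
set q := x * u + y * v + z * w.
have lag : q ^+ 2 + (x * v - y * u) ^+ 2 + (x * w - z * u) ^+ 2 + (y * w - z * v) ^+ 2 =
    (x ^+ 2 + y ^+ 2 + z ^+ 2) * (u ^+ 2 + v ^+ 2 + w ^+ 2) by rewrite /q; ring.
have et : x ^+ 2 + y ^+ 2 + z ^+ 2 = t ^+ 2 - 1 by lra.
have es : u ^+ 2 + v ^+ 2 + w ^+ 2 = s ^+ 2 - 1 by lra.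
rewrite et es in lag.
have n1 := sqr_ge0 (x * v - y * u); have n2 := sqr_ge0 (x * w - z * u).
have n3 := sqr_ge0 (y * w - z * v).
have m1 := sqr_ge0 x; have m2 := sqr_ge0 y; have m3 := sqr_ge0 z.
have m4 := sqr_ge0 u; have m5 := sqr_ge0 v; have m6 := sqr_ge0 w.
have qts : q ^+ 2 < (t * s) ^+ 2.
  have -> : (t * s) ^+ 2 = (t ^+ 2 - 1) * (s ^+ 2 - 1) + (t ^+ 2 + s ^+ 2 - 1) by ring.
  lra.
have ts : 0 < t * s by rewrite mulr_gt0.
have qlt : q < t * s by have [//|h'] := ltP q (t * s); nra.
rewrite mulr0 addr0; move: qlt; rewrite /q; lra.
Qed.

Section FrameMap.
Variables (a b c d : E5).
Hypothesis F : lorentz_frame a b c d.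

Definition frame_map (v : E5) : E5 :=
  \row_j [:: - lor v a; lor v b; lor v c; lor v d; lor v e5]`_j.

Let e55 : lor (e5 : E5) e5 = 1 := lor_e55.
Let N1 : (-1 : R) != 0. Proof. by rewrite oppr_eq0 oner_eq0. Qed.
Let P1 : (1 : R) != 0. Proof. exact: oner_neq0. Qed.

Lemma frame_map_lor u v : lor (frame_map u) (frame_map v) = lor u v.
Proof.
rewrite (frame_parseval (lf_ab F) (lf_ac F) (lf_ad F) (lf_a5 F) (lf_bc F) (lf_bd F)
  (lf_b5 F) (lf_cd F) (lf_c5 F) (lf_d5 F) (lf_aa F) (lf_bb F) (lf_cc F) (lf_dd F) e55
  N1 P1 P1 P1 P1 u v).
by rewrite lorE !mxE /= invrN1 !divr1; ring.
Qed.

Lemma frame_map_inj : injective frame_map.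
Proof.
move=> u v E; have C (j : 'I_5) := congr1 (fun w : E5 => w 0 j) E.
have := C 0; have := C 1; have := C 2; have := C 3; have := C 4; rewrite !mxE /=.
move=> c4 c3 c2 c1 /oppr_inj c0.
have X := frame_expand (lf_ab F) (lf_ac F) (lf_ad F) (lf_a5 F) (lf_bc F) (lf_bd F)
  (lf_b5 F) (lf_cd F) (lf_c5 F) (lf_d5 F) (lf_aa F) (lf_bb F) (lf_cc F) (lf_dd F) e55
  N1 P1 P1 P1 P1.
by rewrite (X u) (X v) c0 c1 c2 c3 c4.
Qed.

Lemma frame_map_surj y : exists v, frame_map v = y.
Proof.
exists (y 0 0 *: a + y 0 1 *: b + y 0 2 *: c + y 0 3 *: d + y 0 4 *: e5).
apply/rowP => j; rewrite mxE; move: j; case: F => aa bb cc dd ab ac ad bc bd cd a5 b5 c5 d5 _.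
apply: ord5P; rewrite /= !lorD.
- by rewrite aa (lorC b) ab (lorC c) ac (lorC d) ad (lorC e5) a5; ring.
- by rewrite ab bb (lorC c) bc (lorC d) bd (lorC e5) b5; ring.
- by rewrite ac bc cc (lorC d) cd (lorC e5) c5; ring.
- by rewrite ad bd cd dd (lorC e5) d5; ring.
- by rewrite a5 b5 c5 d5 e55; ring.
Qed.

Lemma H3R_lor (p : E5) : H3R p <-> lor p p = p 0 4 ^+ 2 - 1 /\ 0 < p 0 0.
Proof. by rewrite lorE /H3R /=; split=> -[E p0]; split=> //; lra. Qed.

Lemma frame_map4 v : frame_map v 0 4 = v 0 4.
Proof. by rewrite mxE /= lor_e5. Qed.

Lemma frame_map_H3R v : H3R v -> H3R (frame_map v).
Proof.
move=> Hv; have [E p0] := (H3R_lor v).1 Hv.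
apply/H3R_lor; rewrite frame_map_lor frame_map4; split=> //.
by rewrite mxE /= oppr_gt0; apply: (future_pairing Hv (lf_aa F) (lf_a5 F) (lf_pos F)).
Qed.

Lemma frame_map_H3R_inv v : H3R (frame_map v) -> H3R v.
Proof.
move=> /H3R_lor; rewrite frame_map_lor frame_map4 => -[E].
rewrite mxE /= oppr_gt0 => va; apply/H3R_lor; split=> //.
have [//|v0|v0] := ltgtP 0 (v 0 0).
  have Hn : H3R (- v) by apply/H3R_lor; rewrite lorNl lorNr opprK E !mxE sqrrN oppr_gt0.
  have := future_pairing Hn (lf_aa F) (lf_a5 F) (lf_pos F); rewrite lorNl oppr_lt0.
  by move=> /lt_trans/(_ va); rewrite ltxx.
exfalso; move: E; rewrite lorE -v0.
have := sqr_ge0 (v 0 1); have := sqr_ge0 (v 0 2); have := sqr_ge0 (v 0 3); lra.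
Qed.

Lemma smooth_lor_cst (w : E5) : smooth_on setT (fun v : E5 => lor v w).
Proof.
move=> k; apply: (Ck_on_lor (f := id) openT); first exact: Ck_on_id.
exact: Ck_on_cst.
Qed.

Lemma derive_lor_lin (w p u : E5) : 'D_u (fun v : E5 => lor v w) p = lor u w.
Proof.
have did : differentiable (fun v : E5 => v) p by [].
have dw : differentiable (fun=> w : E5) p by exact: differentiable_cst.
apply: etrans (derive_lor u did dw) _.
by rewrite derive_cst lor0r addr0 derive_id.
Qed.

Lemma smooth_frame_map : smooth_on setT frame_map.
Proof.
move=> k; apply/Ck_on_rowP; first exact: openT.
have E (j : 'I_5) (f : E5 -> R) : Ck_on k setT f -> (forall v, f v = frame_map v 0 j) ->
    Ck_on k setT (fun v => frame_map v 0 j).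
  by move=> Cf fE; apply: (Ck_on_eq openT (fun v _ => fE v)).
apply: ord5P.
- apply: (E _ (fun v => - lor v a)); last by move=> v; rewrite mxE.
  by apply: (Ck_onN openT); exact: smooth_lor_cst.
- by apply: (E _ (fun v => lor v b)); [exact: smooth_lor_cst|move=> v; rewrite mxE].
- by apply: (E _ (fun v => lor v c)); [exact: smooth_lor_cst|move=> v; rewrite mxE].
- by apply: (E _ (fun v => lor v d)); [exact: smooth_lor_cst|move=> v; rewrite mxE].
- by apply: (E _ (fun v => lor v e5)); [exact: smooth_lor_cst|move=> v; rewrite mxE].
Qed.

Lemma derive_frame_map p u : 'D_u frame_map p = frame_map u.
Proof.
have dF : differentiable frame_map p := smooth_diff smooth_frame_map (I : setT p).
have E (j : 'I_5) (f : E5 -> R) y : (forall v, frame_map v 0 j = f v) -> 'D_u f p = y ->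
    ('D_u frame_map p) 0 j = y.
  move=> fE <-; rewrite (derive_row u j dF).
  exact: (derive_eq_on u openT (I : setT p) (fun v _ => fE v)).
apply/rowP => j; rewrite [RHS]mxE; move: j; apply: ord5P.
- apply: (E _ (fun v => - lor v a)); first by move=> v; rewrite mxE.
  have da := smooth_diff (smooth_lor_cst a) (I : setT p).
  have := deriveB2 u (differentiable_cst (0 : R) p) da.
  rewrite derive_cst sub0r derive_lor_lin => <-.
  by apply: (derive_eq_on u openT (I : setT p)) => v _; rewrite sub0r.
- by apply: (E _ (fun v => lor v b)); [move=> v; rewrite mxE|exact: derive_lor_lin].
- by apply: (E _ (fun v => lor v c)); [move=> v; rewrite mxE|exact: derive_lor_lin].
- by apply: (E _ (fun v => lor v d)); [move=> v; rewrite mxE|exact: derive_lor_lin].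
- by apply: (E _ (fun v => lor v e5)); [move=> v; rewrite mxE|exact: derive_lor_lin].
Qed.

Lemma frame_map_isometry : isometry_H3R frame_map.
Proof.
split.
- split.
  + by move=> v; exact: frame_map_H3R.
  + by move=> u v _ _; exact: frame_map_inj.
  + by move=> y Hy; have [v E] := frame_map_surj y; exists v => //; apply: frame_map_H3R_inv; rewrite E.
- by exists setT; split; [exact: openT| |exact: smooth_frame_map].
- by move=> p u v _ _ _; rewrite !derive_frame_map frame_map_lor.
Qed.

End FrameMap.
End LorentzFrame.

(** * The principal plane is the same at all points *)

(** A hyperbolic rotation of the pair [(X0, xi)] by the angle [- artanh m], completed by the
    two normalised principal directions. *)
Lemma tilted_frame (R : realType) (X0 xi E2 E3 : 'rV[R]_5) (m : R) :
  m ^+ 2 < 1 -> 0 < X0 0 0 -> 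
  lor X0 X0 = -1 -> lor xi xi = 1 -> lor X0 xi = 0 -> lor X0 e5 = 0 -> lor xi e5 = 0 ->
  lor X0 E2 = 0 -> lor X0 E3 = 0 -> lor xi E2 = 0 -> lor xi E3 = 0 ->
  lor E2 e5 = 0 -> lor E3 e5 = 0 -> lor E2 E3 = 0 -> 0 < lor E2 E2 -> 0 < lor E3 E3 ->
  lor X0 X0 = X0 0 4 ^+ 2 - 1 ->
  let w := (Num.sqrt (1 - m ^+ 2))^-1 in
  lorentz_frame (w *: (X0 - m *: xi)) ((Num.sqrt (lor E2 E2))^-1 *: E2)
    (w *: (xi - m *: X0)) ((Num.sqrt (lor E3 E3))^-1 *: E3).
Proof.
move=> m1 p0 XX xx Xx X5 x5 X2 X3 x2 x3 E25 E35 E23 n2 n3 HX w.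
have s0 : 0 < 1 - m ^+ 2 by lra.
have ww : w * w * (1 - m ^+ 2) = 1.
  by rewrite /w -invfM -expr2 sqr_sqrtr ?mulVf ?gt_eqF// ltW.
have unit z : 0 < z -> (Num.sqrt z)^-1 * ((Num.sqrt z)^-1 * z) = 1 :> R.
  move=> z0; rewrite mulrA -invfM -expr2 sqr_sqrtr ?mulVf ?gt_eqF//; exact: ltW.
have aa : lor (w *: (X0 - m *: xi)) (w *: (X0 - m *: xi)) = -1.
  by rewrite !lorD XX xx Xx (lorC xi) Xx; rewrite -[RHS]mulN1r -[X in _ = _ * X]ww; ring.
have a5 : lor (w *: (X0 - m *: xi)) e5 = 0 by rewrite !lorD X5 x5; ring.
split.
- exact: aa.
- by rewrite lorZl lorZr unit.
- by rewrite !lorD XX xx Xx (lorC xi) Xx; rewrite -[RHS]ww; ring.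
- by rewrite lorZl lorZr unit.
- by rewrite !lorD X2 x2; ring.
- by rewrite !lorD XX xx Xx (lorC xi) Xx; ring.
- by rewrite !lorD X3 x3; ring.
- by rewrite !lorD (lorC E2) x2 (lorC E2) X2; ring.
- by rewrite !lorD E23; ring.
- by rewrite !lorD x3 X3; ring.
- exact: a5.
- by rewrite lorZl E25 mulr0.
- by rewrite !lorD X5 x5; ring.
- by rewrite lorZl E35 mulr0.
have w0 : 0 < w by rewrite /w invr_gt0 sqrtr_gt0.
have HX0 : H3R X0 by apply/H3R_lor.
set a := w *: _ in aa a5 *.
have Xa : lor X0 a = - w by rewrite /a lorZr lorBr lorZr XX Xx; ring.
have [//|a0|a0] := ltgtP 0 (a 0 0).
  have := future_pairing HX0 (_ : lor (- a) (- a) = -1) (_ : lor (- a) e5 = 0).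
  rewrite lorNr lorNl opprK aa lorNl a5 oppr0 lorNr Xa opprK mxE oppr_gt0.
  by move=> /(_ erefl erefl a0) /lt_trans/(_ w0); rewrite ltxx.
exfalso; move: aa a5; rewrite lor_e5 lorE -a0 => aa a5; rewrite a5 in aa.
move: aa (sqr_ge0 (a 0 1)) (sqr_ge0 (a 0 2)) (sqr_ge0 (a 0 3)); lra.
Qed.

Section PrincipalPlane.
Context {R : realType} {M : topologicalType}.
Variables (A : set (chart R M)) (x N T : M -> 'rV[R]_5) (sigma k1 k2 k3 : M -> R).
Variables (Dk : set R) (f1 f2 : R -> R).
Hypothesis H : hypersurface A x N T sigma k1 k2 k3 Dk f1 f2.

Let atlas : smooth_atlas A. Proof. by case: (hs_M H). Qed.
Let cM : connected [set: M]. Proof. by case: (hs_M H). Qed.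
Let Ac c : A c -> is_chart c. Proof. by case: atlas => h _ _; exact: h. Qed.
Let at_chart p : exists2 c, A c & chart_dom c p. Proof. by case: atlas => _ h _; exact: h. Qed.
Let sx c : A c -> smooth_on (chart_cod c) (x \o chart_inv c).
Proof. by move=> hc; exact: pp_X (hypersurface_patch H hc). Qed.
Let sN c : A c -> smooth_on (chart_cod c) (N \o chart_inv c).
Proof. by move=> hc; exact: pp_n (hypersurface_patch H hc). Qed.
Let inv_map c p : A c -> chart_dom c p -> chart_inv c (chart_map c p) = p.
Proof. by move=> /Ac[_ _ K _ _]; exact: K. Qed.

(** A principal direction for [k2] as a vector of the ambient space, which does not depend on
    the chart used to find it. *)
Definition curvature_direction p (E : 'rV[R]_5) := E != 0 /\ exists c t,
  [/\ A c, chart_dom c p, E = 'D_t (x \o chart_inv c) (chart_map c p) &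
      weingarten (x \o chart_inv c) (N \o chart_inv c) (k2 p) (chart_map c p) t].

Lemma direction_in_chart p E c : curvature_direction p E -> A c -> chart_dom c p ->
  exists t, [/\ t != 0, 'D_t (x \o chart_inv c) (chart_map c p) = E &
    weingarten (x \o chart_inv c) (N \o chart_inv c) (k2 p) (chart_map c p) t].
Proof.
move=> [E0 [c' [t' [hc' Dp' EE W]]]] hc Dp.
have [st _] : compatible c' c by case: atlas => _ _ h; exact: h.
have ch (f : M -> 'rV[R]_5) := derive_chart_change t' (Ac hc) (Ac hc') st Dp Dp' (f := f).
set t := 'D_t' (chart_map c \o chart_inv c') (chart_map c' p) in ch.
exists t; split.
- by move: E0; apply: contraNneq => t0; rewrite EE (ch x (sx hc)) t0 derive0.
- by rewrite EE (ch x (sx hc)).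
move: W; rewrite /weingarten (ch x (sx hc)) (ch N (sN hc)) /=.
by rewrite (inv_map hc Dp) (inv_map hc' Dp').
Qed.

Lemma frame_at p : exists c t2 t3, [/\ A c, chart_dom c p &
  exists t1, patch_frame (x \o chart_inv c) (N \o chart_inv c) (k1 \o chart_inv c)
    (k2 \o chart_inv c) (k3 \o chart_inv c) (chart_map c p) t1 t2 t3].
Proof.
have [c hc Dp] := at_chart p; have P := hypersurface_patch H hc.
have [t1 [t2 [t3 F]]] := pp_frames P (chart_cod_map Dp).
by exists c, t2, t3; split=> //; exists t1.
Qed.

Lemma direction_exists p : exists E, curvature_direction p E.
Proof.
have [c [t2 [t3 [hc Dp [t1 F]]]]] := frame_at p; have P := hypersurface_patch H hc.
exists ('D_t2 (x \o chart_inv c) (chart_map c p)); split.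
  by apply: contraNneq (pa_t2 F) => /(pp_free P (chart_cod_map Dp)) ->.
by exists c, t2; split=> //; have := pa_2 F; rewrite /= (inv_map hc Dp).
Qed.

Let plane p E v := plane_form (x p) (N p) (k2 p) E v.

Lemma plane_locally_constant (p : M) : exists L : 'rV[R]_5 -> R,
  \forall q \near p, forall E v, curvature_direction q E -> plane q E v = L v.
Proof.
have [c hc Dp] := at_chart p; have P := hypersurface_patch H hc.
have [E dE] := direction_exists p.
have [t [t0 Et W]] := direction_in_chart dE hc Dp.
exists (plane p E).
have ic := inv_map hc Dp.
have W' : weingarten (x \o chart_inv c) (N \o chart_inv c) ((k2 \o chart_inv c) (chart_map c p))
    (chart_map c p) t by rewrite /= ic.
have N1 := plane_form_locally_constant P (chart_cod_map Dp) t0 W'.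
have N2 : nbhs (chart_map c p) (chart_cod c).
  by apply: open_nbhs_nbhs; split; [exact: pp_open P|exact: chart_cod_map].
apply: (chart_near (Ac hc) Dp); apply: filterS (filterI N1 N2) => u [Hu Cu] E' v dE'.
have [Dq Eq] := chart_codP (Ac hc) Cu.
have [t' [t'0 Et' Wt']] := direction_in_chart dE' hc Dq.
rewrite Eq in Et' Wt'.
have := Hu t' t'0 Wt' v; rewrite Et' Et /= ic; exact.
Qed.

Lemma plane_constant p0 E0 : curvature_direction p0 E0 -> forall q E v,
  curvature_direction q E -> plane q E v = plane p0 E0 v.
Proof.
move=> d0; pose P q := forall E v, curvature_direction q E -> plane q E v = plane p0 E0 v.
suff HP : forall q, P q by move=> q E v; exact: HP.
apply: (@locally_constant_connected _ P p0 cM).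
  move=> p; have [L HL] := plane_locally_constant p.
  exists [set q | forall E v, curvature_direction q E -> plane q E v = L v]; first exact: HL.
  move=> q q' Hq Hq' Pq E' v dE'; have [E dE] := direction_exists q.
  by rewrite (Hq' E' v dE') -(Hq E v dE) (Pq E v dE).
move=> E v dE; have [L /nbhs_singleton HL] := plane_locally_constant p0.
by rewrite (HL E v dE) (HL E0 v d0).
Qed.

Let m p : R := k2 p * tilt (N p).

Lemma direction_orthogonal p E : curvature_direction p E ->
  lor E (nu (x p)) = 0 /\ lor E e5 = 0.
Proof.
move=> dE; have [c hc Dp] := at_chart p; have P := hypersurface_patch H hc.
have [t [t0 Et W]] := direction_in_chart dE hc Dp.
have Du := chart_cod_map Dp; have ic := inv_map hc Dp.
have [t1 [t2 [t3 F]]] := pp_frames P Du.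
have W' : weingarten (x \o chart_inv c) (N \o chart_inv c) ((k2 \o chart_inv c) (chart_map c p))
    (chart_map c p) t by rewrite /= ic.
have F' := PatchFrame (pa_t1 F) t0 (pa_t3 F) (pa_T F) (pa_1 F) W' (pa_3 F).
split.
  have := nu_derive (pp_open P) (pp_X P) t (pp_H3R P) Du.
  by rewrite Et /= ic lorC.
have := patch_h2 P Du F'; rewrite (derive_coord (pp_X P) 4 t Du) Et.
by rewrite -lor_e5.
Qed.

(** The position is orthogonal to the principal direction, and pairs to -1 with [centre]. *)
Lemma plane_at_position p E : curvature_direction p E -> plane p E (x p) = - (1 - m p ^+ 2)^-1.
Proof.
move=> dE; have [EX E5] := direction_orthogonal dE.
have [c hc Dp] := at_chart p; have P := hypersurface_patch H hc.
have Du := chart_cod_map Dp; have ic := inv_map hc Dp.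
have XX := H3R_nu (pp_H3R P Du); have Xxi := patch_Xxi P Du;
rewrite /= ic in XX Xxi.
have xE : x p = nu (x p) + x p 0 4 *: e5 by rewrite nuE subrK.
have e1 : lor E (x p) = 0 by rewrite [X in lor _ X]xE lorDr lorZr EX E5 mulr0 addr0.
have e2 : lor (centre (x p) (N p) (k2 p)) (x p) = -1.
  rewrite /centre [X in lor _ X]xE lorBl lorZl !lorDr !lorZr XX nu5 [lor (horizontal _) (nu _)]lorC Xxi.
  by rewrite horizontal5; ring.
by rewrite /plane /plane_form e1 e2 mulr0 mul0r sub0r mulrNN mulr1 mul1r -expr2.
Qed.

(** In the frame adapted to the plane at [p0], the constant quadratic form is [y_1^2 - y_0^2];
    its value at the position is given by [plane_at_position]. *)
Lemma global_frame (p0 : M) : (forall p : M, m p ^+ 2 < 1) -> exists a b c d, lorentz_frame a b c d /\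
  forall q, let y := frame_map a b c d (x q) in
    y 0 0 ^+ 2 - y 0 1 ^+ 2 = (1 - m q ^+ 2)^-1.
Proof.
move=> m1.
have [c [t2 [t3 [hc Dp [t1 F]]]]] := frame_at p0; have P := hypersurface_patch H hc.
have Du := chart_cod_map Dp; have ic := inv_map hc Dp.
set X := x \o chart_inv c in P F; set n := N \o chart_inv c in P F.
set u := chart_map c p0 in Du F ic.
set E2 := 'D_t2 X u; set E3 := 'D_t3 X u.
have d2 : curvature_direction p0 E2.
  split; first by apply: contraNneq (pa_t2 F) => /(pp_free P Du) ->.
  by exists c, t2; split=> //; have := pa_2 F; rewrite /= ic.
have XX : lor (nu (X u)) (nu (X u)) = -1 := H3R_nu (pp_H3R P Du).
have xx : lor (horizontal (n u)) (horizontal (n u)) = 1 := patch_xixi P Du.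
have Xxi : lor (nu (X u)) (horizontal (n u)) = 0 := patch_Xxi P Du.
have xi5 : lor (horizontal (n u)) e5 = 0 := horizontal5 _.
have h2 : lor E2 e5 = 0.
  have := patch_h2 P Du F; rewrite (derive_coord (pp_X P) 4 t2 Du).
  by rewrite -lor_e5.
have h3 : lor E3 e5 = 0.
  have := patch_h3 P Du F; rewrite (derive_coord (pp_X P) 4 t3 Du).
  by rewrite -lor_e5.
have xiE t : lor ('D_t X u) e5 = 0 -> lor (horizontal (n u)) ('D_t X u) = 0.
  move=> t5; have nX := pp_nX P t Du.
  by rewrite /horizontal lorZl lorBl lorZl nX (lorC e5) t5; ring.
have FR := @tilted_frame R (nu (X u)) (horizontal (n u)) E2 E3 (m p0) (m1 p0) _ XX xx Xxi
  (nu5 _) xi5 (nu_derive (pp_open P) (pp_X P) t2 (pp_H3R P) Du)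
  (nu_derive (pp_open P) (pp_X P) t3 (pp_H3R P) Du) (xiE t2 h2) (xiE t3 h3) h2 h3
  (principal_orthogonal P Du (pa_2 F) (pa_3 F) (pp_k23 P Du))
  (patch_DX_pos P Du (pa_t2 F)) (patch_DX_pos P Du (pa_t3 F)).
have p0X : 0 < nu (X u) 0 0 by rewrite mxE; case: (pp_H3R P Du).
have nu4 : lor (nu (X u)) (nu (X u)) = nu (X u) 0 4 ^+ 2 - 1.
  by rewrite XX [X in _ = X ^+ 2 - 1]mxE expr0n sub0r.
have {FR} FR := FR p0X nu4.
eexists _, _, _, _; split; first exact: FR.
move=> q y; have [E dE] := direction_exists q.
have Q1 := plane_at_position dE; have Q2 := plane_constant d2 (x q) dE.
rewrite Q1 in Q2.
rewrite /y /frame_map !mxE /=; apply: oppr_inj; rewrite Q2 /plane /plane_form.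
have s0 : 0 < 1 - m p0 ^+ 2 by rewrite subr_gt0.
have sq z : 0 < z -> (Num.sqrt z)^-1 ^+ 2 = z^-1 :> R.
  by move=> z0; rewrite exprVn sqr_sqrtr// ltW.
have n2 : 0 < lor E2 E2 := patch_DX_pos P Du (pa_t2 F).
have cE : centre (x p0) (N p0) (k2 p0) = nu (X u) - m p0 *: horizontal (n u).
  by rewrite /centre /X /n /= ic.
rewrite cE (lorC E2 (x q)) (lorC (nu (X u) - _) (x q)) 2!lorZr -/(m p0).
move: (lor (x q) _) (lor (x q) E2) (sq _ s0) (sq _ n2) => B C.
move: (m p0) (lor E2 E2) => k l.
move: (Num.sqrt (1 - k ^+ 2))^-1 (Num.sqrt l)^-1 => w v ew ev.
transitivity (v ^+ 2 * (C * C) - w ^+ 2 * (B * B)); first by ring.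
by rewrite ew ev expr2; ring.
Qed.

End PrincipalPlane.

(** * Change of chart, hyperbolic and polar angles *)

Section Reparametrize.
Context {R : realType} {M : topologicalType}.
Variables (A : set (chart R M)) (c0 : chart R M) (F G : 'rV[R]_3 -> 'rV[R]_3) (B : set 'rV[R]_3).
Hypotheses (atlas : smooth_atlas A) (h0 : A c0).
Hypotheses (oB : open B) (BD : B `<=` chart_cod c0).
Hypotheses (sF : smooth_on B F) (oFB : open (F @` B)).
Hypotheses (GK : forall u, B u -> G (F u) = u) (sG : smooth_on (F @` B) G).

Definition new_chart : chart R M :=
  Chart (chart_dom c0 `&` [set q | B (chart_map c0 q)]) (F \o chart_map c0) (chart_inv c0 \o G).

Let ic0 : is_chart c0. Proof. by case: atlas => h _ _; exact: h. Qed.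

Lemma new_chart_cod : chart_cod new_chart = F @` B.
Proof.
apply/seteqP; split=> [_ [q [Dq Bq] <-]|_ [u Bu <-]] /=; first by exists (chart_map c0 q).
have [Dq Eq] := chart_codP ic0 (BD Bu).
by exists (chart_inv c0 u) => /=; [split=> //=; rewrite Eq|rewrite Eq].
Qed.

Lemma new_chart_is_chart : is_chart new_chart.
Proof.
have [oD _ K cm ci] := ic0; split.
- rewrite openE => q [Dq Bq]; rewrite /interior /=.
  have N1 : nbhs q (chart_dom c0) by exact: open_nbhs_nbhs.
  have N2 : nbhs q (chart_map c0 @^-1` B) by apply: (cm q Dq); exact: open_nbhs_nbhs.
  exact: filterI N1 N2.
- by rewrite new_chart_cod.
- by move=> q [Dq Bq] /=; rewrite GK// K.
- move=> q [Dq Bq]; apply: continuous_comp; first exact: cm.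
  exact: Ck_on_cont (sF 0%N) Bq.
move=> z; rewrite new_chart_cod => -[u Bu <-].
apply: continuous_comp; first by apply: Ck_on_cont (sG 0%N) _; exists u.
by rewrite GK//; apply: ci; exact: BD.
Qed.

Lemma new_chart_smooth : smooth_chart A new_chart.
Proof.
split; first exact: new_chart_is_chart.
move=> c' hc'; have [_ _ comp] := atlas; have [st1 st2] := comp c0 c' h0 hc'.
have ic' : is_chart c' by case: atlas => h _ _; exact: h.
have [oD _ K _ _] := ic0; have [oD' _ K' _ _] := ic'.
have [oDn _ _ _ _] := new_chart_is_chart.
split=> k.
  have oW := chart_image_open new_chart_is_chart oD'.
  apply: (Ck_on_comp (g := chart_map c' \o chart_inv c0) (f := G) oW _ (st1 k)).
    by move=> _ [q [[Dq Bq] Dq'] <-] /=; rewrite GK//; exists q.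
  apply: (Ck_on_sub _ (sG k)) => _ [q [[Dq Bq] Dq'] <-] /=.
  by exists (chart_map c0 q).
have oW := chart_image_open ic' oDn.
apply: (Ck_on_comp (g := F) (f := chart_map c0 \o chart_inv c') oW _ (sF k)).
  by move=> _ [q [Dq' [Dq Bq]] <-] /=; rewrite K'.
apply: (Ck_on_sub _ (st2 k)) => _ [q [Dq' [Dq Bq]] <-].
by exists q.
Qed.

End Reparametrize.

Section Angles.
Context {R : realType}.
Implicit Types (y z C : R).

Lemma hyperbolic_angle (y0 y1 C : R) : 0 < y0 -> 0 < C -> C ^+ 2 = y0 ^+ 2 - y1 ^+ 2 ->
  let v := ln ((y0 + y1) / Num.sqrt (y0 ^+ 2 - y1 ^+ 2)) in
  [/\ 0 < y0 + y1, y0 = C * cosh v & y1 = C * sinh v].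
Proof.
move=> p0 C0 E v.
have sC : Num.sqrt (y0 ^+ 2 - y1 ^+ 2) = C by rewrite -E sqrtr_sqr ger0_norm// ltW.
have C2 : 0 < C ^+ 2 by rewrite exprn_gt0.
have fac : (y0 + y1) * (y0 - y1) = C ^+ 2 by rewrite E; ring.
have s0 : 0 < y0 + y1.
  have [//|h] := ltP 0 (y0 + y1).
  have h' : 0 < y0 - y1 by lra.
  have n : (y0 + y1) * (y0 - y1) <= 0 by rewrite mulr_le0_ge0// ltW.
  by rewrite fac in n; lra.
split=> //.
  have ev : expR v = (y0 + y1) / C by rewrite /v sC lnK// posrE divr_gt0.
  have Cn : C != 0 by rewrite gt_eqF.
  have sn : y0 + y1 != 0 by rewrite gt_eqF.
  rewrite /cosh expRN ev invf_div; apply: (mulIf sn).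
  have -> : C * (((y0 + y1) / C + C / (y0 + y1)) / 2) * (y0 + y1) =
    ((y0 + y1) ^+ 2 + C ^+ 2) / 2 by field; rewrite Cn sn.
  by rewrite E; field.
have ev : expR v = (y0 + y1) / C by rewrite /v sC lnK// posrE divr_gt0.
have Cn : C != 0 by rewrite gt_eqF.
have sn : y0 + y1 != 0 by rewrite gt_eqF.
rewrite /sinh expRN ev invf_div; apply: (mulIf sn).
have -> : C * (((y0 + y1) / C - C / (y0 + y1)) / 2) * (y0 + y1) =
  ((y0 + y1) ^+ 2 - C ^+ 2) / 2 by field; rewrite Cn sn.
by rewrite E; field.
Qed.

Lemma polar_exists (y z C : R) : 0 < C -> C ^+ 2 = y ^+ 2 + z ^+ 2 ->
  exists w, y = C * cos w /\ z = C * sin w.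
Proof.
move=> C0 E; have Cn : C != 0 by rewrite gt_eqF.
have yC : -1 <= y / C <= 1.
  rewrite -ler_norml normrM normfV (gtr0_norm C0) ler_pdivrMr// mul1r.
  rewrite -(ger0_norm (ltW C0)) -ler_sqr ?nnegrE// !real_normK ?num_real// E.
  by rewrite lerDl sqr_ge0.
have s2 : sin (acos (y / C)) = `|z| / C.
  rewrite sin_acos//; have -> : 1 - (y / C) ^+ 2 = (z / C) ^+ 2.
    rewrite !expr_div_n -[1](@divff _ (C ^+ 2)) ?expf_neq0// -mulrBl E; congr (_ / _); ring.
  by rewrite sqrtr_sqr normrM normfV (gtr0_norm C0).
have c2 : cos (acos (y / C)) = y / C by rewrite acosK.
have [z0|/ltW z0] := leP 0 z.
  exists (acos (y / C)); rewrite c2 s2 ger0_norm//.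
  by rewrite ![C * _]mulrC !divfK.
exists (- acos (y / C)); rewrite cosN sinN c2 s2 ler0_norm// mulNr opprK.
by rewrite ![C * _]mulrC !divfK.
Qed.

(** The arctangent measures the angle from the fixed vector [(a, b)], as long as [(y, z)] stays
    in the open half-plane around it. *)
Lemma polar_angle (a b y z C0 C w0 : R) : 0 < C0 -> 0 < C -> a = C0 * cos w0 -> b = C0 * sin w0 ->
  C ^+ 2 = y ^+ 2 + z ^+ 2 -> 0 < a * y + b * z ->
  let w := w0 + atan ((a * z - b * y) / (a * y + b * z)) in
  y = C * cos w /\ z = C * sin w.
Proof.
move=> C00 C_0 ea eb E p0 w; set X := a * y + b * z in p0 *.
set Y := a * z - b * y.
have ab : a ^+ 2 + b ^+ 2 = C0 ^+ 2.
  by rewrite ea eb !exprMn -mulrDr cos2Dsin2 mulr1.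
have XY : X ^+ 2 + Y ^+ 2 = (C0 * C) ^+ 2.
  by rewrite exprMn E -ab /X /Y; ring.
have Xn : X != 0 by rewrite gt_eqF.
have sq : Num.sqrt (1 + (Y / X) ^+ 2) = C0 * C / X.
  have -> : 1 + (Y / X) ^+ 2 = (C0 * C / X) ^+ 2.
    by rewrite [RHS]expr_div_n -XY; field.
  by rewrite sqrtr_sqr ger0_norm// ltW// divr_gt0// mulr_gt0.
have C0n : C0 != 0 by rewrite gt_eqF.
have Cn : C != 0 by rewrite gt_eqF.
have cw : cos (atan (Y / X)) = X / (C0 * C) by rewrite cos_atan sq invf_div.
have sw : sin (atan (Y / X)) = Y / (C0 * C).
  have : tan (atan (Y / X)) = Y / X by rewrite atanK.
  rewrite /tan cw => e; have cn : X / (C0 * C) != 0 by rewrite !mulf_neq0 ?invr_eq0 ?mulf_neq0.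
  by rewrite -[LHS](divfK cn) e; field; rewrite C0n Cn Xn.
have ea' : cos w0 = a / C0 by rewrite ea mulrC mulKf.
have eb' : sin w0 = b / C0 by rewrite eb mulrC mulKf.
have C2 : C0 ^+ 2 != 0 by rewrite expf_neq0.
rewrite /w cosD sinD cw sw ea' eb'; split; apply: (mulIf C2).
  transitivity (a * X - b * Y); first by rewrite -ab /X /Y; ring.
  by field; rewrite C0n Cn.
transitivity (b * X + a * Y); first by rewrite -ab /X /Y; ring.
by field; rewrite C0n Cn.
Qed.

End Angles.

(** * Adapted coordinates and the theorem *)

Lemma ord3P (P : 'I_3 -> Prop) : P 0 -> P 1 -> P 2 -> forall i, P i.
Proof.
move=> P0 P1 P2 [[|[|[|//]]] lt3].
- by rewrite (_ : Ordinal lt3 = 0)//; apply: val_inj.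
- by rewrite (_ : Ordinal lt3 = 1)//; apply: val_inj.
- by rewrite (_ : Ordinal lt3 = 2)//; apply: val_inj.
Qed.

Section ModelMap.
Context {R : realType}.
Variables (I : set R) (a1 a2 : R -> R).
Hypothesis prof : profile I a1 a2.

Definition model_map (z : 'rV[R]_3) := model a1 a2 (z 0 0) (z 0 1) (z 0 2).

Let diff1 (f : R -> R) (s f' : R) : is_derive s 1 f f' -> differentiable f s.
Proof. by move=> [d _]; apply/derivable1_diffP. Qed.

Lemma differentiable_cosh_sinh (s : R) : differentiable (@cosh R) s /\ differentiable (@sinh R) s.
Proof.
have de (t : R) : differentiable (@expR R) t by apply: diff1; exact: is_derive_expR.
have dN : differentiable (fun t : R => - t) s by exact: differentiableN.
have dE : differentiable (fun t : R => expR (- t)) s.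
  by apply: (differentiable_comp dN); exact: de.
have dc : differentiable (fun=> 2^-1 : R) s by exact: differentiable_cst.
by split; [apply: (differentiableM (differentiableD (de s) dE) dc)|
  apply: (differentiableM (differentiableB (de s) dE) dc)].
Qed.

Lemma differentiable_model_map (z : 'rV[R]_3) : I (z 0 0) -> differentiable model_map z.
Proof.
move=> Iz; have [oI _ sa1 sa2 _] := prof.
have coord (j : 'I_3) (f : R -> R) : differentiable f (z 0 j) ->
    differentiable (fun y : 'rV[R]_3 => f (y 0 j)) z.
  move=> df; have dj : differentiable (fun y : 'rV[R]_3 => y 0 j) z.
    by apply: (differentiable_rowP (fun y : 'rV[R]_3 => y) z).1.
  exact: (differentiable_comp dj df).
have d1 : differentiable a1 (z 0 0) := smooth_diff sa1 Iz.
have d2 : differentiable a2 (z 0 0) := smooth_diff sa2 Iz.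
have [dc _] := differentiable_cosh_sinh (a1 (z 0 0)).
have [_ ds] := differentiable_cosh_sinh (a1 (z 0 0)).
have dc1 := coord 0 (cosh \o a1) (differentiable_comp d1 dc).
have ds1 := coord 0 (sinh \o a1) (differentiable_comp d1 ds).
have [dcv dsv] := differentiable_cosh_sinh (z 0 1).
have dcv1 := coord 1 cosh dcv; have dsv1 := coord 1 sinh dsv.
have dcw := coord 2 cos (diff1 (is_derive_cos (z 0 2))).
have dsw := coord 2 sin (diff1 (is_derive_sin (z 0 2))).
have da := coord 0 a2 d2.
apply/differentiable_rowP => j.
have E (f : 'rV[R]_3 -> R) : differentiable f z -> (forall y, f y = model_map y 0 j) ->
    differentiable (fun y => model_map y 0 j) z.
  by move=> df fE; rewrite (_ : (fun y => _) = f)//; apply/funext => y; rewrite fE.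
move: j E; apply: ord5P => E.
- by apply: (E _ (differentiableM dc1 dcv1)) => y; rewrite mxE.
- by apply: (E _ (differentiableM dc1 dsv1)) => y; rewrite mxE.
- by apply: (E _ (differentiableM ds1 dcw)) => y; rewrite mxE.
- by apply: (E _ (differentiableM ds1 dsw)) => y; rewrite mxE.
- by apply: (E _ da) => y; rewrite mxE.
Qed.

End ModelMap.

Section ModelCharts.
Context {R : realType} {M : topologicalType}.
Variables (A : set (chart R M)) (x : M -> 'rV[R]_5) (a b c d : 'rV[R]_5).
Variables (S a1 a2 : R -> R) (I J : set R).
Hypothesis atlas : smooth_atlas A.
Hypothesis hx : immersion_H3R A x.
Hypothesis F : lorentz_frame a b c d.
Hypotheses (prof : profile I a1 a2) (sS : smooth_on J S).
Let Phi := frame_map a b c d.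
Let y p := Phi (x p).
Let s p := S (x p 0 4).
Hypothesis hJ : forall p, J (x p 0 4).
Hypothesis hI : forall p, I (s p).
Hypothesis ha2 : forall p, a2 (s p) = x p 0 4.
Hypothesis hcosh : forall p, 0 < cosh (a1 (s p)).
Hypothesis hcosh2 : forall p, cosh (a1 (s p)) ^+ 2 = y p 0 0 ^+ 2 - y p 0 1 ^+ 2.
Hypothesis hsinh : forall p, 0 < sinh (a1 (s p)).
Hypothesis hsinh2 : forall p, sinh (a1 (s p)) ^+ 2 = y p 0 2 ^+ 2 + y p 0 3 ^+ 2.

(** Near [p] take the arc length of the height, the hyperbolic angle of [(y_0, y_1)] and the
    polar angle of [(y_2, y_3)]. The model map sends these to [Phi \o x], an immersion, so
    their differential is injective and the inverse function theorem makes them a chart. *)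
Lemma model_charts : open_part_of_model A (Phi \o x) I a1 a2.
Proof.
move=> p; have [ac0 ac1 _] := atlas.
have [c0 h0 Dp] := ac1 p; have ic0 := ac0 _ h0.
have [sx xH imm] := hx; have sX := sx _ h0.
have [oD oC K cm ci] := ic0.
set D := chart_cod c0 in oC; pose X := x \o chart_inv c0; pose u0 := chart_map c0 p.
have Du0 : D u0 by exact: chart_cod_map.
pose Y u := Phi (X u).
have sY : smooth_on D Y.
  by move=> k; apply: (Ck_on_comp oC (fun _ _ => Logic.I) (smooth_frame_map a b c d k) (sX k)).
have sYj (j : 'I_5) : smooth_on D (fun u => Y u 0 j) := smooth_coord oC sY j.
have sh : smooth_on D (fun u => X u 0 4) := smooth_coord oC sX 4.
have E0 : Y u0 = y p by rewrite /Y /X /u0 /= K.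
set al := y p 0 2 in E0 *; set be := y p 0 3.
have [w0 [eal ebe]] := polar_exists (hsinh p) (hsinh2 p).
pose q2 u := al * Y u 0 2 + be * Y u 0 3.
pose q3 u := al * Y u 0 3 - be * Y u 0 2.
have sq2 : smooth_on D q2.
  by move=> k; apply: (Ck_onD oC); apply: (Ck_onM oC); solve [exact: Ck_on_cst | exact: sYj].
have sq3 : smooth_on D q3.
  by move=> k; apply: (Ck_onB oC); apply: (Ck_onM oC); solve [exact: Ck_on_cst | exact: sYj].
(* the half-plane condition of [polar_angle] *)
pose D' : set 'rV[R]_3 := D `&` [set u | 0 < q2 u].
have oD' : open D'.
  rewrite openE => u [Du qu]; rewrite /interior /=.
  have /cvgr_gt/(_ _ qu) N := Ck_on_cont (sq2 0%N) Du.
  have ND : nbhs u D by exact: open_nbhs_nbhs.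
  exact: filterI ND N.
have D'u0 : D' u0.
  split=> //=; rewrite /q2 E0 -/al -/be -!expr2.
  by have := hsinh2 p; rewrite -/al -/be => <-; rewrite exprn_gt0.
have yD u : D u -> Y u = y (chart_inv c0 u) by [].
have hyp u : D u -> [/\ 0 < Y u 0 0 + Y u 0 1, 0 < Y u 0 0 ^+ 2 - Y u 0 1 ^+ 2 & 0 < Y u 0 0].
  move=> Du; have Y0 : 0 < Y u 0 0 by case: (frame_map_H3R F (xH (chart_inv c0 u))).
  have [h1 _ _] := hyperbolic_angle Y0 (hcosh _) (hcosh2 (chart_inv c0 u)).
  by split=> //; rewrite -[X in _ < X](hcosh2 (chart_inv c0 u)) exprn_gt0.
pose v u : R := ln ((Y u 0 0 + Y u 0 1) / Num.sqrt (Y u 0 0 ^+ 2 - Y u 0 1 ^+ 2)).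
pose w u : R := w0 + atan (q3 u / q2 u).
pose Fu (u : 'rV[R]_3) : 'rV[R]_3 := \row_j [:: S (X u 0 4); v u; w u]`_j.
have sv : smooth_on D v.
  move=> k; apply: (Ck_on_comp1 (g := @ln R) oC _ (smooth_ln k)).
    by move=> u /hyp[h1 h2 _] /=; rewrite divr_gt0// sqrtr_gt0.
  apply: (Ck_onM oC); first by apply: (Ck_onD oC); exact: sYj.
  apply: (Ck_onV oC); first by move=> u /hyp[_ h2 _]; rewrite gt_eqF// sqrtr_gt0.
  apply: (Ck_on_sqrt oC); first by move=> u /hyp[].
  apply: (Ck_onB oC).
    by apply: (@Ck_on_eq _ _ _ k D (fun u => Y u 0 0 * Y u 0 0)) => //; apply: (Ck_onM oC); exact: sYj.
  by apply: (@Ck_on_eq _ _ _ k D (fun u => Y u 0 1 * Y u 0 1)) => //; apply: (Ck_onM oC); exact: sYj.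
have sw : smooth_on D' w.
  move=> k; apply: (Ck_onD oD'); first exact: Ck_on_cst.
  apply: (Ck_on_comp1 (g := @atan R) oD' (fun _ _ => Logic.I) (smooth_atan k)).
  apply: (Ck_onM oD'); first by apply: (Ck_on_sub _ (sq3 k)) => u [].
  apply: (Ck_onV oD'); first by move=> u [_ /lt0r_neq0].
  by apply: (Ck_on_sub _ (sq2 k)) => u [].
have sF : smooth_on D' Fu.
  move=> k; apply/Ck_on_rowP => // j.
  have E (f : 'rV[R]_3 -> R) : Ck_on k D' f -> (forall u, f u = Fu u 0 j) ->
      Ck_on k D' (fun u => Fu u 0 j).
    by move=> Cf fE; apply: (Ck_on_eq oD' (fun u _ => fE u)).
  move: j E; apply: ord3P => E.
  - apply: (E (fun u => S (X u 0 4))); last by move=> u; rewrite mxE.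
    apply: (Ck_on_comp1 (g := S) oD' _ (sS k)); first by move=> u _; exact: hJ.
    by apply: (Ck_on_sub _ (sh k)) => u [].
  - by apply: (E v); [apply: (Ck_on_sub _ (sv k)) => u []|move=> u; rewrite mxE].
  - by apply: (E w); [exact: sw|move=> u; rewrite mxE].
have YF u : D' u -> I (Fu u 0 0) /\ Y u = model_map a1 a2 (Fu u).
  move=> [Du qu]; set q := chart_inv c0 u.
  have Es : Fu u 0 0 = s q by rewrite mxE.
  split; first by rewrite Es.
  have [_ h2 h0'] := hyp u Du.
  have [_ e0 e1] := hyperbolic_angle h0' (hcosh q) (hcosh2 q).
  have [e2 e3] := polar_angle (hsinh p) (hsinh q) eal ebe (hsinh2 q) qu.
  have F1 : Fu u 0 1 = v u by rewrite mxE.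
  have F2 : Fu u 0 2 = w u by rewrite mxE.
  apply/rowP => j; rewrite /model_map Es F1 F2 [RHS]mxE.
  move: j; apply: ord5P => /=.
  - exact: e0.
  - exact: e1.
  - exact: e2.
  - exact: e3.
  by rewrite ha2 /Y /Phi frame_map4.
have dF u : D' u -> differentiable Fu u := smooth_diff sF.
have injF t : 'D_t Fu u0 = 0 -> t = 0.
  move=> Ft.
  have Z : 'D_t Y u0 = 0.
    rewrite (derive_eq_on (g := model_map a1 a2 \o Fu) t oD' D'u0); last by move=> u /YF[].
    have dm := differentiable_model_map prof (YF _ D'u0).1.
    by rewrite (derive_comp t (dF _ D'u0) dm) Ft derive0.
  have dX : differentiable X u0 := smooth_diff sX Du0.
  have dP : differentiable Phi (X u0) := smooth_diff (smooth_frame_map a b c d) (Logic.I : setT (X u0)).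
  have Z' : 'D_('D_t X u0) Phi (X u0) = 0 by rewrite -(derive_comp t dX dP).
  rewrite derive_frame_map in Z'.
  have X0 : 'D_t X u0 = 0.
    apply: (frame_map_inj F); rewrite Z'; apply/rowP => j; rewrite !mxE.
    by move: j; apply: ord5P; rewrite /= lor0l ?oppr0.
  have fr := imm _ _ h0 Dp.
  apply: (row_free_inj fr); rewrite mul0mx -X0.
  by rewrite (deriveEjacobian _ dX).
have uJ : 'J Fu u0 \in unitmx.
  rewrite -row_free_unit -kermx_eq0; apply/rowV0P => t /sub_kermxP.
  by rewrite -(deriveEjacobian _ (dF _ D'u0)) => /injF.
have ex := inverse_function oD' sF D'u0 uJ.
have [r [r0 [G [BD oOm GK sG]]]] := filter_ex (filterI (nbhs_right_gt (0 : R)) ex).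
have BD0 : ball u0 r `<=` chart_cod c0 by move=> u /BD[].
have sFB : smooth_on (ball u0 r) Fu by move=> k; exact: Ck_on_sub (sF k).
exists (new_chart c0 Fu G (ball u0 r)); split.
- exact: (new_chart_smooth atlas h0 (ball_open _ _) BD0 sFB oOm GK sG).
- by split=> //=; exact: ballxx.
move=> q [Dq Bq] z; have [h1 h2] := YF _ (BD _ Bq); split; first exact: h1.
by rewrite -[RHS]/(model_map a1 a2 (Fu (chart_map c0 q))) -h2 /Y /X /= K.
Qed.

End ModelCharts.

Section Assembly.
Context {R : realType} {M : topologicalType}.

Lemma hypersurface_swap (A : set (chart R M)) (x N T : M -> 'rV[R]_5) (sigma k1 k2 k3 : M -> R)
    (D : set R) (f1 f2 : R -> R) : hypersurface A x N T sigma k1 k2 k3 D f1 f2 ->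
  hypersurface A x N T sigma k1 k3 k2 D f2 f1.
Proof.
case=> hM hx hN hT hT0 hk2 hk3 h12 h13 h23 hST hD hk1D hf1 hf2 hr2 hr3; split=> //.
by move=> p; rewrite eq_sym.
Qed.

Definition is_model (A : set (chart R M)) (x : M -> 'rV[R]_5) :=
  exists (Phi : 'rV[R]_5 -> 'rV[R]_5) (I : set R) (a1 a2 : R -> R),
    [/\ isometry_H3R Phi, profile I a1 a2 & open_part_of_model A (Phi \o x) I a1 a2].

(** With [m2^2 < 1], the frame of [global_frame] and the profile of [global_profile] fit
    together: both express [cosh^2] and [sinh^2] through [m2]. *)
Lemma ordered_model (A : set (chart R M)) (x N T : M -> 'rV[R]_5) (sigma k1 k2 k3 : M -> R)
    (D : set R) (f1 f2 : R -> R) (p0 : M) :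
  hypersurface A x N T sigma k1 k2 k3 D f1 f2 ->
  (forall p, (k2 p * tilt (N p)) ^+ 2 < 1) -> is_model A x.
Proof.
move=> H m1; have [a [b [c [d [F HF]]]]] := global_frame H p0 m1.
have [S [I [J [a1 [a2 [prof oJ sS HS]]]]]] := global_profile H m1 p0.
exists (frame_map a b c d), I, a1, a2; split=> //; first exact: frame_map_isometry.
have atlas : smooth_atlas A by case: (hs_M H).
have xH q : H3R (x q) by case: (hs_x H) => _ h _; exact: h.
apply: (model_charts atlas (hs_x H) F prof sS) => q; have [h1 [h2 h3] h4 h5 [h6 h7]] := HS q => //.
  by rewrite HF; exact: h6.
have [E _] := frame_map_H3R F (xH q).
have n0 : 1 - (k2 q * tilt (N q)) ^+ 2 != 0 by rewrite subr_eq0 eq_sym lt_eqF.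
have -> : frame_map a b c d (x q) 0 2 ^+ 2 + frame_map a b c d (x q) 0 3 ^+ 2 =
    (1 - (k2 q * tilt (N q)) ^+ 2)^-1 - 1 by rewrite -HF; lra.
rewrite h7; set z := (k2 q * tilt (N q)) ^+ 2 in n0 *; by field.
Qed.

Lemma profile_set0 : profile (set0 : set R) id id.
Proof.
split; [exact: open0|by []|by move=> k; exact: Ck_on_id|by move=> k; exact: Ck_on_id|by []].
Qed.

End Assembly.

Theorem theorem3p9 (R : realType) (M : topologicalType) (A : set (chart R M))
    (x N T : M -> 'rV[R]_5) (sigma k1 k2 k3 : M -> R)
    (D : set R) (f1 f2 : R -> R)
    (hM : manifold3 A)
    (hx : immersion_H3R A x)
    (hN : unit_normal A x N)
    (hTtan : tangent_field A x T)
    (hT : forall p, e5 = T p + sigma p *: N p)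
    (hA : class_A A x N T)
    (hT0 : forall p, T p != 0)
    (hk1 : principal_curvature A x N k1)
    (hk2 : principal_curvature A x N k2)
    (hk3 : principal_curvature A x N k3)
    (hdist : forall p, [/\ k1 p != k2 p, k1 p != k3 p & k2 p != k3 p])
    (hST : shape_scales A x N T k1)
    (hD : open D)
    (hk1D : forall p, D (k1 p))
    (hf1 : smooth_on D f1)
    (hf2 : smooth_on D f2)
    (hrel2 : forall p, k2 p = f1 (k1 p))
    (hrel3 : forall p, k3 p = f2 (k1 p)) :
  exists (Phi : 'rV[R]_5 -> 'rV[R]_5) (I : set R) (a1 a2 : R -> R),
    [/\ isometry_H3R Phi, profile I a1 a2 &
        open_part_of_model A (Phi \o x) I a1 a2].
Proof.
have [[p0 _]|nM] := pselect (exists p : M, True); last first.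
  exists id, set0, id, id; split.
  - split.
    + by split=> [p|p q _ _|p Hp] //; exists p.
    + by exists setT; split; [exact: openT|by []|move=> k; exact: Ck_on_id].
    + by move=> p u v _ _ _; rewrite !derive_id.
  - exact: profile_set0.
  - by move=> p; exfalso; apply: nM; exists p.
have H : hypersurface A x N T sigma k1 k2 k3 D f1 f2.
  by split=> // p; have [] := hdist p.
have [m1|m1] := curvature_dichotomy H; first exact: ordered_model p0 H m1.
apply: (ordered_model p0 (hypersurface_swap H)) => p.
(* as [m2 m3 = 1], exchanging the two curvatures reverses the inequality *)
have E : (k2 p * tilt (N p)) ^+ 2 * (k3 p * tilt (N p)) ^+ 2 = 1.
  have e1 := tilt_sqr H p; have e2 := curvature_product H p.
  transitivity ((tilt (N p) ^+ 2 * (k2 p * k3 p)) ^+ 2); first by ring.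
  by rewrite e2 e1 expr1n.
have h2 := m1 p; set m2 := (k2 p * _) ^+ 2 in E h2; set m3 := (k3 p * _) ^+ 2 in E *.
have m30 : 0 <= m3 by exact: sqr_ge0.
by have [//|h] := ltP m3 1; nra.
Qed.
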